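(* Let $0<d<\pi/2$ and $\psi(\zeta)=\log(1+\mathrm{e}^{\pi\sinh\zeta})$. Assume that $f$ is analytic in $\psi(\mathscr{D}_d)$ and that there exist positive constants $K$ and $\mu$ with $\mu\le1$ such that $|f(z)|\le K|z^{\mu}\mathrm{e}^{-\mu z}|$ for all $z\in\psi(\mathscr{D}_d)$. For a positive integer $n$ let $h=\frac{\log(2dn/\mu)}{n}$, and let $n$ be sufficiently large that $n\ge(\mu\mathrm{e})/(2d)$. Then $$\sup_{t\in(0,\infty)}\left|f(t)-\sum_{k=-n}^{n}f(\psi(kh))\,S(k,h)(\psi^{-1}(t))\right|\le C\,\mathrm{e}^{-\pi dn/\log(2dn/\mu)},$$ where $$C=\frac{K}{\pi^{1-\mu}d\mu}\left\{\frac{4}{\pi(1-\mathrm{e}^{-\pi\mu\mathrm{e}})\{\cos(\frac{\pi}{2}\sin d)\}^{2\mu}\{\cos d\}^{\mu+1}}+\mu\,2^{1-\mu}\mathrm{e}^{\mu(\pi+2)/2}\right\}.$$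
   Context: For $d>0$: $\mathscr{D}_d=\{\zeta\in\mathbb{C}:|\operatorname{Im}\zeta|<d\}$. The Sinc function is $S(k,h)(x)=\frac{\sin[\pi(x/h-k)]}{\pi(x/h-k)}$ (with value $1$ at $x=kh$). Since $1+\mathrm{e}^{\pi\sinh\zeta}$ has no zeros for $|\operatorname{Im}\zeta|<\pi/2$, $\psi$ denotes the analytic branch on this strip that is real on the real axis; $\psi^{-1}$ is the inverse of $\psi:\mathbb{R}\to(0,\infty)$. For real $\mu$, $|z^{\mu}\mathrm{e}^{-\mu z}|=|z|^{\mu}|\mathrm{e}^{-z}|^{\mu}$. Convention: $\psi(\mathscr{D}_d)$ is regarded as an (infinitely sheeted) Riemann surface. Thus ''$f$ is analytic in $\psi(\mathscr{D}_d)$'' means that $F(\zeta)=f(\psi(\zeta))$ is an analytic function on $\mathscr{D}_d$ (with $f(t)=F(\psi^{-1}(t))$ for $t\in(0,\infty)$), and the bound on $|f(z)|$ for all $z\in\psi(\mathscr{D}_d)$ means the bound on $|F(\zeta)|$ with $z=\psi(\zeta)$, for all $\zeta\in\mathscr{D}_d$. *)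

(* Defs.v *)
From Stdlib Require Import Reals ZArith.
From Coquelicot Require Import Coquelicot.

Open Scope R_scope.

Definition Cexp (z : C) : C :=
  (exp (Re z) * cos (Im z), exp (Re z) * sin (Im z)).

Definition Csinh (z : C) : C := ((Cexp z - Cexp (- z)) / 2)%C.

Definition strip (d : R) (z : C) : Prop := Rabs (Im z) < d.

(* Complex differentiability on an open set. *)
Definition analytic_on (D : C -> Prop) (F : C -> C) : Prop :=
  forall z : C, D z -> @ex_derive C_AbsRing C_NormedModule F z.

(* [psi] is the branch of log (1 + exp (PI sinh z)) on the strip
   |Im z| < PI/2 that is analytic there and real on the real axis; these
   conditions determine it uniquely on that strip. *)
Definition is_psi (psi : C -> C) : Prop :=
  analytic_on (strip (PI / 2)) psi /\
  (forall z : C, strip (PI / 2) z ->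
     Cexp (psi z) = (1 + Cexp (RtoC PI * Csinh z))%C) /\
  (forall x : R, Im (psi (RtoC x)) = 0).

Definition psi_on_R (psi : C -> C) (x : R) : R := Re (psi (RtoC x)).

(* [psi_inv] is a two-sided inverse of psi : R -> (0, +oo); its values at
   t <= 0 are irrelevant. *)
Definition is_psi_inv (psi : C -> C) (psi_inv : R -> R) : Prop :=
  (forall x : R, psi_inv (psi_on_R psi x) = x) /\
  (forall t : R, 0 < t -> psi_on_R psi (psi_inv t) = t).

(* A function f on the Riemann surface psi(D_d) is represented by its
   pull-back F = f o psi on D_d; this is its restriction to (0, +oo). *)
Definition on_half_line (psi_inv : R -> R) (F : C -> C) (t : R) : C :=
  F (RtoC (psi_inv t)).

(* |z^mu exp (- mu z)| = |z|^mu |exp (- z)|^mu for real mu and z <> 0.  The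
   first factor does not depend on the branch of z^mu.  [Rpower] has a junk
   value at base 0, but psi has no zero, since exp (psi z) <> 1. *)
Definition decay_modulus (mu : R) (z : C) : R :=
  Rpower (Cmod z) mu * Rpower (Cmod (Cexp (- z)%C)) mu.

Definition sinc_basis (k : Z) (h x : R) : R :=
  if Req_EM_T x (IZR k * h) then 1
  else sin (PI * (x / h - IZR k)) / (PI * (x / h - IZR k)).

(* a (-n) + ... + a n *)
Definition sum_sym (n : nat) (a : Z -> C) : C :=
  sum_n (fun j : nat => a (Z.of_nat j - Z.of_nat n)%Z) (2 * n).

Definition step (d mu : R) (n : nat) : R :=
  ln (2 * d * INR n / mu) / INR n.

Definition sinc_error (psi : C -> C) (psi_inv : R -> R) (f : R -> C)
    (h : R) (n : nat) (t : R) : R :=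
  Cmod (f t - sum_sym n (fun k : Z =>
                 f (psi_on_R psi (IZR k * h))
                 * RtoC (sinc_basis k h (psi_inv t))))%C.

(* The supremum is taken in the extended reals. *)
Definition sup_half_line (g : R -> R) : Rbar :=
  Lub_Rbar (fun y : R => exists t : R, 0 < t /\ y = g t).

Definition err_const (K d mu : R) : R :=
  K / (Rpower PI (1 - mu) * d * mu) *
  (4 / (PI * (1 - exp (- (PI * mu * exp 1)))
        * Rpower (cos (PI / 2 * sin d)) (2 * mu)
        * Rpower (cos d) (mu + 1))
   + mu * Rpower 2 (1 - mu) * exp (mu * (PI + 2) / 2)).

(* Main.v *)
(* Pull everything back to the strip by z = psi(zeta).  Two ingredients bound
   the error at x = psi^(-1)(t).

   Discretization.  The residue theorem for
   F(z) / ((z - x) sin (PI z / h)) on the rectangle with vertices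
   +-(N + 1/2) h +- i D gives F(x) minus the symmetric sinc sum of order N.
   On the horizontal sides |z - x| >= D and |sin (PI z / h)| >= sinh (PI D / h);
   the vertical sides vanish as N -> oo, and then D -> d.  Since F is only
   assumed complex differentiable, this rests on Goursat's bisection; as all
   poles are real and simple, their residues are split off one at a time and
   the remaining function is only needed to have limits on the real axis.

   Truncation.  Each h |F(k h)| with |k| > n is bounded by the integral over
   [(|k| - 1) h, |k| h] of an explicit derivative, so the tail telescopes.

   Both need |psi(z) exp(- psi(z))|, z = x + i y, for which one puts
   a = PI sinh x cos y and A = (PI / 2) sin y.  First
   |1 + exp (PI sinh z)| >= (1 + exp a) cos A; this bounds
   |psi'(z)| = PI |cosh z| / |1 + exp (- PI sinh z)| by the x-derivative of
   ln (1 + exp a) / (cos y cos A), and integrating from -oo bounds |psi|. *)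
Require Import Defs.
From Stdlib Require Import Reals ZArith.
From Stdlib Require Import Lra Lia Psatz List Classical ClassicalEpsilon FinFun.
From Coquelicot Require Import Coquelicot.

Open Scope R_scope.

(** * Limits and derivatives of complex functions *)

(** The step [h] comes from balancing the two errors. With [X = 2 d n / mu] and [n h = ln X],
    truncation costs about [exp (- PI mu X / 2) = exp (- PI d n)], discretization
    [exp (- PI d / h) = exp (- PI d n / ln X)]; the latter dominates and gives the rate. The
    condition on [n] says [X >= e]. Since [mu <= 1], the factor [cosh x ^ mu] of the strip bound may
    be raised to [cosh x], and [cosh x * exp (- ka * |sinh x|)] has a primitive. Its rate
    [ka = mu PI cos d] supplies one power of [cos d]; the powers [mu] of [cos d] and [2 mu] of the
    other cosine come from the bound on [|psi exp (- psi)|]. Truncation sees only the real axis,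
    where these cosines are 1. The delicate estimate is the lower bound for [|1 + exp (PI sinh z)|]:
    the phase [PI cosh x sin y] passes through odd multiples of [PI] as [x] grows, and there only
    the size of [PI sinh x cos y] keeps the sum away from 0. At a node [x = k h] the kernel has a
    double pole. Such [x] are treated apart: a sinc sum of large order equals [F x] there, so that
    only truncation is left. *)

Definition climit (g : C -> C) (z l : C) : Prop :=
  forall eps, 0 < eps -> exists del, 0 < del /\
    forall w, w <> z -> Cmod (w - z)%C < del -> Cmod (g w - l)%C < eps.

Definition ccont (g : C -> C) (z : C) : Prop := climit g z (g z).

(** A limit over [w <> z], so the value of the quotient at [w = z], a division by 0, has no
    influence. *)
Definition cderiv (g : C -> C) (z l : C) : Prop :=
  climit (fun w => (g w - g z) / (w - z))%C z l.

Lemma Cmod_sub_sym (z w : C) : Cmod (z - w)%C = Cmod (w - z)%C.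
Proof. rewrite <- Cmod_opp; f_equal; ring. Qed.

Lemma Csub_neq_0 (z w : C) : z <> w -> (z - w)%C <> 0%C.
Proof.
  intros H E; apply H.
  replace z with ((z - w) + w)%C by ring. rewrite E; ring.
Qed.

Lemma Cmod_Im_le (z : C) : Rabs (Im z) <= Cmod z.
Proof.
  eapply Rle_trans; [apply (Rmax_r (Rabs (fst z))) | apply Rmax_Cmod].
Qed.

Lemma Cmod_le_abs (z : C) : Cmod z <= Rabs (Re z) + Rabs (Im z).
Proof.
  destruct z as [x y]; simpl.
  replace ((x, y) : C) with (RtoC x + Ci * RtoC y)%C
    by (apply injective_projections; simpl; ring).
  eapply Rle_trans; [apply Cmod_triangle|].
  rewrite Cmod_mult, Cmod_Ci, !Cmod_R; lra.
Qed.

Lemma Cmod_Cauchy_Schwarz (u v : C) :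
  Re u * Re v + Im u * Im v <= Cmod u * Cmod v.
Proof.
  rewrite <- (Cmod_conj u), <- Cmod_mult.
  eapply Rle_trans; [|apply re_le_Cmod].
  eapply Rle_trans; [|apply RRle_abs].
  destruct u, v; right; simpl; ring.
Qed.

Lemma climit_const (k z : C) : climit (fun _ => k) z k.
Proof.
  intros eps He; exists 1; split; [lra|]; intros w _ _.
  replace (k - k)%C with (RtoC 0) by ring. rewrite Cmod_0; exact He.
Qed.

Lemma climit_id (z : C) : climit (fun w => w) z z.
Proof. intros eps He; exists eps; split; auto. Qed.

Lemma climit_ext_loc (f g : C -> C) (z l : C) (r : R) :
  0 < r -> (forall w, w <> z -> Cmod (w - z)%C < r -> f w = g w) ->
  climit f z l -> climit g z l.
Proof.
  intros Hr E Hf eps He; destruct (Hf eps He) as [d [Hd H]].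
  exists (Rmin r d); split; [apply Rmin_pos; auto|].
  intros w Hw Hwd; rewrite <- E; auto.
  - apply H; auto; eapply Rlt_le_trans; [exact Hwd | apply Rmin_r].
  - eapply Rlt_le_trans; [exact Hwd | apply Rmin_l].
Qed.

Lemma climit_ext (f g : C -> C) (z l : C) :
  (forall w, w <> z -> f w = g w) -> climit f z l -> climit g z l.
Proof. intros E; apply (climit_ext_loc f g z l 1); [lra | auto]. Qed.

Lemma climit_plus (f g : C -> C) (z l m : C) :
  climit f z l -> climit g z m -> climit (fun w => f w + g w)%C z (l + m)%C.
Proof.
  intros Hf Hg eps He.
  destruct (Hf (eps / 2)) as [d [Hd H]]; [lra|].
  destruct (Hg (eps / 2)) as [d' [Hd' H']]; [lra|].
  exists (Rmin d d'); split; [apply Rmin_pos; auto|].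
  intros w Hw Hwd.
  specialize (H w Hw (Rlt_le_trans _ _ _ Hwd (Rmin_l _ _))).
  specialize (H' w Hw (Rlt_le_trans _ _ _ Hwd (Rmin_r _ _))).
  replace (f w + g w - (l + m))%C with ((f w - l) + (g w - m))%C by ring.
  eapply Rle_lt_trans; [apply Cmod_triangle | lra].
Qed.

Lemma climit_mult (f g : C -> C) (z l m : C) :
  climit f z l -> climit g z m -> climit (fun w => f w * g w)%C z (l * m)%C.
Proof.
  intros Hf Hg eps He.
  pose proof (Cmod_ge_0 l) as Hl; pose proof (Cmod_ge_0 m) as Hm.
  set (e := Rmin 1 (eps / (Cmod l + Cmod m + 2))).
  assert (He0 : 0 < eps / (Cmod l + Cmod m + 2))
    by (apply Rdiv_lt_0_compat; lra).
  assert (Hep : 0 < e) by (apply Rmin_pos; lra).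
  assert (He1 : e <= 1) by apply Rmin_l.
  assert (He2 : e * (Cmod l + Cmod m + 2) <= eps).
  { apply Rle_trans with (eps / (Cmod l + Cmod m + 2) * (Cmod l + Cmod m + 2)).
    - apply Rmult_le_compat_r; [lra | apply Rmin_r].
    - right; field; lra. }
  destruct (Hf e Hep) as [d [Hd H]].
  destruct (Hg e Hep) as [d' [Hd' H']].
  exists (Rmin d d'); split; [apply Rmin_pos; auto|].
  intros w Hw Hwd.
  specialize (H w Hw (Rlt_le_trans _ _ _ Hwd (Rmin_l _ _))).
  specialize (H' w Hw (Rlt_le_trans _ _ _ Hwd (Rmin_r _ _))).
  replace (f w * g w - l * m)%C
    with ((f w - l) * (g w - m) + (f w - l) * m + l * (g w - m))%C by ring.
  eapply Rle_lt_trans; [apply Cmod_triangle|].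
  eapply Rle_lt_trans; [apply Rplus_le_compat_r, Cmod_triangle|].
  rewrite !Cmod_mult.
  pose proof (Cmod_ge_0 (f w - l)%C); pose proof (Cmod_ge_0 (g w - m)%C).
  nra.
Qed.

Lemma climit_opp (f : C -> C) (z l : C) :
  climit f z l -> climit (fun w => - f w)%C z (- l)%C.
Proof.
  intros H; replace (- l)%C with (- (1) * l)%C by ring.
  apply climit_ext with (fun w => - (1) * f w)%C; [intros; ring|].
  apply (climit_mult (fun _ => (- (1))%C)); [apply climit_const | exact H].
Qed.

Lemma climit_minus (f g : C -> C) (z l m : C) :
  climit f z l -> climit g z m -> climit (fun w => f w - g w)%C z (l - m)%C.
Proof. intros Hf Hg; apply climit_plus; [exact Hf | apply climit_opp, Hg]. Qed.

Lemma climit_inv (f : C -> C) (z l : C) :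
  l <> 0%C -> climit f z l -> climit (fun w => / f w)%C z (/ l)%C.
Proof.
  intros Hl Hf eps He.
  assert (Hl0 : 0 < Cmod l) by (apply Cmod_gt_0; auto).
  destruct (Hf (Rmin (Cmod l / 2) (eps * Cmod l * Cmod l / 2))) as [d [Hd H]].
  { apply Rmin_pos; [lra|]. apply Rdiv_lt_0_compat; [|lra].
    repeat apply Rmult_lt_0_compat; auto. }
  exists d; split; auto; intros w Hw Hwd; specialize (H w Hw Hwd).
  assert (H1 := Rlt_le_trans _ _ _ H (Rmin_l _ _)).
  assert (H2 := Rlt_le_trans _ _ _ H (Rmin_r _ _)).
  assert (H3 : Cmod l / 2 < Cmod (f w)).
  { pose proof (Cmod_triangle (f w) (l - f w)%C) as T.
    replace (f w + (l - f w))%C with l in T by ring.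
    rewrite (Cmod_sub_sym l) in T; lra. }
  assert (Hfw : f w <> 0%C) by (apply Cmod_gt_0; lra).
  replace (/ f w - / l)%C with ((l - f w) / (f w * l))%C by (field; auto).
  rewrite Cmod_div by (apply Cmult_neq_0; auto).
  rewrite Cmod_mult, Cmod_sub_sym.
  apply (Rmult_lt_reg_r (Cmod (f w) * Cmod l)); [nra|].
  replace (Cmod (f w - l) / (Cmod (f w) * Cmod l) * (Cmod (f w) * Cmod l))
    with (Cmod (f w - l)%C) by (field; lra).
  assert (eps * Cmod l * (Cmod l / 2) < eps * Cmod l * Cmod (f w))
    by (apply Rmult_lt_compat_l; nra).
  nra.
Qed.

Lemma climit_div (f g : C -> C) (z l m : C) :
  m <> 0%C -> climit f z l -> climit g z m ->
  climit (fun w => f w / g w)%C z (l / m)%C.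
Proof. intros Hm Hf Hg; apply climit_mult; [|apply climit_inv]; auto. Qed.

Lemma climit_unique (f : C -> C) (z l m : C) :
  climit f z l -> climit f z m -> l = m.
Proof.
  intros Hl Hm.
  assert (E : (l - m)%C = 0%C).
  { apply Cmod_eq_0.
    destruct (Cmod_ge_0 (l - m)%C) as [P|P]; [exfalso | auto].
    destruct (Hl (Cmod (l - m)%C / 2)) as [d [Hd H]]; [lra|].
    destruct (Hm (Cmod (l - m)%C / 2)) as [d' [Hd' H']]; [lra|].
    set (r := Rmin d d' / 2).
    assert (Hr : 0 < r) by (unfold r; pose proof (Rmin_pos d d' Hd Hd'); lra).
    assert (Hrd : r < d) by (unfold r in *; pose proof (Rmin_l d d'); lra).
    assert (Hrd' : r < d') by (unfold r in *; pose proof (Rmin_r d d'); lra).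
    assert (Er : (z + r - z)%C = RtoC r) by ring.
    assert (Hz : (z + r)%C <> z).
    { intros E. rewrite E in Er.
      apply (f_equal Cmod) in Er. replace (z - z)%C with (RtoC 0) in Er by ring.
      rewrite !Cmod_R, !Rabs_right in Er by lra. lra. }
    assert (Em : Cmod (z + r - z)%C = r)
      by (rewrite Er, Cmod_R, Rabs_right; lra).
    specialize (H _ Hz); specialize (H' _ Hz). rewrite Em in H, H'.
    specialize (H Hrd); specialize (H' Hrd').
    pose proof (Cmod_triangle (l - f (z + r))%C (f (z + r) - m)%C) as T.
    replace (l - f (z + r) + (f (z + r) - m))%C with (l - m)%C in T by ring.
    rewrite (Cmod_sub_sym l (f (z + r)%C)) in T. lra. }
  replace l with ((l - m) + m)%C by ring. rewrite E; ring.
Qed.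

Lemma ccont_near (f : C -> C) (z : C) : ccont f z ->
  forall eps, 0 < eps -> exists del, 0 < del /\
    forall w, Cmod (w - z)%C < del -> Cmod (f w - f z)%C < eps.
Proof.
  intros H eps He; destruct (H eps He) as [d [Hd Hw]].
  exists d; split; auto; intros w Hwd.
  destruct (Ceq_dec w z) as [->|N]; [|auto].
  replace (f z - f z)%C with (RtoC 0) by ring. rewrite Cmod_0; auto.
Qed.

Lemma cderiv_ccont (f : C -> C) (z l : C) : cderiv f z l -> ccont f z.
Proof.
  intros H; unfold ccont.
  replace (f z) with (l * (z - z) + f z)%C by ring.
  apply climit_ext with (fun w => (f w - f z) / (w - z) * (w - z) + f z)%C.
  { intros w Hw; field. apply Csub_neq_0; auto. }
  apply climit_plus; [apply climit_mult; [exact H|] | apply climit_const].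
  apply climit_minus; [apply climit_id | apply climit_const].
Qed.

Lemma cderiv_const (k z : C) : cderiv (fun _ => k) z 0%C.
Proof.
  apply climit_ext with (fun _ => 0%C); [|apply climit_const].
  intros w Hw; field. apply Csub_neq_0; auto.
Qed.

Lemma cderiv_id (z : C) : cderiv (fun w => w) z 1%C.
Proof.
  apply climit_ext with (fun _ => 1%C); [|apply climit_const].
  intros w Hw; field. apply Csub_neq_0; auto.
Qed.

Lemma cderiv_plus (f g : C -> C) (z l m : C) :
  cderiv f z l -> cderiv g z m -> cderiv (fun w => f w + g w)%C z (l + m)%C.
Proof.
  intros Hf Hg; eapply climit_ext; [|apply (climit_plus _ _ _ _ _ Hf Hg)].
  intros w Hw; simpl; field. apply Csub_neq_0; auto.
Qed.

Lemma cderiv_mult (f g : C -> C) (z l m : C) :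
  cderiv f z l -> cderiv g z m ->
  cderiv (fun w => f w * g w)%C z (l * g z + f z * m)%C.
Proof.
  intros Hf Hg.
  apply climit_ext with
    (fun w => (f w - f z) / (w - z) * g w + f z * ((g w - g z) / (w - z)))%C.
  { intros w Hw; simpl; field. apply Csub_neq_0; auto. }
  apply climit_plus; apply climit_mult; auto.
  - apply (cderiv_ccont _ _ _ Hg).
  - apply climit_const.
Qed.

Lemma cderiv_opp (f : C -> C) (z l : C) :
  cderiv f z l -> cderiv (fun w => - f w)%C z (- l)%C.
Proof.
  intros H; eapply climit_ext; [|apply (climit_opp _ _ _ H)].
  intros w Hw; simpl; field. apply Csub_neq_0; auto.
Qed.

Lemma cderiv_minus (f g : C -> C) (z l m : C) :
  cderiv f z l -> cderiv g z m -> cderiv (fun w => f w - g w)%C z (l - m)%C.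
Proof. intros Hf Hg; apply cderiv_plus; [exact Hf | apply cderiv_opp, Hg]. Qed.

Lemma ccont_neq_0 (f : C -> C) (z : C) : ccont f z -> f z <> 0%C ->
  exists del, 0 < del /\ forall w, Cmod (w - z)%C < del -> f w <> 0%C.
Proof.
  intros Hc Hz; destruct (ccont_near _ _ Hc (Cmod (f z))) as [d [Hd H]].
  { apply Cmod_gt_0; auto. }
  exists d; split; auto; intros w Hw E; specialize (H w Hw).
  rewrite E, Cmod_sub_sym in H.
  replace (f z - 0)%C with (f z) in H by ring. lra.
Qed.

Lemma cderiv_inv (f : C -> C) (z l : C) :
  f z <> 0%C -> cderiv f z l -> cderiv (fun w => / f w)%C z (- l / (f z * f z))%C.
Proof.
  intros Hz Hf; pose proof (cderiv_ccont _ _ _ Hf) as Hc.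
  destruct (ccont_neq_0 _ _ Hc Hz) as [d [Hd H]].
  apply climit_ext_loc
    with (fun w => - ((f w - f z) / (w - z)) / (f w * f z))%C d; auto.
  { intros w Hw Hwd; field; repeat split; auto. apply Csub_neq_0; auto. }
  apply climit_div; [apply Cmult_neq_0; auto | apply climit_opp, Hf |].
  apply climit_mult; [exact Hc | apply climit_const].
Qed.

Lemma cderiv_ext_loc (f g : C -> C) (z l : C) (r : R) :
  0 < r -> (forall w, Cmod (w - z)%C < r -> f w = g w) ->
  cderiv f z l -> cderiv g z l.
Proof.
  intros Hr E; apply climit_ext_loc with r; auto.
  intros w _ Hw; rewrite (E w Hw), (E z); auto.
  replace (z - z)%C with (RtoC 0) by ring. rewrite Cmod_0; auto.
Qed.

Lemma ex_derive_cderiv (f : C -> C) (z : C) :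
  @ex_derive C_AbsRing C_NormedModule f z -> exists l, cderiv f z l.
Proof.
  intros [l [_ H]]; exists l.
  assert (Hl : is_filter_lim (locally (z : AbsRing_UniformSpace C_AbsRing)) z)
    by (intros P HP; exact HP).
  specialize (H z Hl); intros eps He.
  assert (He2 : 0 < eps / 2) by lra.
  destruct (H (mkposreal _ He2)) as [d Hd].
  exists d; split; [apply cond_pos|]; intros w Hw Hwd.
  specialize (Hd w Hwd).
  change (Cmod (f w - f z - (w - z) * l)%C <= eps / 2 * Cmod (w - z)%C) in Hd.
  assert (Hwz := Csub_neq_0 _ _ Hw).
  assert (Hp : 0 < Cmod (w - z)%C) by (apply Cmod_gt_0; auto).
  replace ((f w - f z) / (w - z) - l)%C
    with ((f w - f z - (w - z) * l) / (w - z))%C by (field; auto).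
  rewrite Cmod_div by auto.
  apply (Rmult_lt_reg_r (Cmod (w - z)%C)); auto.
  unfold Rdiv at 1; rewrite Rmult_assoc, Rinv_l by lra. nra.
Qed.

(** * Complex exponential and sine *)

(** The common source of the elementary inequalities below: each is applied to the difference of two
    sides that agree at the left end, and the sign of the derivative is often the previous
    inequality of the chain. *)
Lemma le_of_derive_nonneg (f f' : R -> R) (a b : R) : a <= b ->
  (forall t, a <= t <= b -> is_derive f t (f' t)) ->
  (forall t, a <= t <= b -> 0 <= f' t) -> f a <= f b.
Proof.
  intros Hab Hd Hp.
  destruct (MVT_gen f a b f') as [c [Hc E]].
  - intros t Ht; rewrite Rmin_left, Rmax_right in Ht by auto; apply Hd; lra.
  - intros t Ht; rewrite Rmin_left, Rmax_right in Ht by auto.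
    apply continuity_pt_filterlim, (@ex_derive_continuous R_AbsRing R_NormedModule).
    exists (f' t); apply Hd; auto.
  - rewrite Rmin_left, Rmax_right in Hc by auto.
    specialize (Hp c Hc). nra.
Qed.

Lemma exp_mult_opp (a : R) : exp a * exp (- a) = 1.
Proof. rewrite <- exp_plus, Rplus_opp_r; apply exp_0. Qed.

(** From [1 + t <= exp t] at [t = a] and [t = - a]. The latter gives [exp a * (1 - a) <= 1], while
    [(1 + a + 2 a^2) (1 - a) = 1 + a^2 (1 - 2 a) >= 1] for [a <= 1/2]. *)
Lemma exp_quadratic (a : R) : Rabs a <= / 2 -> Rabs (exp a - 1 - a) <= 2 * a ^ 2.
Proof.
  intros Ha; apply Rabs_le_between in Ha.
  pose proof (exp_ineq1_le a); pose proof (exp_ineq1_le (- a)) as H1.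
  pose proof (exp_pos a).
  assert (E : exp a * exp (- a) = 1)
    by apply exp_mult_opp.
  assert (exp a * (1 - a) <= 1) by nra.
  assert (exp a <= 1 + a + 2 * a ^ 2).
  { apply (Rmult_le_reg_r (1 - a)); [lra|]. nra. }
  apply Rabs_le; nra.
Qed.

Lemma one_sub_cos_bounds (b : R) : 0 <= 1 - cos b <= b ^ 2 / 2.
Proof.
  split; [generalize (COS_bound b); lra|].
  assert (H : forall x, 0 <= x -> 1 - cos x <= x ^ 2 / 2).
  { intros x Hx.
    enough (cos 0 - 1 + 0 ^ 2 / 2 <= cos x - 1 + x ^ 2 / 2)
      by (rewrite cos_0 in *; lra).
    apply (le_of_derive_nonneg (fun t => cos t - 1 + t ^ 2 / 2)
      (fun t => t - sin t)); auto.
    - intros t _; auto_derive; auto; field.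
    - intros t [[Ht|<-] _]; [pose proof (sin_lt_x t Ht); lra|].
      rewrite sin_0; lra. }
  destruct (Rle_dec 0 b) as [P|N]; [auto|].
  rewrite <- cos_neg; replace (b ^ 2) with ((- b) ^ 2) by ring; apply H; lra.
Qed.

Lemma sin_cubic_pos (b : R) : 0 <= b -> 0 <= b - sin b <= b ^ 3 / 6.
Proof.
  intros Hb; split.
  - destruct Hb as [Hb|<-]; [pose proof (sin_lt_x b Hb); lra|].
    rewrite sin_0; lra.
  - enough (sin 0 - 0 + 0 ^ 3 / 6 <= sin b - b + b ^ 3 / 6)
      by (rewrite sin_0 in *; lra).
    apply (le_of_derive_nonneg (fun t => sin t - t + t ^ 3 / 6)
      (fun t => cos t - 1 + t ^ 2 / 2)); auto.
    + intros t _; auto_derive; auto; field.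
    + intros t _; pose proof (one_sub_cos_bounds t); lra.
Qed.

Lemma sin_cubic (b : R) : Rabs (sin b - b) <= Rabs b ^ 3 / 6.
Proof.
  destruct (Rle_dec 0 b) as [P|N].
  - rewrite (Rabs_right b) by lra; pose proof (sin_cubic_pos b P).
    rewrite Rabs_left1; lra.
  - rewrite (Rabs_left b) by lra; pose proof (sin_cubic_pos (- b)) as H.
    rewrite sin_neg in H; rewrite Rabs_right; lra.
Qed.

Lemma Cexp_plus (z w : C) : Cexp (z + w)%C = (Cexp z * Cexp w)%C.
Proof.
  destruct z, w; unfold Cexp; apply injective_projections; simpl;
    rewrite exp_plus; [rewrite cos_plus | rewrite sin_plus]; ring.
Qed.

Lemma Cexp_0 : Cexp 0%C = 1%C.
Proof.
  unfold Cexp; simpl; rewrite exp_0, cos_0, sin_0.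
  apply injective_projections; simpl; ring.
Qed.

Lemma Cmod_Cexp (z : C) : Cmod (Cexp z) = exp (Re z).
Proof.
  unfold Cmod, Cexp; simpl.
  replace (exp (Re z) * cos (Im z) * (exp (Re z) * cos (Im z) * 1) +
           exp (Re z) * sin (Im z) * (exp (Re z) * sin (Im z) * 1))
    with (exp (Re z) * exp (Re z) * (Rsqr (sin (Im z)) + Rsqr (cos (Im z))))
    by (unfold Rsqr; ring).
  rewrite sin2_cos2, Rmult_1_r, sqrt_square; auto.
  left; apply exp_pos.
Qed.

Lemma Cexp_neq_0 (z : C) : Cexp z <> 0%C.
Proof. apply Cmod_gt_0; rewrite Cmod_Cexp; apply exp_pos. Qed.

Lemma Cexp_opp (z : C) : Cexp (- z)%C = (/ Cexp z)%C.
Proof.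
  assert (E : (Cexp z * Cexp (- z))%C = 1%C)
    by (rewrite <- Cexp_plus, Cplus_opp_r; apply Cexp_0).
  pose proof (Cexp_neq_0 z).
  replace (Cexp (- z)) with (/ Cexp z * (Cexp z * Cexp (- z)))%C
    by (field; auto). rewrite E; field; auto.
Qed.

(** [Cexp] is given by components, so the real and imaginary errors are estimated separately, each
    by [4 r^2], from the real bounds for [exp], [cos] and [sin]. *)
Lemma Cexp_taylor (w : C) : Cmod w <= / 2 ->
  Cmod (Cexp w - 1 - w)%C <= 8 * Cmod w ^ 2.
Proof.
  intros Hw; set (r := Cmod w) in *.
  pose proof (re_le_Cmod w) as Ha; pose proof (Cmod_Im_le w) as Hb.
  fold r in Ha, Hb.
  destruct w as [a b]; simpl in Ha, Hb; clearbody r.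
  eapply Rle_trans; [apply Cmod_le_abs|]; unfold Cexp; simpl.
  pose proof (exp_quadratic a ltac:(lra)) as He.
  pose proof (one_sub_cos_bounds b) as Hc.
  pose proof (sin_cubic b) as Hs.
  pose proof (Rabs_pos a); pose proof (Rabs_pos b).
  assert (Hb3 : Rabs b ^ 3 / 6 <= r ^ 2) by (simpl; nra).
  assert (Ea : a ^ 2 <= r ^ 2) by (rewrite <- pow2_abs; simpl; nra).
  assert (Eb : b ^ 2 <= r ^ 2) by (rewrite <- pow2_abs; simpl; nra).
  assert (Hcos : Rabs (cos b) <= 1)
    by (apply Rabs_le; generalize (COS_bound b); lra).
  assert (P1 : Rabs (exp a * cos b + - (1) + - a) <= 4 * r ^ 2).
  { replace (exp a * cos b + - (1) + - a)
      with ((exp a - 1 - a) * cos b + (1 + a) * (cos b - 1)) by ring.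
    eapply Rle_trans; [apply Rabs_triang|]; rewrite !Rabs_mult.
    assert (Rabs (1 + a) <= 2)
      by (apply Rabs_le; apply Rabs_le_between in Ha; lra).
    assert (Rabs (cos b - 1) <= b ^ 2 / 2) by (apply Rabs_le; lra).
    pose proof (Rabs_pos (exp a - 1 - a)); pose proof (Rabs_pos (cos b - 1)).
    pose proof (Rabs_pos (cos b)); pose proof (Rabs_pos (1 + a)). nra. }
  assert (P2 : Rabs (exp a * sin b + - 0 + - b) <= 4 * r ^ 2).
  { replace (exp a * sin b + - 0 + - b)
      with ((exp a - 1) * sin b + (sin b - b)) by ring.
    eapply Rle_trans; [apply Rabs_triang|]; rewrite !Rabs_mult.
    assert (H1 : Rabs (exp a - 1) <= 2 * r).
    { replace (exp a - 1) with ((exp a - 1 - a) + a) by ring.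
      eapply Rle_trans; [apply Rabs_triang|]. nra. }
    assert (H2 : Rabs (sin b) <= 3 / 2 * r).
    { replace (sin b) with ((sin b - b) + b) by ring.
      eapply Rle_trans; [apply Rabs_triang|]. nra. }
    pose proof (Rabs_pos (exp a - 1)); pose proof (Rabs_pos (sin b)). nra. }
  lra.
Qed.

Lemma Cexp_quotient_near_0 : forall eps, 0 < eps -> exists del, 0 < del /\
  forall u : C, u <> 0%C -> Cmod u < del -> Cmod ((Cexp u - 1) / u - 1)%C < eps.
Proof.
  intros eps He; exists (Rmin (/ 2) (eps / 16)); split; [apply Rmin_pos; lra|].
  intros u Hu Hd.
  assert (H1 := Rlt_le_trans _ _ _ Hd (Rmin_l _ _)).
  assert (H2 := Rlt_le_trans _ _ _ Hd (Rmin_r _ _)).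
  assert (Hp : 0 < Cmod u) by (apply Cmod_gt_0; auto).
  replace ((Cexp u - 1) / u - 1)%C with ((Cexp u - 1 - u) / u)%C
    by (field; auto).
  rewrite Cmod_div by auto.
  pose proof (Cexp_taylor u ltac:(lra)).
  apply (Rmult_lt_reg_r (Cmod u)); auto.
  unfold Rdiv; rewrite Rmult_assoc, Rinv_l by lra. nra.
Qed.

Lemma cderiv_Cexp_comp (f : C -> C) (z l : C) :
  cderiv f z l -> cderiv (fun w => Cexp (f w)) z (Cexp (f z) * l)%C.
Proof.
  intros Hf.
  (* The difference quotient of the exponential at 0, completed by its limit 1: [f w = f z] may
     happen for [w <> z], so one cannot divide by [f w - f z]. *)
  set (E := fun u : C => if Ceq_dec u 0 then RtoC 1 else ((Cexp u - 1) / u)%C).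
  assert (HE : climit (fun w => E (f w - f z)%C) z 1%C).
  { intros eps He; destruct (Cexp_quotient_near_0 eps He) as [d [Hd H]].
    destruct (ccont_near _ _ (cderiv_ccont _ _ _ Hf) d Hd) as [d' [Hd' H']].
    exists d'; split; auto; intros w _ Hw; unfold E.
    destruct (Ceq_dec (f w - f z) 0) as [_|N]; [|auto].
    replace (1 - 1)%C with (RtoC 0) by ring; rewrite Cmod_0; auto. }
  replace (Cexp (f z) * l)%C with (Cexp (f z) * 1 * l)%C by ring.
  apply climit_ext with
    (fun w => Cexp (f z) * E (f w - f z) * ((f w - f z) / (w - z)))%C.
  { intros w Hw; pose proof (Csub_neq_0 _ _ Hw).
    replace (Cexp (f w)) with (Cexp (f z) * Cexp (f w - f z))%C
      by (rewrite <- Cexp_plus; f_equal; ring).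
    unfold E; destruct (Ceq_dec (f w - f z) 0) as [->|N].
    - rewrite Cexp_0; field; auto.
    - field; split; auto. }
  apply climit_mult; [apply climit_mult; [apply climit_const | exact HE]|].
  exact Hf.
Qed.

Lemma cosh_ge_1 (v : R) : 1 <= cosh v.
Proof.
  unfold cosh; pose proof (exp_pos v); pose proof (exp_pos (- v)).
  assert (exp v * exp (- v) = 1)
    by apply exp_mult_opp.
  pose proof (pow2_ge_0 (exp v - exp (- v))). nra.
Qed.

Lemma cosh_sqr (x : R) : cosh x ^ 2 = 1 + sinh x ^ 2.
Proof. unfold cosh, sinh; pose proof (exp_mult_opp x); simpl; nra. Qed.

Lemma sinh_odd (v : R) : sinh (- v) = - sinh v.
Proof. unfold sinh; rewrite Ropp_involutive; field. Qed.

Lemma cosh_even (v : R) : cosh (- v) = cosh v.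
Proof. unfold cosh; rewrite Ropp_involutive; field. Qed.

Lemma sinh_pos (y : R) : 0 < y -> 0 < sinh y.
Proof. intros H; rewrite <- sinh_0; apply sinh_lt; exact H. Qed.

Lemma sinh_nonneg (y : R) : 0 <= y -> 0 <= sinh y.
Proof. intros [H| <-]; [left; apply sinh_pos, H | rewrite sinh_0; lra]. Qed.

Lemma sinh_ge_id (x : R) : 0 <= x -> x <= sinh x.
Proof.
  intros Hx; enough (sinh 0 - 0 <= sinh x - x) by (rewrite sinh_0 in *; lra).
  apply (le_of_derive_nonneg (fun t => sinh t - t) (fun t => cosh t - 1)); auto.
  - intros t _; unfold sinh, cosh; auto_derive; auto; field.
  - intros t _; pose proof (cosh_ge_1 t); lra.
Qed.

(** Written with exponentials so that differentiability follows from [cderiv_Cexp_comp]; moduli are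
    read off the components instead. *)
Definition Csin (z : C) : C :=
  (- Ci / 2 * (Cexp (Ci * z) - Cexp (- (Ci * z))))%C.

Lemma Csin_components (x y : R) :
  Csin (x, y) = (sin x * cosh y, cos x * sinh y).
Proof.
  unfold Csin, Cdiv, Cexp, cosh, sinh; simpl.
  replace (0 * x - 1 * y) with (- y) by ring.
  replace (0 * y + 1 * x) with x by ring.
  rewrite Ropp_involutive, cos_neg, sin_neg.
  apply injective_projections; simpl; field.
Qed.

Lemma Csin_RtoC (x : R) : Csin (RtoC x) = RtoC (sin x).
Proof.
  unfold RtoC; rewrite Csin_components, cosh_0, sinh_0.
  apply injective_projections; simpl; ring.
Qed.

(** Both lower bounds for the denominator of the kernel come from here: the [sinh] term serves the
    horizontal sides, the [sin] term the vertical ones. It also locates the zeros of [Csin]. *)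
Lemma Cmod2_Csin (x y : R) :
  Cmod (Csin (x, y)) ^ 2 = sin x ^ 2 + sinh y ^ 2.
Proof.
  rewrite Csin_components, Cmod2_alt; simpl.
  pose proof (sin2_cos2 x) as H1; unfold Rsqr in H1.
  pose proof (cosh_sqr y) as H2; simpl in H2.
  replace (cosh y) with (cosh y * 1) by ring. nra.
Qed.

Lemma ex_cderiv_Csin_scaled (a z : C) :
  exists l, cderiv (fun w => Csin (a * w)) z l.
Proof.
  eexists; unfold Csin; apply cderiv_mult; [apply cderiv_const|].
  assert (H : cderiv (fun w => Ci * (a * w))%C z
                (0 * (a * z) + Ci * (0 * z + a * 1))%C).
  { apply cderiv_mult; [apply cderiv_const|].
    apply cderiv_mult; [apply cderiv_const | apply cderiv_id]. }
  apply cderiv_minus; apply cderiv_Cexp_comp; [exact H|].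
  apply cderiv_opp, H.
Qed.

Lemma cosh_quadratic (v : R) : Rabs v <= / 2 -> cosh v - 1 <= 2 * v ^ 2.
Proof.
  intros Hv; pose proof (exp_quadratic v Hv) as H1.
  pose proof (exp_quadratic (- v)) as H2.
  rewrite Rabs_Ropp in H2; specialize (H2 Hv).
  apply Rabs_le_between in H1, H2; unfold cosh; nra.
Qed.

Lemma sinh_cubic_pos (v : R) : 0 <= v <= / 2 -> 0 <= sinh v - v <= v ^ 3.
Proof.
  intros Hv; split; [pose proof (sinh_ge_id v); lra|].
  enough (0 ^ 3 + 0 - sinh 0 <= v ^ 3 + v - sinh v)
    by (rewrite sinh_0 in *; lra).
  apply (le_of_derive_nonneg (fun t => t ^ 3 + t - sinh t)
    (fun t => 3 * t ^ 2 + 1 - cosh t)).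
  - lra.
  - intros t _; unfold sinh, cosh; auto_derive; auto; field.
  - intros t Ht; pose proof (cosh_quadratic t) as H.
    rewrite Rabs_right in H by lra. nra.
Qed.

Lemma sinh_cubic (v : R) : Rabs v <= / 2 -> Rabs (sinh v - v) <= Rabs v ^ 3.
Proof.
  intros Hv; destruct (Rle_dec 0 v) as [P|N].
  - rewrite (Rabs_right v) in * by lra; pose proof (sinh_cubic_pos v).
    rewrite Rabs_right; lra.
  - rewrite (Rabs_left v) in * by lra; pose proof (sinh_cubic_pos (- v)) as H.
    rewrite sinh_odd in H; rewrite Rabs_left1; lra.
Qed.

Lemma Csin_taylor (w : C) : Cmod w <= / 2 ->
  Cmod (Csin w - w)%C <= 8 * Cmod w ^ 3.
Proof.
  intros Hw; set (r := Cmod w) in *.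
  pose proof (re_le_Cmod w) as Ha; pose proof (Cmod_Im_le w) as Hb.
  fold r in Ha, Hb.
  destruct w as [u v]; simpl in Ha, Hb; clearbody r.
  eapply Rle_trans; [apply Cmod_le_abs|]; rewrite Csin_components; simpl.
  pose proof (Rabs_pos u); pose proof (Rabs_pos v).
  pose proof (one_sub_cos_bounds u) as Hc; pose proof (sin_cubic u) as Hs.
  pose proof (cosh_quadratic v ltac:(lra)) as Hch.
  pose proof (cosh_ge_1 v) as Hch1.
  pose proof (sinh_cubic v ltac:(lra)) as Hsh.
  assert (Eu : u ^ 2 <= r ^ 2) by (rewrite <- pow2_abs; simpl; nra).
  assert (Ev : v ^ 2 <= r ^ 2) by (rewrite <- pow2_abs; simpl; nra).
  assert (Hr2 : r ^ 2 <= / 4) by (simpl; nra).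
  assert (Eu3 : Rabs u ^ 3 <= r ^ 3) by (apply pow_incr; lra).
  assert (Ev3 : Rabs v ^ 3 <= r ^ 3) by (apply pow_incr; lra).
  assert (Hr3 : 0 <= r ^ 3) by (apply pow_le; lra).
  assert (P1 : Rabs (sin u * cosh v + - u) <= 4 * r ^ 3).
  { replace (sin u * cosh v + - u)
      with ((sin u - u) * cosh v + u * (cosh v - 1)) by ring.
    eapply Rle_trans; [apply Rabs_triang|]; rewrite !Rabs_mult.
    rewrite (Rabs_right (cosh v)), (Rabs_right (cosh v - 1)) by lra.
    assert (Rabs (sin u - u) * cosh v <= r ^ 3 / 6 * 2).
    { apply Rmult_le_compat; try lra; apply Rabs_pos. }
    assert (Rabs u * (cosh v - 1) <= r * (2 * r ^ 2)).
    { apply Rmult_le_compat; lra. }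
    simpl in *; lra. }
  assert (P2 : Rabs (cos u * sinh v + - v) <= 4 * r ^ 3).
  { replace (cos u * sinh v + - v)
      with ((sinh v - v) + - ((1 - cos u) * sinh v)) by ring.
    eapply Rle_trans; [apply Rabs_triang|]; rewrite Rabs_Ropp, Rabs_mult.
    rewrite (Rabs_right (1 - cos u)) by lra.
    assert (Rabs (sinh v) <= 2 * r).
    { replace (sinh v) with ((sinh v - v) + v) by ring.
      eapply Rle_trans; [apply Rabs_triang|].
      assert (r ^ 3 <= r) by (simpl in *; nra). lra. }
    assert ((1 - cos u) * Rabs (sinh v) <= r ^ 2 / 2 * (2 * r)).
    { apply Rmult_le_compat; try lra; apply Rabs_pos. }
    simpl in *; lra. }
  lra.
Qed.

(** The difference is [(w - sin w) / (w sin w)], a cubic error over a quadratic denominator. This is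
    the only local fact about the sine that the poles at the nodes require. *)
Lemma climit_inv_Csin_sub_inv :
  climit (fun w => / Csin w - / w)%C 0%C 0%C.
Proof.
  intros eps He; exists (Rmin (/ 4) (eps / 16)); split; [apply Rmin_pos; lra|].
  intros w Hw; replace (w - 0)%C with w by ring; intros Hd.
  assert (H1 := Rlt_le_trans _ _ _ Hd (Rmin_l _ _)).
  assert (H2 := Rlt_le_trans _ _ _ Hd (Rmin_r _ _)).
  assert (Hp : 0 < Cmod w) by (apply Cmod_gt_0; auto).
  pose proof (Csin_taylor w ltac:(lra)) as T; set (r := Cmod w) in *.
  (* Here [r < 1/4] enters: the Taylor error takes at most half of [|w|], which leaves
     [|sin w| >= r / 2]. *)
  assert (Hr3 : 8 * r ^ 3 <= r / 2) by (simpl; nra).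
  assert (L : r / 2 <= Cmod (Csin w)).
  { pose proof (Cmod_triangle (Csin w) (w - Csin w)%C) as T1.
    replace (Csin w + (w - Csin w))%C with w in T1 by ring.
    rewrite (Cmod_sub_sym w (Csin w)) in T1; fold r in T1; lra. }
  assert (N : Csin w <> 0%C) by (apply Cmod_gt_0; lra).
  replace (/ Csin w - / w - 0)%C with ((w - Csin w) / (Csin w * w))%C
    by (field; auto).
  rewrite Cmod_div by (apply Cmult_neq_0; auto).
  rewrite Cmod_mult, (Cmod_sub_sym w (Csin w)); fold r.
  apply (Rmult_lt_reg_r (Cmod (Csin w) * r)); [nra|].
  unfold Rdiv; rewrite Rmult_assoc, Rinv_l, Rmult_1_r by nra.
  apply Rle_lt_trans with (8 * r ^ 3); [exact T|].
  apply Rlt_le_trans with (eps * (r / 2 * r)).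
  { replace (8 * r ^ 3) with (8 * r * (r * r)) by ring.
    replace (eps * (r / 2 * r)) with (eps / 2 * (r * r)) by field.
    apply Rmult_lt_compat_r; [apply Rmult_lt_0_compat|]; lra. }
  apply Rmult_le_compat_l; [lra|]. nra.
Qed.

(** * Integrals along segments and rectangles *)

Definition rcont (f : R -> C) (t : R) : Prop :=
  continuous (fun s => Re (f s)) t /\ continuous (fun s => Im (f s)) t.

Definition CInt (f : R -> C) (a b : R) : C :=
  (RInt (fun t => Re (f t)) a b, RInt (fun t => Im (f t)) a b).

Definition rcont_on (f : R -> C) (a b : R) : Prop :=
  forall t, a <= t <= b -> rcont f t.

Lemma rcont_ex_RInt (f : R -> C) (a b : R) : a <= b -> rcont_on f a b ->
  ex_RInt (fun t => Re (f t)) a b /\ ex_RInt (fun t => Im (f t)) a b.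
Proof.
  intros Hab H; split;
    apply (@ex_RInt_continuous R_CompleteNormedModule); intros t Ht;
    rewrite Rmin_left, Rmax_right in Ht by auto; apply (H t Ht).
Qed.

Lemma CInt_Chasles (f : R -> C) (a b c : R) : a <= b <= c -> rcont_on f a c ->
  (CInt f a b + CInt f b c)%C = CInt f a c.
Proof.
  intros Hab H.
  destruct (rcont_ex_RInt f a b) as [H1 H2]; [lra | intros t Ht; apply H; lra |].
  destruct (rcont_ex_RInt f b c) as [H3 H4]; [lra | intros t Ht; apply H; lra |].
  apply injective_projections; simpl; apply (@RInt_Chasles R_CompleteNormedModule);
    auto.
Qed.

Lemma CInt_ext (f g : R -> C) (a b : R) : a <= b ->
  (forall t, a <= t <= b -> f t = g t) -> CInt f a b = CInt g a b.
Proof.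
  intros Hab E; unfold CInt; f_equal; apply RInt_ext; intros t Ht;
    rewrite Rmin_left, Rmax_right in Ht by auto; rewrite E by lra; auto.
Qed.

Lemma CInt_plus (f g : R -> C) (a b : R) : a <= b ->
  rcont_on f a b -> rcont_on g a b ->
  CInt (fun t => f t + g t)%C a b = (CInt f a b + CInt g a b)%C.
Proof.
  intros Hab Hf Hg.
  destruct (rcont_ex_RInt f a b Hab Hf) as [H1 H2].
  destruct (rcont_ex_RInt g a b Hab Hg) as [H3 H4].
  apply injective_projections; simpl;
    apply (@RInt_plus R_CompleteNormedModule); auto.
Qed.

Lemma rcont_plus (f g : R -> C) (t : R) :
  rcont f t -> rcont g t -> rcont (fun s => f s + g s)%C t.
Proof.
  intros [H1 H2] [H3 H4]; split; simpl;
    apply (@continuous_plus R_UniformSpace R_AbsRing R_NormedModule); auto.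
Qed.

(* With I the integral, |I|^2 is the integral of the real part of
   conj(I) * f, which is at most |I| * phi. *)
Lemma CInt_norm_le (f : R -> C) (phi : R -> R) (a b : R) : a <= b ->
  rcont_on f a b -> ex_RInt phi a b ->
  (forall t, a <= t <= b -> Cmod (f t) <= phi t) ->
  Cmod (CInt f a b) <= RInt phi a b.
Proof.
  intros Hab Hf Hphi H.
  destruct (rcont_ex_RInt f a b Hab Hf) as [H1 H2].
  set (I := CInt f a b).
  assert (E : Cmod I ^ 2 = RInt (fun t => Re I * Re (f t) + Im I * Im (f t)) a b).
  { rewrite Cmod2_alt.
    rewrite (@RInt_plus R_CompleteNormedModule
               (fun t => scal (Re I) (Re (f t))) (fun t => scal (Im I) (Im (f t)))).
    - rewrite !(@RInt_scal R_CompleteNormedModule) by auto.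
      unfold scal, plus; simpl; unfold mult; simpl; unfold I, CInt; simpl; ring.
    - apply (@ex_RInt_scal R_NormedModule); auto.
    - apply (@ex_RInt_scal R_NormedModule); auto. }
  assert (L : RInt (fun t => Re I * Re (f t) + Im I * Im (f t)) a b
              <= RInt (fun t => Cmod I * phi t) a b).
  { apply RInt_le; auto.
    - apply (@ex_RInt_plus R_NormedModule);
        apply (@ex_RInt_scal R_NormedModule); auto.
    - apply (@ex_RInt_scal R_NormedModule); auto.
    - intros t Ht; specialize (H t ltac:(lra)).
      apply Rle_trans with (Cmod I * Cmod (f t)).
      2: apply Rmult_le_compat_l; [apply Cmod_ge_0 | exact H].
      apply Cmod_Cauchy_Schwarz. }
  rewrite <- E in L.
  rewrite (@RInt_scal R_CompleteNormedModule phi) in L by auto.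
  change (Cmod I ^ 2 <= Cmod I * RInt phi a b) in L.
  destruct (Cmod_ge_0 I) as [P|P].
  - apply (Rmult_le_reg_l (Cmod I)); [exact P|]. simpl in L; lra.
  - rewrite <- P; apply RInt_ge_0; auto.
    intros t Ht; eapply Rle_trans; [apply Cmod_ge_0 | apply H; lra].
Qed.

Lemma CInt_norm_le_const (f : R -> C) (M a b : R) : a <= b ->
  rcont_on f a b -> (forall t, a <= t <= b -> Cmod (f t) <= M) ->
  Cmod (CInt f a b) <= M * (b - a).
Proof.
  intros Hab Hf H.
  replace (M * (b - a)) with (RInt (fun _ => M) a b)
    by (rewrite RInt_const; unfold scal; simpl; unfold mult; simpl; ring).
  apply CInt_norm_le; auto. apply (@ex_RInt_const R_NormedModule).
Qed.

Lemma CInt_antiderivative (f G : R -> C) (a b : R) : a <= b -> rcont_on f a b ->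
  (forall t, a <= t <= b -> is_derive (fun s => Re (G s)) t (Re (f t)) /\
                            is_derive (fun s => Im (G s)) t (Im (f t))) ->
  CInt f a b = (G b - G a)%C.
Proof.
  intros Hab Hf H; apply injective_projections; simpl; apply is_RInt_unique.
  - apply (@is_RInt_derive R_CompleteNormedModule (fun s => Re (G s))
             (fun s => Re (f s)));
      intros t Ht; rewrite Rmin_left, Rmax_right in Ht by auto;
      [apply (H t Ht) | apply (Hf t Ht)].
  - apply (@is_RInt_derive R_CompleteNormedModule (fun s => Im (G s))
             (fun s => Im (f s)));
      intros t Ht; rewrite Rmin_left, Rmax_right in Ht by auto;
      [apply (H t Ht) | apply (Hf t Ht)].
Qed.

(** The counterclockwise integral along the boundary of [[a, b] x [c, e]]; [Ci] is [dz / dt] on the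
    vertical sides. *)
Definition rect (g : C -> C) (a b c e : R) : C :=
  (CInt (fun t => g (t, c)) a b + Ci * CInt (fun t => g (b, t)) c e
   - CInt (fun t => g (t, e)) a b - Ci * CInt (fun t => g (a, t)) c e)%C.

Definition hseg (g : C -> C) (a b y : R) : Prop :=
  forall x, a <= x <= b -> ccont g (x, y).

Definition vseg (g : C -> C) (x c e : R) : Prop :=
  forall y, c <= y <= e -> ccont g (x, y).

(** Continuity is asked for on the boundary only, because functions with poles inside the rectangle
    are integrated too. *)
Definition edges (g : C -> C) (a b c e : R) : Prop :=
  hseg g a b c /\ hseg g a b e /\ vseg g a c e /\ vseg g b c e.

Lemma rcont_of_near (f : R -> C) (t : R) :
  (forall eps, 0 < eps -> exists del, 0 < del /\
     forall s, Rabs (s - t) < del -> Cmod (f s - f t)%C < eps) -> rcont f t.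
Proof.
  intros H; split; apply filterlim_locally; intros eps;
    destruct (H eps (cond_pos eps)) as [d [Hd Hs]];
    exists (mkposreal d Hd); intros s Hsd; specialize (Hs s Hsd);
    eapply Rle_lt_trans; [|apply Hs| |apply Hs].
  - apply (re_le_Cmod (f s - f t)%C).
  - apply (Cmod_Im_le (f s - f t)%C).
Qed.

Lemma hseg_rcont (g : C -> C) (a b y : R) :
  hseg g a b y -> rcont_on (fun t => g (t, y)) a b.
Proof.
  intros H t Ht; apply rcont_of_near; intros eps He.
  destruct (ccont_near _ _ (H t Ht) eps He) as [d [Hd Hw]].
  exists d; split; auto; intros s Hs; apply Hw.
  replace ((s, y) - (t, y))%C with (RtoC (s - t))
    by (apply injective_projections; simpl; ring).
  rewrite Cmod_R; auto.
Qed.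

Lemma vseg_rcont (g : C -> C) (x c e : R) :
  vseg g x c e -> rcont_on (fun t => g (x, t)) c e.
Proof.
  intros H t Ht; apply rcont_of_near; intros eps He.
  destruct (ccont_near _ _ (H t Ht) eps He) as [d [Hd Hw]].
  exists d; split; auto; intros s Hs; apply Hw.
  replace ((x, s) - (x, t))%C with (Ci * RtoC (s - t))%C
    by (apply injective_projections; simpl; ring).
  rewrite Cmod_mult, Cmod_Ci, Cmod_R; lra.
Qed.

Lemma rect_split_h (g : C -> C) (a b b' c e : R) : a <= b <= b' ->
  hseg g a b' c -> hseg g a b' e ->
  rect g a b' c e = (rect g a b c e + rect g b b' c e)%C.
Proof.
  intros Hab H1 H2; unfold rect.
  rewrite <- (CInt_Chasles _ a b b' Hab (hseg_rcont _ _ _ _ H1)).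
  rewrite <- (CInt_Chasles _ a b b' Hab (hseg_rcont _ _ _ _ H2)). ring.
Qed.

Lemma rect_split_v (g : C -> C) (a b c e e' : R) : c <= e <= e' ->
  vseg g a c e' -> vseg g b c e' ->
  rect g a b c e' = (rect g a b c e + rect g a b e e')%C.
Proof.
  intros Hab H1 H2; unfold rect.
  rewrite <- (CInt_Chasles _ c e e' Hab (vseg_rcont _ _ _ _ H1)).
  rewrite <- (CInt_Chasles _ c e e' Hab (vseg_rcont _ _ _ _ H2)). ring.
Qed.

Lemma rect_plus (f g : C -> C) (a b c e : R) : a <= b -> c <= e ->
  edges f a b c e -> edges g a b c e ->
  rect (fun z => f z + g z)%C a b c e = (rect f a b c e + rect g a b c e)%C.
Proof.
  intros Hab Hce (F1 & F2 & F3 & F4) (G1 & G2 & G3 & G4); unfold rect.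
  apply hseg_rcont in F1, F2, G1, G2; apply vseg_rcont in F3, F4, G3, G4.
  rewrite !(CInt_plus (fun t => f (t, _)) (fun t => g (t, _))) by auto.
  rewrite !(CInt_plus (fun t => f (_, t)) (fun t => g (_, t))) by auto. ring.
Qed.

Lemma rect_ext (f g : C -> C) (a b c e : R) : a <= b -> c <= e ->
  (forall x y, a <= x <= b -> c <= y <= e ->
     x = a \/ x = b \/ y = c \/ y = e -> f (x, y) = g (x, y)) ->
  rect f a b c e = rect g a b c e.
Proof.
  intros Hab Hce E; unfold rect.
  rewrite (CInt_ext (fun t => f (t, c)) (fun t => g (t, c)))
    by (auto; intros; apply E; tauto || lra).
  rewrite (CInt_ext (fun t => f (t, e)) (fun t => g (t, e)))
    by (auto; intros; apply E; tauto || lra).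
  rewrite (CInt_ext (fun t => f (b, t)) (fun t => g (b, t)))
    by (auto; intros; apply E; tauto || lra).
  rewrite (CInt_ext (fun t => f (a, t)) (fun t => g (a, t)))
    by (auto; intros; apply E; tauto || lra). reflexivity.
Qed.

Lemma Cmod_triangle4 (u v w z : C) :
  Cmod (u + v - w - z)%C <= Cmod u + Cmod v + Cmod w + Cmod z.
Proof.
  pose proof (Cmod_triangle (u + v - w)%C (- z)%C) as H1.
  pose proof (Cmod_triangle (u + v)%C (- w)%C) as H2.
  pose proof (Cmod_triangle u v) as H3.
  rewrite Cmod_opp in H1, H2. unfold Cminus in *; lra.
Qed.

Lemma rect_norm_le (g : C -> C) (M a b c e : R) : a <= b -> c <= e ->
  edges g a b c e ->
  (forall x y, a <= x <= b -> c <= y <= e -> Cmod (g (x, y)) <= M) ->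
  Cmod (rect g a b c e) <= 2 * M * ((b - a) + (e - c)).
Proof.
  intros Hab Hce (F1 & F2 & F3 & F4) H; unfold rect, Cminus.
  apply hseg_rcont in F1, F2; apply vseg_rcont in F3, F4.
  eapply Rle_trans; [apply Cmod_triangle4|].
  rewrite !Cmod_mult, Cmod_Ci.
  pose proof (CInt_norm_le_const _ M _ _ Hab F1 ltac:(intros; apply H; lra)).
  pose proof (CInt_norm_le_const _ M _ _ Hab F2 ltac:(intros; apply H; lra)).
  pose proof (CInt_norm_le_const _ M _ _ Hce F3 ltac:(intros; apply H; lra)).
  pose proof (CInt_norm_le_const _ M _ _ Hce F4 ltac:(intros; apply H; lra)).
  lra.
Qed.

Lemma ccont_affine (al be z : C) : ccont (fun w => al + be * w)%C z.
Proof.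
  apply climit_plus; [apply climit_const|].
  apply climit_mult; [apply climit_const | apply climit_id].
Qed.

(** The case of Cauchy's theorem that a primitive settles at once. Goursat's argument subtracts such
    a function, the tangent map, on a small rectangle. *)
Lemma rect_affine (al be : C) (a b c e : R) : a <= b -> c <= e ->
  rect (fun w => al + be * w)%C a b c e = 0%C.
Proof.
  intros Hab Hce.
  set (G := fun w => (al * w + be * (w * w) / 2)%C).
  assert (Hh : forall y, CInt (fun t => al + be * (t, y))%C a b
                         = (G (b, y) - G (a, y))%C).
  { intros y; apply (CInt_antiderivative _ (fun t => G (t, y))); auto.
    - apply (hseg_rcont (fun w => al + be * w)%C); intros x _; apply ccont_affine.
    - intros t _; destruct al as [p q], be as [r s]; unfold G; simpl.
      split; auto_derive; auto; field. }
  (* On a vertical side the [t]-derivative of [G (x + i t)] is [i] times the integrand, hence the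
     primitive [- Ci * G]. *)
  assert (Hv : forall x, CInt (fun t => al + be * (x, t))%C c e
                         = (- Ci * (G (x, e) - G (x, c)))%C).
  { intros x; rewrite (CInt_antiderivative _ (fun t => - Ci * G (x, t))%C);
      auto; [ring | |].
    - apply (vseg_rcont (fun w => al + be * w)%C); intros y _; apply ccont_affine.
    - intros t _; destruct al as [p q], be as [r s]; unfold G; simpl.
      split; auto_derive; auto; field. }
  unfold rect; rewrite !Hh, !Hv.
  replace (Ci * (- Ci * (G (b, e) - G (b, c))))%C with (G (b, e) - G (b, c))%C.
  2: apply injective_projections; simpl; ring.
  replace (Ci * (- Ci * (G (a, e) - G (a, c))))%C with (G (a, e) - G (a, c))%C.
  2: apply injective_projections; simpl; ring.
  ring.
Qed.

Definition boxcont (g : C -> C) (a b c e : R) : Prop :=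
  forall x y, a <= x <= b -> c <= y <= e -> ccont g (x, y).

Lemma boxcont_edges (g : C -> C) (a b c e : R) : a <= b -> c <= e ->
  boxcont g a b c e -> edges g a b c e.
Proof.
  intros Hab Hce H; repeat split; intros t Ht; apply H; lra.
Qed.

Lemma boxcont_mono (g : C -> C) (a b c e a' b' c' e' : R) :
  a <= a' -> b' <= b -> c <= c' -> e' <= e ->
  boxcont g a b c e -> boxcont g a' b' c' e'.
Proof. intros ? ? ? ? H x y Hx Hy; apply H; lra. Qed.

(** Subtracting the tangent map does not change the integral. What remains is at most [eps] times
    the distance to [(p, q)], which the half perimeter bounds, and the contour contributes twice the
    half perimeter. *)
Lemma rect_near_derivative (g : C -> C) (l : C) (p q eps a b c e : R) :
  a <= p <= b -> c <= q <= e -> 0 <= eps -> boxcont g a b c e ->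
  (forall x y, a <= x <= b -> c <= y <= e ->
     Cmod (g (x, y) - g (p, q) - l * ((x, y) - (p, q)))%C
     <= eps * Cmod ((x, y) - (p, q))%C) ->
  Cmod (rect g a b c e) <= 2 * eps * ((b - a) + (e - c)) ^ 2.
Proof.
  intros Hp Hq He Hg H.
  set (al := (g (p, q) - l * (p, q))%C).
  set (rho := fun w => (g w + (- al + (- l) * w))%C).
  assert (Ha : forall z, ccont (fun w => - al + (- l) * w)%C z)
    by (intros; apply ccont_affine).
  assert (Hr : boxcont rho a b c e)
    by (intros x y Hx Hy; apply climit_plus; [apply Hg | apply Ha]; auto).
  replace (rect g a b c e) with (rect rho a b c e).
  2:{ unfold rho; rewrite rect_plus, rect_affine by
        (try apply boxcont_edges; auto; try lra; intros x y _ _; apply Ha). ring. }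
  replace (2 * eps * (b - a + (e - c)) ^ 2)
    with (2 * (eps * (b - a + (e - c))) * (b - a + (e - c))) by ring.
  apply rect_norm_le; [lra | lra | apply boxcont_edges; auto; lra |].
  intros x y Hx Hy; unfold rho, al.
  replace (g (x, y) + (- (g (p, q) - l * (p, q)) + - l * (x, y)))%C
    with (g (x, y) - g (p, q) - l * ((x, y) - (p, q)))%C by ring.
  eapply Rle_trans; [apply H; auto|].
  apply Rmult_le_compat_l; auto.
  eapply Rle_trans; [apply Cmod_le_abs|]; simpl.
  apply Rplus_le_compat; apply Rabs_le; lra.
Qed.

Lemma cderiv_near (g : C -> C) (z l : C) : cderiv g z l ->
  forall eps, 0 < eps -> exists del, 0 < del /\ forall w, Cmod (w - z)%C < del ->
    Cmod (g w - g z - l * (w - z))%C <= eps * Cmod (w - z)%C.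
Proof.
  intros H eps He; destruct (H eps He) as [d [Hd Hw]].
  exists d; split; auto; intros w Hwd.
  destruct (Ceq_dec w z) as [->|N].
  - replace (g z - g z - l * (z - z))%C with (RtoC 0) by ring.
    replace (z - z)%C with (RtoC 0) by ring. rewrite Cmod_0; lra.
  - specialize (Hw w N Hwd); assert (N' := Csub_neq_0 _ _ N).
    replace (g w - g z - l * (w - z))%C
      with (((g w - g z) / (w - z) - l) * (w - z))%C by (field; auto).
    rewrite Cmod_mult; apply Rmult_le_compat_r; [apply Cmod_ge_0 | lra].
Qed.

(** * Goursat's theorem *)

Lemma rect_quarters (g : C -> C) (a c w v : R) : 0 <= w -> 0 <= v ->
  boxcont g a (a + 2 * w) c (c + 2 * v) ->
  rect g a (a + 2 * w) c (c + 2 * v) =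
  (rect g a (a + w) c (c + v) + rect g (a + w) (a + w + w) c (c + v)
   + rect g a (a + w) (c + v) (c + v + v)
   + rect g (a + w) (a + w + w) (c + v) (c + v + v))%C.
Proof.
  intros Hw Hv H.
  replace (a + 2 * w) with (a + w + w) in * by ring.
  replace (c + 2 * v) with (c + v + v) in * by ring.
  rewrite (rect_split_v g a (a + w + w) c (c + v) (c + v + v)),
    (rect_split_h g a (a + w) (a + w + w) c (c + v)),
    (rect_split_h g a (a + w) (a + w + w) (c + v) (c + v + v)); try lra;
    try (intros x Hx; apply H; lra). ring.
Qed.

(** Selects the lower left corner of a quarter whose integral still exceeds [eta / 4 ^ S n]. The
    default [q3] is safe: when three quarters fail, the triangle inequality forces the fourth to
    qualify. *)
Definition bisect_step (g : C -> C) (w v eta : R) (n : nat) (p : R * R) : R * R :=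
  let big q := Rlt_dec (eta / 4 ^ S n)
    (Cmod (rect g (fst q) (fst q + w / 2 ^ S n) (snd q) (snd q + v / 2 ^ S n))) in
  let q1 := (fst p + w / 2 ^ S n, snd p) in
  let q2 := (fst p, snd p + v / 2 ^ S n) in
  let q3 := (fst p + w / 2 ^ S n, snd p + v / 2 ^ S n) in
  if big p then p else if big q1 then q1 else if big q2 then q2 else q3.

Fixpoint bisect (g : C -> C) (w v eta : R) (p : R * R) (n : nat) : R * R :=
  match n with
  | O => p
  | S m => bisect_step g w v eta m (bisect g w v eta p m)
  end.

Lemma bisect_step_spec (g : C -> C) (w v eta : R) (n : nat) (p : R * R) :
  0 <= w -> 0 <= v ->
  boxcont g (fst p) (fst p + w / 2 ^ n) (snd p) (snd p + v / 2 ^ n) ->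
  eta / 4 ^ n < Cmod (rect g (fst p) (fst p + w / 2 ^ n)
                           (snd p) (snd p + v / 2 ^ n)) ->
  let q := bisect_step g w v eta n p in
  eta / 4 ^ S n < Cmod (rect g (fst q) (fst q + w / 2 ^ S n)
                             (snd q) (snd q + v / 2 ^ S n)) /\
  (fst p <= fst q <= fst p + w / 2 ^ S n) /\
  (snd p <= snd q <= snd p + v / 2 ^ S n).
Proof.
  intros Hw Hv Hc H q.
  assert (H2 : 0 < 2 ^ S n) by (apply pow_lt; lra).
  assert (H2' : 0 < 2 ^ n) by (apply pow_lt; lra).
  assert (H4' : 0 < 4 ^ n) by (apply pow_lt; lra).
  assert (Ew : w / 2 ^ n = 2 * (w / 2 ^ S n)) by (simpl; field; lra).
  assert (Ev : v / 2 ^ n = 2 * (v / 2 ^ S n)) by (simpl; field; lra).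
  assert (Ee : eta / 4 ^ n = 4 * (eta / 4 ^ S n)) by (simpl; field; lra).
  assert (Hw' : 0 <= w / 2 ^ S n) by (apply Rdiv_le_0_compat; lra).
  assert (Hv' : 0 <= v / 2 ^ S n) by (apply Rdiv_le_0_compat; lra).
  rewrite Ew, Ev in H, Hc; rewrite Ee in H.
  rewrite rect_quarters in H by auto.
  unfold q, bisect_step; clear q.
  repeat (match goal with |- context [Rlt_dec ?u ?t] =>
            destruct (Rlt_dec u t) as [?|?]; cbn [fst snd] in *;
            [split; [auto | lra] |] end).
  split; [|lra].
  pose proof (Cmod_triangle
    (rect g (fst p) (fst p + w / 2 ^ S n) (snd p) (snd p + v / 2 ^ S n)
     + rect g (fst p + w / 2 ^ S n) (fst p + w / 2 ^ S n + w / 2 ^ S n)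
         (snd p) (snd p + v / 2 ^ S n)
     + rect g (fst p) (fst p + w / 2 ^ S n) (snd p + v / 2 ^ S n)
         (snd p + v / 2 ^ S n + v / 2 ^ S n))%C
    (rect g (fst p + w / 2 ^ S n) (fst p + w / 2 ^ S n + w / 2 ^ S n)
       (snd p + v / 2 ^ S n) (snd p + v / 2 ^ S n + v / 2 ^ S n))) as T1.
  pose proof (Cmod_triangle
    (rect g (fst p) (fst p + w / 2 ^ S n) (snd p) (snd p + v / 2 ^ S n)
     + rect g (fst p + w / 2 ^ S n) (fst p + w / 2 ^ S n + w / 2 ^ S n)
         (snd p) (snd p + v / 2 ^ S n))%C
    (rect g (fst p) (fst p + w / 2 ^ S n) (snd p + v / 2 ^ S n)
         (snd p + v / 2 ^ S n + v / 2 ^ S n))) as T2.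
  pose proof (Cmod_triangle
    (rect g (fst p) (fst p + w / 2 ^ S n) (snd p) (snd p + v / 2 ^ S n))
    (rect g (fst p + w / 2 ^ S n) (fst p + w / 2 ^ S n + w / 2 ^ S n)
         (snd p) (snd p + v / 2 ^ S n))) as T3.
  lra.
Qed.

(** The intervals [[u n, u n + w / 2 ^ n]] are nested, since a move to the right by at most
    [w / 2 ^ S n] is paid for by the halved length; the common point is the supremum of the left
    ends. *)
Lemma nested_point (u : nat -> R) (w : R) : 0 <= w ->
  (forall n, u n <= u (S n) <= u n + w / 2 ^ S n) ->
  exists x, forall n, u n <= x <= u n + w / 2 ^ n.
Proof.
  intros Hw H.
  assert (Hh : forall n, u (S n) + w / 2 ^ S n <= u n + w / 2 ^ n).
  { intros n; specialize (H n); assert (0 < 2 ^ n) by (apply pow_lt; lra).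
    replace (w / 2 ^ n) with (w / 2 ^ S n + w / 2 ^ S n) by (simpl; field; lra).
    lra. }
  assert (Hp : forall n, 0 <= w / 2 ^ n).
  { intros n; apply Rdiv_le_0_compat; [lra | apply pow_lt; lra]. }
  assert (M1 : forall n k, u n <= u (n + k)%nat).
  { intros n k; induction k as [|k IH]; [rewrite Nat.add_0_r; lra|].
    rewrite Nat.add_succ_r; specialize (H (n + k)%nat); lra. }
  assert (M2 : forall n k, u (n + k)%nat + w / 2 ^ (n + k) <= u n + w / 2 ^ n).
  { intros n k; induction k as [|k IH]; [rewrite Nat.add_0_r; lra|].
    rewrite Nat.add_succ_r; specialize (Hh (n + k)%nat); lra. }
  assert (M : forall n m, u m <= u n + w / 2 ^ n).
  { intros n m; destruct (Nat.le_ge_cases n m) as [L|L].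
    - replace m with (n + (m - n))%nat by lia.
      specialize (M2 n (m - n)%nat); specialize (Hp (n + (m - n))%nat); lra.
    - specialize (M1 m (n - m)%nat); replace (m + (n - m))%nat with n in M1 by lia.
      specialize (Hp n); lra. }
  destruct (completeness (fun y => exists n, y = u n)) as [x [Hub Hlub]].
  - exists (u 0%nat + w / 2 ^ 0); intros y [n ->]; apply M.
  - exists (u 0%nat); exists 0%nat; auto.
  - exists x; intros n; split; [apply Hub; eauto|].
    apply Hlub; intros y [m ->]; apply M.
Qed.

Lemma pow_half_small (M del : R) : 0 < del -> exists n, M / 2 ^ n < del.
Proof.
  intros Hd; destruct (Pow_x_infinity 2 ltac:(rewrite Rabs_right; lra) (M / del + 1))
    as [n Hn].
  exists n; specialize (Hn n (le_n n)).
  assert (P : 0 < 2 ^ n) by (apply pow_lt; lra).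
  rewrite Rabs_right in Hn by lra.
  apply (Rmult_lt_reg_r (2 ^ n)); auto.
  replace (M / 2 ^ n * 2 ^ n) with (M / del * del) by (field; lra).
  rewrite (Rmult_comm del); apply Rmult_lt_compat_r; lra.
Qed.

Theorem Goursat_rect (g : C -> C) (a b c e : R) : a <= b -> c <= e ->
  (forall x y, a <= x <= b -> c <= y <= e -> exists l, cderiv g (x, y) l) ->
  rect g a b c e = 0%C.
Proof.
  intros Hab Hce H; apply Cmod_eq_0.
  destruct (Cmod_ge_0 (rect g a b c e)) as [P|P]; [exfalso | auto].
  set (w := b - a); set (v := e - c).
  assert (Hw : 0 <= w) by (unfold w; lra); assert (Hv : 0 <= v) by (unfold v; lra).
  (* Half of the supposedly nonzero modulus, so that the invariant of the bisection is strict from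
     [n = 0] on. *)
  set (eta := Cmod (rect g a b c e) / 2).
  assert (Heta : 0 < eta) by (unfold eta; lra).
  assert (Hc : boxcont g a b c e).
  { intros x y Hx Hy; destruct (H x y Hx Hy) as [l Hl].
    apply (cderiv_ccont _ _ _ Hl). }
  set (u := bisect g w v eta (a, c)).
  assert (Hpos : forall n, 0 < 2 ^ n) by (intros; apply pow_lt; lra).
  assert (Hq : forall t n, 0 <= t -> 0 <= t / 2 ^ n)
    by (intros; apply Rdiv_le_0_compat; auto).
  assert (Hhalf : forall t n, t / 2 ^ n = t / 2 ^ S n + t / 2 ^ S n)
    by (intros t n; specialize (Hpos n); simpl; field; lra).
  assert (Inv : forall n,
    eta / 4 ^ n < Cmod (rect g (fst (u n)) (fst (u n) + w / 2 ^ n)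
                            (snd (u n)) (snd (u n) + v / 2 ^ n)) /\
    (a <= fst (u n) /\ fst (u n) + w / 2 ^ n <= b) /\
    (c <= snd (u n) /\ snd (u n) + v / 2 ^ n <= e)).
  { induction n as [|n [I1 [I2 I3]]].
    - simpl; unfold Rdiv; rewrite Rinv_1, !Rmult_1_r; unfold w, v.
      replace (a + (b - a)) with b by ring; replace (c + (e - c)) with e by ring.
      split; [unfold eta; lra | lra].
    - pose proof (bisect_step_spec g w v eta n (u n) Hw Hv) as S.
      change (u (Datatypes.S n)) with (bisect_step g w v eta n (u n)).
      destruct S as [S1 [S2 S3]]; auto.
      { apply (boxcont_mono g a b c e); auto; lra. }
      rewrite Hhalf in I2, I3.
      split; [exact S1 | lra]. }
  assert (Mono : forall n, (fst (u n) <= fst (u (S n)) <= fst (u n) + w / 2 ^ S n) /\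
                           (snd (u n) <= snd (u (S n)) <= snd (u n) + v / 2 ^ S n)).
  { intros n; destruct (Inv n) as [I1 [I2 I3]].
    destruct (bisect_step_spec g w v eta n (u n) Hw Hv) as [S1 [S2 S3]]; auto.
    apply (boxcont_mono g a b c e); auto; lra. }
  destruct (nested_point (fun n => fst (u n)) w Hw (fun n => proj1 (Mono n)))
    as [p Hp].
  destruct (nested_point (fun n => snd (u n)) v Hv (fun n => proj2 (Mono n)))
    as [q Hq'].
  destruct (H p q) as [l Hl].
  { specialize (Hp 0%nat); destruct (Inv 0%nat) as [_ [I2 _]]; lra. }
  { specialize (Hq' 0%nat); destruct (Inv 0%nat) as [_ [_ I3]]; lra. }
  (* Chosen so that [2 eps (w + v)^2 < eta]: on the [n]-th rectangle the upper bound
     [2 eps (w + v)^2 / 4^n] then contradicts the lower bound [eta / 4^n]. *)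
  set (eps := eta / (2 * (w + v) ^ 2 + 1)).
  assert (Hden : 0 < 2 * (w + v) ^ 2 + 1) by (pose proof (pow2_ge_0 (w + v)); lra).
  assert (Heps : 0 < eps) by (apply Rdiv_lt_0_compat; auto).
  destruct (cderiv_near _ _ _ Hl eps Heps) as [del [Hdel Hnear]].
  destruct (pow_half_small (w + v) del Hdel) as [n Hn].
  specialize (Hp n); specialize (Hq' n); destruct (Inv n) as [I1 [I2 I3]].
  pose proof (rect_near_derivative g l p q eps
    (fst (u n)) (fst (u n) + w / 2 ^ n) (snd (u n)) (snd (u n) + v / 2 ^ n)
    Hp Hq' (Rlt_le _ _ Heps)) as B.
  specialize (Hpos n).
  apply (Rlt_irrefl (eta / 4 ^ n)).
  eapply Rlt_le_trans; [exact I1|]; eapply Rle_trans; [apply B|].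
  - apply (boxcont_mono g a b c e); auto; lra.
  - intros x y Hx Hy; apply Hnear.
    eapply Rle_lt_trans; [apply Cmod_le_abs|]; simpl.
    apply Rle_lt_trans with (w / 2 ^ n + v / 2 ^ n).
    + apply Rplus_le_compat; apply Rabs_le; lra.
    + replace (w / 2 ^ n + v / 2 ^ n) with ((w + v) / 2 ^ n) by (field; lra).
      exact Hn.
  - assert (E4 : 4 ^ n = 2 ^ n * 2 ^ n)
      by (rewrite <- Rpow_mult_distr; f_equal; ring).
    replace (2 * eps * (fst (u n) + w / 2 ^ n - fst (u n)
               + (snd (u n) + v / 2 ^ n - snd (u n))) ^ 2)
      with (eps * (2 * (w + v) ^ 2) / (2 ^ n * 2 ^ n)) by (field; lra).
    rewrite E4; apply Rmult_le_compat_r.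
    { left; apply Rinv_0_lt_compat; nra. }
    replace eta with (eps * (2 * (w + v) ^ 2 + 1)) by (unfold eps; field; lra).
    apply Rmult_le_compat_l; lra.
Qed.

(** * Residues at simple real poles *)

(** Pointwise limits on the axis become uniform by compactness of [[a, b]]: just above and just
    below the axis, [g] is close to the same limit. Hence the two long sides of a thin rectangle
    nearly cancel. *)
Lemma climit_axis_symmetric (g : C -> C) (a b : R) : a <= b ->
  (forall x, a <= x <= b -> exists l, climit g (x, 0) l) ->
  forall eps, 0 < eps -> exists del, 0 < del /\ forall y, 0 < y < del ->
    forall x, a <= x <= b -> Cmod (g (x, (- y)%R) - g (x, y))%C <= eps.
Proof.
  intros Hab H eps He.
  (* The factor 2 leaves room for moving the centre: [(x, y)] lies within [|x - t| + y] of the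
     chosen centre [(t, 0)], and each summand is below [delta t]. *)
  assert (D : forall x, exists d : posreal, a <= x <= b -> exists l,
             forall w, w <> (x, 0) -> Cmod (w - (x, 0))%C < 2 * d ->
               Cmod (g w - l)%C < eps / 2).
  { intros x; destruct (classic (a <= x <= b)) as [I|N].
    - destruct (H x I) as [l Hl]; destruct (Hl (eps / 2)) as [d [Hd Hw]]; [lra|].
      assert (Hd2 : 0 < d / 2) by lra.
      exists (mkposreal _ Hd2); intros _; exists l; intros w N Hwd.
      apply Hw; auto; simpl in Hwd; lra.
    - exists (mkposreal _ Rlt_0_1); tauto. }
  set (delta := fun x => proj1_sig (constructive_indefinite_description _ (D x))).
  assert (Hdelta : forall x, a <= x <= b -> exists l,
             forall w, w <> (x, 0) -> Cmod (w - (x, 0))%C < 2 * delta x ->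
               Cmod (g w - l)%C < eps / 2).
  { intros x; exact (proj2_sig (constructive_indefinite_description _ (D x))). }
  destruct (compactness_value_1d a b delta) as [d Hd].
  exists d; split; [apply cond_pos|]; intros y Hy x Hx.
  (* The compactness principle yields its centre [t] only under a double negation, hence the proof
     by contradiction. *)
  apply Rnot_lt_le; intros Habs; apply (Hd x Hx); intros (t & Ht & Hxt & Hdt).
  destruct (Hdelta t Ht) as [l Hl].
  assert (K : forall s, Rabs s = y -> Cmod (g (x, s) - l)%C < eps / 2).
  { intros s Hs; apply Hl.
    - intros E; apply (f_equal snd) in E; simpl in E.
      rewrite E, Rabs_R0 in Hs; lra.
    - eapply Rle_lt_trans; [apply Cmod_le_abs|]; simpl.
      unfold Rminus in Hxt.
      replace (s + - 0) with s by ring. rewrite Hs; lra. }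
  pose proof (K y (Rabs_right y ltac:(lra))) as K1.
  assert (E2 : Rabs (- y) = y) by (rewrite Rabs_Ropp, Rabs_right; lra).
  pose proof (K (- y) E2) as K2.
  pose proof (Cmod_triangle (g (x, (- y)%R) - l)%C (l - g (x, y))%C) as T.
  replace (g (x, (- y)%R) - l + (l - g (x, y)))%C
    with (g (x, (- y)%R) - g (x, y))%C in T by ring.
  rewrite (Cmod_sub_sym l (g (x, y))) in T. lra.
Qed.

Lemma Cmod_vert (x y : R) : Cmod ((x, y) - (x, 0))%C = Rabs y.
Proof.
  replace ((x, y) - (x, 0))%C with (Ci * RtoC y)%C
    by (apply injective_projections; simpl; ring).
  rewrite Cmod_mult, Cmod_Ci, Cmod_R; ring.
Qed.

Lemma ccont_axis_bounded (g : C -> C) (x : R) : ccont g (x, 0) ->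
  exists M del, 0 <= M /\ 0 < del /\ forall y, Rabs y < del -> Cmod (g (x, y)) <= M.
Proof.
  intros H; destruct (ccont_near _ _ H 1 Rlt_0_1) as [d [Hd Hw]].
  exists (1 + Cmod (g (x, 0))), d; split; [pose proof (Cmod_ge_0 (g (x, 0))); lra|].
  split; auto; intros y Hy; specialize (Hw (x, y)).
  rewrite Cmod_vert in Hw; specialize (Hw Hy).
  pose proof (Cmod_triangle (g (x, y) - g (x, 0))%C (g (x, 0))) as T.
  replace (g (x, y) - g (x, 0) + g (x, 0))%C with (g (x, y)) in T by ring. lra.
Qed.

(* The integrals over the parts above and below a thin strip around the real
   axis vanish, and the strip contributes arbitrarily little. *)
Lemma rect_removable (g : C -> C) (a b c e : R) : a < b -> c < 0 < e ->
  (forall x y, a <= x <= b -> c <= y <= e -> y <> 0 -> exists l, cderiv g (x, y) l) ->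
  (forall x, a <= x <= b -> exists l, climit g (x, 0) l) ->
  ccont g (a, 0) -> ccont g (b, 0) -> rect g a b c e = 0%C.
Proof.
  intros Hab Hce Hd Hl Ha Hb.
  assert (Hcont : forall x y, a <= x <= b -> c <= y <= e -> y <> 0 -> ccont g (x, y)).
  { intros x y Hx Hy N; destruct (Hd x y Hx Hy N) as [l L].
    apply (cderiv_ccont _ _ _ L). }
  assert (Va : vseg g a c e).
  { intros y Hy; destruct (Req_dec y 0) as [->|N]; [auto | apply Hcont; lra]. }
  assert (Vb : vseg g b c e).
  { intros y Hy; destruct (Req_dec y 0) as [->|N]; [auto | apply Hcont; lra]. }
  destruct (ccont_axis_bounded g a Ha) as (Ma & da & HMa & Hda & Ba).
  destruct (ccont_axis_bounded g b Hb) as (Mb & db & HMb & Hdb & Bb).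
  apply Cmod_eq_0; apply Rle_antisym; [|apply Cmod_ge_0].
  apply le_epsilon; intros eps He; rewrite Rplus_0_l.
  set (eta := eps / (2 * (b - a))).
  assert (Heta : 0 < eta) by (apply Rdiv_lt_0_compat; lra).
  destruct (climit_axis_symmetric g a b (Rlt_le _ _ Hab) Hl eta Heta)
    as (d1 & Hd1 & S).
  (* [2 y] respects every constraint: bounded sides ([da], [db]), closeness across the axis ([d1]),
     room inside the rectangle ([c], [e]). The last entry keeps the two short sides below [eps / 4]
     in total, beside [eps / 2] for the long ones. *)
  set (y := Rmin (Rmin (Rmin da db) (Rmin d1 (Rmin (- c) e)))
                 (eps / (4 * (Ma + Mb + 1))) / 2).
  assert (Hmin : 0 < 2 * y /\ 2 * y <= da /\ 2 * y <= db /\ 2 * y <= d1 /\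
                 2 * y <= - c /\ 2 * y <= e /\ 2 * y <= eps / (4 * (Ma + Mb + 1))).
  { assert (0 < eps / (4 * (Ma + Mb + 1))) by (apply Rdiv_lt_0_compat; lra).
    unfold y, Rmin; repeat destruct Rle_dec; lra. }
  destruct Hmin as (Y0 & Y1 & Y2 & Y3 & Y4 & Y5 & Y6); clearbody y.
  assert (E : rect g a b c e = rect g a b (- y) y).
  { rewrite (rect_split_v g a b c (- y) e), (rect_split_v g a b (- y) y e);
      try lra; try (intros t Ht; apply Va || apply Vb; lra).
    rewrite (Goursat_rect g a b c (- y)), (Goursat_rect g a b y e);
      try lra; try (intros; apply Hd; lra). ring. }
  assert (Hh : forall s, Rabs s = y -> rcont_on (fun t => g (t, s)) a b).
  { intros s Hs; apply hseg_rcont; intros x Hx; apply Hcont; auto.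
    - assert (B := Rabs_le_between s y); lra.
    - intros ->; rewrite Rabs_R0 in Hs; lra. }
  assert (Ey : Rabs y = y) by (apply Rabs_right; lra).
  assert (Ey' : Rabs (- y) = y) by (rewrite Rabs_Ropp; exact Ey).
  assert (Hneg : rcont_on (fun t => - g (t, y))%C a b).
  { intros t Ht; destruct (Hh y Ey t Ht) as [H1 H2]; split; simpl;
      apply (@continuous_opp R_UniformSpace R_AbsRing R_NormedModule); auto. }
  assert (Eh : (CInt (fun t => g (t, (- y)%R)) a b - CInt (fun t => g (t, y)) a b)%C
               = CInt (fun t => g (t, (- y)%R) - g (t, y))%C a b).
  { unfold Cminus; rewrite (CInt_plus _ (fun t => - g (t, y))%C) by (auto; lra).
    f_equal; apply injective_projections; simpl;
      destruct (rcont_ex_RInt (fun t => g (t, y)) a b) as [I1 I2]; auto; try lra;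
      symmetry; apply (@RInt_opp R_CompleteNormedModule); auto. }
  rewrite E; unfold rect.
  replace (CInt (fun t => g (t, (- y)%R)) a b
           + Ci * CInt (fun t => g (b, t)) (- y) y
           - CInt (fun t => g (t, y)) a b
           - Ci * CInt (fun t => g (a, t)) (- y) y)%C
    with (CInt (fun t => g (t, (- y)%R) - g (t, y)) a b
           + Ci * CInt (fun t => g (b, t)) (- y) y - 0
           - Ci * CInt (fun t => g (a, t)) (- y) y)%C by (rewrite <- Eh; ring).
  eapply Rle_trans; [apply Cmod_triangle4|].
  rewrite !Cmod_mult, Cmod_Ci, Cmod_0.
  assert (B1 : Cmod (CInt (fun t => g (t, (- y)%R) - g (t, y))%C a b) <= eta * (b - a)).
  { apply CInt_norm_le_const; [lra | |].
    - intros t Ht; apply rcont_plus; [apply (Hh _ Ey' t Ht) | apply (Hneg t Ht)].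
    - intros t Ht; apply S; lra. }
  assert (B2 : Cmod (CInt (fun t => g (b, t)) (- y) y) <= Mb * (y - - y)).
  { apply CInt_norm_le_const; [lra | |].
    - apply vseg_rcont; intros t Ht; apply Vb; lra.
    - intros t Ht; apply Bb, Rabs_def1; lra. }
  assert (B3 : Cmod (CInt (fun t => g (a, t)) (- y) y) <= Ma * (y - - y)).
  { apply CInt_norm_le_const; [lra | |].
    - apply vseg_rcont; intros t Ht; apply Va; lra.
    - intros t Ht; apply Ba, Rabs_def1; lra. }
  assert (B4 : eta * (b - a) = eps / 2) by (unfold eta; field; lra).
  assert (B5 : 2 * y * (Ma + Mb) <= eps / 4).
  { apply Rle_trans with (eps / (4 * (Ma + Mb + 1)) * (Ma + Mb + 1)).
    - apply Rmult_le_compat; lra.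
    - right; field; lra. }
  nra.
Qed.

Lemma cderiv_pole (r p z : C) : z <> p -> exists l, cderiv (fun w => r / (w - p))%C z l.
Proof.
  intros H; eexists; apply cderiv_mult; [apply cderiv_const|].
  apply cderiv_inv; [apply Csub_neq_0; exact H|].
  apply cderiv_minus; [apply cderiv_id | apply cderiv_const].
Qed.

Lemma ccont_pole (r p z : C) : z <> p -> ccont (fun w => r / (w - p))%C z.
Proof. intros H; destruct (cderiv_pole r p z H) as [l L]; apply (cderiv_ccont _ _ _ L). Qed.

Lemma neq_by_Im (x y p : R) : y <> 0 -> (x, y) <> RtoC p.
Proof. intros H E; apply (f_equal snd) in E; simpl in E; auto. Qed.

Lemma neq_by_Re (x y p : R) : x <> p -> (x, y) <> RtoC p.
Proof. intros H E; apply (f_equal fst) in E; simpl in E; auto. Qed.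

(** [G] is [r] times a branch of [log (z - p)], up to a constant. On a horizontal line off the axis,
    [- atan ((t - p) / y)] is smooth and differs from the argument by a constant. [CInt_pole_v] uses
    another such expression, so no cut is ever crossed. *)
Lemma CInt_pole_h (r : C) (p a b y : R) : a <= b -> y <> 0 ->
  let G := fun t => (r * ((/ 2 * ln ((t - p) ^ 2 + y ^ 2))%R, (- atan ((t - p) / y))%R))%C in
  CInt (fun t => r / ((t, y) - p))%C a b = (G b - G a)%C.
Proof.
  intros Hab Hy G; apply CInt_antiderivative; auto.
  - apply (hseg_rcont (fun w => r / (w - p))%C); intros x _.
    apply ccont_pole, neq_by_Im, Hy.
  - assert (P : forall t, 0 < (t - p) ^ 2 + y ^ 2).
    { intros t; pose proof (pow2_ge_0 (t - p)).
      assert (0 < y ^ 2) by (apply pow2_gt_0; auto). lra. }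
    intros t _; specialize (P t); destruct r as [r s]; unfold G; simpl.
    split; auto_derive; simpl in P; try (split; auto; lra || auto); auto;
      try (repeat split; auto; lra);
      field; repeat split; auto; nra.
Qed.

Lemma CInt_pole_v (r : C) (p x c e : R) : c <= e -> x <> p ->
  let G := fun t => (r * ((/ 2 * ln ((x - p) ^ 2 + t ^ 2))%R, (atan (t / (x - p)))%R))%C in
  (Ci * CInt (fun t => r / ((x, t) - p)) c e)%C = (G e - G c)%C.
Proof.
  intros Hce Hx G; assert (Hxp : x - p <> 0) by lra.
  rewrite (CInt_antiderivative _ (fun t => - Ci * G t)%C); auto.
  - apply injective_projections; simpl; ring.
  - apply (vseg_rcont (fun w => r / (w - p))%C); intros y _.
    apply ccont_pole, neq_by_Re, Hx.
  - assert (P : forall t, 0 < (x - p) ^ 2 + t ^ 2).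
    { intros t; pose proof (pow2_ge_0 t).
      assert (0 < (x - p) ^ 2) by (apply pow2_gt_0; auto). lra. }
    intros t _; specialize (P t); destruct r as [r s]; unfold G; simpl.
    split; auto_derive; simpl in P; try (split; auto; lra || auto); auto;
      try (repeat split; auto; lra);
      field; repeat split; auto; nra.
Qed.

Lemma atan_swap (x y : R) : 0 < x -> 0 < y -> atan (x / y) + atan (y / x) = PI / 2.
Proof.
  intros Hx Hy; replace (y / x) with (/ (x / y)) by (field; lra).
  rewrite atan_inv by (apply Rdiv_lt_0_compat; auto). lra.
Qed.

(** The logarithms cancel at the corners. Each corner is left with two arctangents of reciprocal
    arguments, with sum [PI / 2]; the four corners give [2 PI]. *)
Lemma rect_simple_pole (r : C) (p a b c e : R) : a < p < b -> c < 0 < e ->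
  rect (fun z => r / (z - p))%C a b c e = (2 * PI * Ci * r)%C.
Proof.
  intros Hp Hce; unfold rect.
  rewrite !CInt_pole_h, !CInt_pole_v by lra.
  assert (A1 : atan ((b - p) / c) = - atan ((b - p) / - c))
    by (rewrite <- atan_opp; f_equal; field; lra).
  assert (A2 : atan ((a - p) / c) = atan ((p - a) / - c))
    by (f_equal; field; lra).
  assert (A3 : atan (c / (b - p)) = - atan (- c / (b - p)))
    by (rewrite <- atan_opp; f_equal; field; lra).
  assert (A4 : atan ((a - p) / e) = - atan ((p - a) / e))
    by (rewrite <- atan_opp; f_equal; field; lra).
  assert (A5 : atan (e / (a - p)) = - atan (e / (p - a)))
    by (rewrite <- atan_opp; f_equal; field; lra).
  assert (A6 : atan (c / (a - p)) = atan (- c / (p - a)))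
    by (f_equal; field; lra).
  rewrite A1, A2, A3, A4, A5, A6.
  pose proof (atan_swap (b - p) (- c) ltac:(lra) ltac:(lra)) as S1.
  pose proof (atan_swap (p - a) (- c) ltac:(lra) ltac:(lra)) as S2.
  pose proof (atan_swap (b - p) e ltac:(lra) ltac:(lra)) as S3.
  pose proof (atan_swap (p - a) e ltac:(lra) ltac:(lra)) as S4.
  replace (2 * PI * Ci * r)%C with (r * (0%R, (2 * PI)%R))%C
    by (apply injective_projections; simpl; ring).
  match goal with |- ?L = _ =>
    replace L with (r * (0%R, (atan ((b - p) / - c) + atan (- c / (b - p))
      + (atan ((p - a) / - c) + atan (- c / (p - a)))
      + (atan ((b - p) / e) + atan (e / (b - p)))
      + (atan ((p - a) / e) + atan (e / (p - a))))%R))%C end.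
  2: apply injective_projections; simpl; ring.
  rewrite S1, S2, S3, S4; do 2 f_equal; field.
Qed.

Definition residue_sum (l : list (R * C)) : C :=
  fold_right (fun pr s => (snd pr + s)%C) 0%C l.

(** The hypotheses are shaped for an induction on the list: subtracting one principal part preserves
    them for the remaining poles, and the empty list is [rect_removable]. *)
Lemma rect_residues (l : list (R * C)) (a b c e : R) : a < b -> c < 0 < e ->
  forall g : C -> C,
  NoDup (map fst l) ->
  (forall p r, In (p, r) l -> a < p < b) ->
  (forall x y, a <= x <= b -> c <= y <= e -> y <> 0 -> exists l, cderiv g (x, y) l) ->
  (forall x, a <= x <= b -> ~ In x (map fst l) -> exists L, climit g (x, 0) L) ->
  (forall p r, In (p, r) l -> exists L, climit (fun z => g z - r / (z - p))%C (p, 0) L) ->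
  ccont g (a, 0) -> ccont g (b, 0) ->
  rect g a b c e = (2 * PI * Ci * residue_sum l)%C.
Proof.
  intros Hab Hce; induction l as [|[p r] l IH]; intros g Hnd Hin Hd Hlim Hpole Ha Hb.
  - simpl residue_sum; rewrite (rect_removable g) by auto; ring.
  - simpl in Hnd; apply NoDup_cons_iff in Hnd; destruct Hnd as [Hn Hnd].
    assert (Hp : a < p < b) by (apply (Hin p r); left; auto).
    set (g' := fun z => (g z - r / (z - p))%C).
    assert (Hg' : forall z, z <> RtoC p -> ccont g z -> ccont g' z).
    { intros z Hz Hg; apply climit_minus; [exact Hg | apply ccont_pole, Hz]. }
    assert (E' : rect g' a b c e = (2 * PI * Ci * residue_sum l)%C).
    { apply IH; auto.
      - intros q s Hq; apply (Hin q s); right; auto.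
      - intros x y Hx Hy Ny; destruct (Hd x y Hx Hy Ny) as [d1 D1].
        destruct (cderiv_pole r p (x, y) (neq_by_Im x y p Ny)) as [d2 D2].
        exists (d1 - d2)%C; apply cderiv_minus; auto.
      (* The removed pole [p] is now an ordinary point of the axis; its limit is the hypothesis at
         the pole. *)
      - intros x Hx Nx; destruct (Req_dec x p) as [->|Nxp].
        + apply (Hpole p r); left; auto.
        + destruct (Hlim x Hx) as [L HL].
          { intros [E|I]; [apply Nxp; auto | auto]. }
          eexists; apply climit_minus; [exact HL|].
          apply ccont_pole, neq_by_Re, Nxp.
      - intros q s Hq; destruct (Hpole q s) as [L HL]; [right; auto|].
        (* Here the poles have to be distinct: the subtracted term is continuous at [q] and merely
           shifts the limit there. *)
        assert (Nq : q <> p).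
        { intros ->; apply Hn; apply (in_map fst) in Hq; exact Hq. }
        exists (L - r / ((q, 0) - p))%C.
        apply climit_ext with (fun z => g z - s / (z - q) - r / (z - p))%C.
        { intros w _; unfold g', Cminus; ring. }
        apply climit_minus; [exact HL | apply ccont_pole, neq_by_Re, Nq].
      - apply Hg'; [apply neq_by_Re; lra | exact Ha].
      - apply Hg'; [apply neq_by_Re; lra | exact Hb]. }
    assert (Cg : forall x y, a <= x <= b -> c <= y <= e ->
              x = a \/ x = b \/ y = c \/ y = e -> ccont g (x, y)).
    { intros x y Hx Hy B; destruct (Req_dec y 0) as [->|Ny].
      - destruct B as [-> | [-> | [B|B]]]; auto; lra.
      - destruct (Hd x y Hx Hy Ny) as [d1 D1]; apply (cderiv_ccont _ _ _ D1). }
    assert (Np : forall x y, x = a \/ x = b \/ y = c \/ y = e -> (x, y) <> RtoC p).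
    { intros x y [-> | [-> | [-> | ->]]]; [apply neq_by_Re | apply neq_by_Re |
        apply neq_by_Im | apply neq_by_Im]; lra. }
    rewrite (rect_ext g (fun z => g' z + r / (z - p))%C).
    + rewrite rect_plus, E', rect_simple_pole; try lra.
      * simpl residue_sum; ring.
      * repeat split; intros t Ht; apply Hg'; try apply Np; try apply Cg; try lra; tauto.
      * repeat split; intros t Ht; apply ccont_pole, Np; tauto.
    + lra.
    + lra.
    + intros x y _ _ _; unfold g', Cminus; ring.
Qed.

Lemma climit_scaled (f : C -> C) (L p : C) (k : R) : 0 < k ->
  climit f 0%C L -> climit (fun z => f (k * (z - p))%C) p L.
Proof.
  intros Hk H eps He; destruct (H eps He) as [d [Hd Hw]].
  exists (d / k); split; [apply Rdiv_lt_0_compat; auto|].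
  intros w Nw Hwd; apply Hw.
  - apply Cmult_neq_0; [|apply Csub_neq_0, Nw].
    intros E; apply (f_equal fst) in E; simpl in E; lra.
  - replace (k * (w - p) - 0)%C with (k * (w - p))%C by ring.
    rewrite Cmod_mult, Cmod_R, Rabs_right by lra.
    apply (Rmult_lt_reg_r (/ k)); [apply Rinv_0_lt_compat; auto|].
    replace (k * Cmod (w - p) * / k) with (Cmod (w - p)%C) by (field; lra).
    exact Hwd.
Qed.

(** * The contour integral of the sinc error *)

Lemma sin_IZR_PI (k : Z) : sin (IZR k * PI) = 0.
Proof. apply sin_eq_0_1; exists k; reflexivity. Qed.

Lemma cos_IZR_PI_sqr (k : Z) : cos (IZR k * PI) * cos (IZR k * PI) = 1.
Proof.
  pose proof (sin2_cos2 (IZR k * PI)) as H; rewrite sin_IZR_PI in H.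
  unfold Rsqr in H; lra.
Qed.

Lemma Csin_shift (k : Z) (w : C) :
  Csin (w + RtoC (IZR k * PI))%C = (RtoC (cos (IZR k * PI)) * Csin w)%C.
Proof.
  destruct w as [u v].
  replace ((u, v) + RtoC (IZR k * PI))%C with (u + IZR k * PI, v)
    by (apply injective_projections; simpl; ring).
  rewrite !Csin_components, sin_plus, cos_plus, sin_IZR_PI.
  apply injective_projections; simpl; ring.
Qed.

Lemma Csin_zero (u v : R) : Csin (u, v) = 0%C -> v = 0 /\ exists k, u = IZR k * PI.
Proof.
  intros H; pose proof (Cmod2_Csin u v) as E; rewrite H, Cmod_0 in E.
  pose proof (pow2_ge_0 (sin u)); pose proof (pow2_ge_0 (sinh v)).
  split.
  - assert (S0 : sinh v = 0).
    { destruct (Req_dec (sinh v) 0) as [|N]; auto.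
      pose proof (pow2_gt_0 _ N); simpl in *; lra. }
    rewrite <- (arcsinh_sinh v), S0; rewrite <- (arcsinh_sinh 0) at 2.
    rewrite sinh_0; reflexivity.
  - apply sin_eq_0_0.
    destruct (Req_dec (sin u) 0) as [|N]; auto.
    pose proof (pow2_gt_0 _ N); simpl in *; lra.
Qed.

Lemma residue_sum_app (l l' : list (R * C)) :
  residue_sum (l ++ l') = (residue_sum l + residue_sum l')%C.
Proof.
  induction l as [|pr l IH]; simpl; [ring|]. rewrite IH; ring.
Qed.

Lemma residue_sum_seq (f : nat -> R * C) (n : nat) :
  residue_sum (map f (seq 0 (S n))) = sum_n (fun j => snd (f j)) n.
Proof.
  induction n as [|n IH].
  - rewrite sum_O; simpl; ring.
  - rewrite seq_S, map_app, residue_sum_app, IH, sum_Sn; simpl.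
    change plus with Cplus; ring.
Qed.

Lemma sum_n_C_mult_l (c : C) (u : nat -> C) (n : nat) :
  sum_n (fun j => (c * u j)%C) n = (c * sum_n u n)%C.
Proof. exact (sum_n_mult_l (K := C_Ring) c u n). Qed.

(** A node with the residue of the sinc kernel there: [sin (PI z / h)] has derivative
    [cos (k PI) * PI / h] at [k h], and [cos (k PI)] is its own inverse. *)
Definition sinc_pole (F : C -> C) (h x : R) (k : Z) : R * C :=
  (IZR k * h, (F (RtoC (IZR k * h)) / (IZR k * h - x)
               * (cos (IZR k * PI) * h / PI))%C).

(** Put [q z = F z / (z - x)] and [ka = PI / h], and translate the sine to the node [p]. Up to the
    sign [cos (k PI)], the kernel minus its principal part is [q z * (1 / sin (ka (z - p)) - 1 / (ka
    (z - p)))] plus [(q z - q p) / (ka (z - p))]. The first term tends to 0, the second to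
    [q' p / ka]. *)
Lemma sinc_kernel_pole (F : C -> C) (h x : R) (k : Z) (l : C) :
  0 < h -> x <> IZR k * h -> cderiv F (RtoC (IZR k * h)) l ->
  exists L, climit (fun z => F z / ((z - x) * Csin (RtoC (PI / h) * z))
                      - snd (sinc_pole F h x k) / (z - fst (sinc_pole F h x k)))%C
                   (RtoC (IZR k * h)) L.
Proof.
  intros Hh Hx HF.
  assert (HPI := PI_RGT_0).
  assert (Hk : 0 < PI / h) by (apply Rdiv_lt_0_compat; auto).
  set (p := RtoC (IZR k * h)) in *; set (ka := RtoC (PI / h)).
  set (sg := RtoC (cos (IZR k * PI))).
  assert (Hsg : (sg * sg)%C = 1%C)
    by (unfold sg; rewrite <- RtoC_mult, cos_IZR_PI_sqr; reflexivity).
  assert (Npx : (p - x)%C <> 0%C).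
  { apply Csub_neq_0; intros E; apply (f_equal fst) in E; simpl in E; auto. }
  assert (Nka : ka <> 0%C) by (intros E; apply (f_equal fst) in E; simpl in E; lra).
  assert (Nsg : sg <> 0%C) by (intros E; rewrite E in Hsg;
    apply (f_equal fst) in Hsg; simpl in Hsg; lra).
  set (q := fun z : C => (F z / (z - x))%C).
  assert (Hq : exists m, cderiv q p m).
  { eexists; apply cderiv_mult; [exact HF|]; apply cderiv_inv; [exact Npx|].
    apply cderiv_minus; [apply cderiv_id | apply cderiv_const]. }
  destruct Hq as [m Hm].
  pose proof (climit_scaled _ _ p (PI / h) Hk climit_inv_Csin_sub_inv) as Hs.
  fold ka in Hs.
  exists (sg * (q p * 0 + m / ka))%C.
  assert (Hnear : exists del, 0 < del /\ forall z, z <> p -> Cmod (z - p)%C < del ->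
            Csin (ka * (z - p))%C <> 0%C /\ (z - x)%C <> 0%C).
  (* Within distance [h] of the node the sine has no other zero, and within [d1] the factor [z - x]
     does not vanish. *)
  { destruct (ccont_neq_0 (fun z => z - x)%C p) as [d1 [Hd1 H1]]; auto.
    { apply climit_minus; [apply climit_id | apply climit_const]. }
    exists (Rmin h d1); split; [apply Rmin_pos; auto|].
    intros z Nz Hz; split.
    - intros E; destruct (z - p)%C as [u v] eqn:Ez.
      replace (ka * (u, v))%C with (PI / h * u, PI / h * v) in E
        by (apply injective_projections; simpl; ring).
      apply Csin_zero in E; destruct E as [Ev [j Eu]].
      assert (v = 0) by (apply (Rmult_eq_reg_l (PI / h)); lra); subst v.
      assert (Eu' : u = IZR j * h).
      { apply (Rmult_eq_reg_l (PI / h)); [|lra]. rewrite Eu; field; lra. }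
      change ((u, 0)) with (RtoC u) in *.
      assert (Hz' := Rlt_le_trans _ _ _ Hz (Rmin_l _ _)).
      rewrite Cmod_R, Eu', Rabs_mult, (Rabs_right h) in Hz' by lra.
      assert (Hj : Rabs (IZR j) < 1) by (apply (Rmult_lt_reg_r h); lra).
      rewrite <- abs_IZR in Hj; apply lt_IZR in Hj.
      assert (j = 0%Z) by lia; subst j.
      apply (Csub_neq_0 _ _ Nz); rewrite Ez, Eu'; f_equal; simpl; ring.
    - apply H1; eapply Rlt_le_trans; [exact Hz | apply Rmin_r]. }
  destruct Hnear as [del [Hdel Hnear]].
  apply climit_ext_loc with
    (fun z => sg * (q z * (/ Csin (ka * (z - p)) - / (ka * (z - p)))
                    + (q z - q p) / (z - p) / ka))%C del; auto.
  - intros z Nz Hz; destruct (Hnear z Nz Hz) as [N1 N2].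
    assert (N3 := Csub_neq_0 _ _ Nz).
    replace (Csin (ka * z)%C) with (sg * Csin (ka * (z - p)))%C.
    2:{ unfold sg; rewrite <- Csin_shift; f_equal; unfold ka, p.
        replace (IZR k * PI) with (PI / h * (IZR k * h)) by (field; lra).
        rewrite (RtoC_mult (PI / h)); ring. }
    unfold sinc_pole, fst, snd; fold p; fold sg.
    replace (sg * h / PI)%C with (sg / ka)%C.
    2:{ unfold sg, ka; apply injective_projections; simpl; field; lra. }
    replace (IZR k * h - x)%C with (p - x)%C.
    2:{ unfold p; rewrite RtoC_mult; reflexivity. }
    unfold q.
    replace (F z / ((z - x) * (sg * Csin (ka * (z - p)))))%C
      with (sg * (F z / ((z - x) * Csin (ka * (z - p)))) / (sg * sg))%C
      by (field; repeat split; auto).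
    rewrite Hsg; field; repeat split; auto.
  - apply climit_mult; [apply climit_const|].
    apply climit_plus; [apply climit_mult; [|exact Hs]|].
    + apply (cderiv_ccont _ _ _ Hm).
    + apply climit_mult; [exact Hm | apply climit_const].
Qed.

Definition sinc_kernel (F : C -> C) (h x : R) (z : C) : C :=
  (F z / ((z - x) * Csin (RtoC (PI / h) * z)))%C.

Lemma Csin_scaled_zero (h u v : R) : 0 < h ->
  Csin (RtoC (PI / h) * (u, v))%C = 0%C -> v = 0 /\ exists k, u = IZR k * h.
Proof.
  intros Hh E; assert (HPI := PI_RGT_0).
  assert (Hk : 0 < PI / h) by (apply Rdiv_lt_0_compat; auto).
  replace (RtoC (PI / h) * (u, v))%C with (PI / h * u, PI / h * v) in E
    by (apply injective_projections; simpl; ring).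
  apply Csin_zero in E; destruct E as [Ev [j Eu]]; split.
  - apply (Rmult_eq_reg_l (PI / h)); lra.
  - exists j; apply (Rmult_eq_reg_l (PI / h)); [|lra]. rewrite Eu; field; lra.
Qed.

Lemma sinc_kernel_cderiv (F : C -> C) (h x : R) (z l : C) : 0 < h ->
  cderiv F z l -> z <> RtoC x -> (forall k, z <> RtoC (IZR k * h)) ->
  exists m, cderiv (sinc_kernel F h x) z m.
Proof.
  intros Hh HF Nx Nk.
  destruct (ex_cderiv_Csin_scaled (RtoC (PI / h)) z) as [s Hs].
  eexists; apply cderiv_mult; [exact HF|]; apply cderiv_inv.
  - apply Cmult_neq_0; [apply Csub_neq_0, Nx|].
    destruct z as [u v]; intros E; apply Csin_scaled_zero in E; auto.
    destruct E as [-> [k ->]]; apply (Nk k); reflexivity.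
  - apply cderiv_mult; [apply cderiv_minus; [apply cderiv_id | apply cderiv_const]|].
    exact Hs.
Qed.

(** The residue at [x] is [F x / sin (PI x / h)]; multiplying by this sine turns it into [F x] and
    the residues at the nodes into minus the sinc terms. The half-odd [b / h] makes the vertical
    sides pass midway between nodes. *)
Lemma sinc_contour (F : C -> C) (h x D : R) (N : nat) :
  0 < h -> 0 < D -> (forall k, x <> IZR k * h) ->
  let b := (INR N + / 2) * h in
  - b < x < b ->
  (forall u v, - b <= u <= b -> - D <= v <= D -> exists l, cderiv F (u, v) l) ->
  (RtoC (sin (PI * x / h)) * rect (sinc_kernel F h x) (- b) b (- D) D)%C =
  (2 * PI * Ci * (F (RtoC x) -
     sum_sym N (fun k => F (RtoC (IZR k * h)) * RtoC (sinc_basis k h x))))%C.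
Proof.
  intros Hh HD Hx b Hxb HF; assert (HPI := PI_RGT_0).
  assert (Hb : 0 < b).
  { apply Rmult_lt_0_compat; auto; pose proof (pos_INR N); lra. }
  set (sx := RtoC (sin (PI * x / h))).
  assert (Nsx : sin (PI * x / h) <> 0).
  { intros E; apply sin_eq_0_0 in E; destruct E as [k E]; apply (Hx k).
    apply (Rmult_eq_reg_l (PI / h)).
    - replace (PI / h * x) with (PI * x / h) by (field; lra).
      rewrite E; field; lra.
    - apply Rgt_not_eq, Rdiv_lt_0_compat; auto. }
  assert (Nsx' : sx <> 0%C) by (intros E; apply (f_equal fst) in E; auto).
  set (idx := fun j : nat => (Z.of_nat j - Z.of_nat N)%Z).
  set (tl := map (fun j => sinc_pole F h x (idx j)) (seq 0 (S (2 * N)))).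
  set (l := (x, (F (RtoC x) / sx)%C) :: tl).
  assert (Hidx : forall j, In j (seq 0 (S (2 * N))) -> - b < IZR (idx j) * h < b).
  { intros j Hj; apply in_seq in Hj.
    assert (- INR N <= IZR (idx j) <= INR N).
    { rewrite INR_IZR_INZ, <- opp_IZR; unfold idx; split; apply IZR_le; lia. }
    unfold b; split; nra. }
  assert (Hax : forall u, - b <= u <= b -> ~ In u (map fst l) ->
            exists L, cderiv (sinc_kernel F h x) (u, 0) L).
  { intros u Hu Nu; destruct (HF u 0 Hu ltac:(lra)) as [m Hm].
    apply (sinc_kernel_cderiv F h x (u, 0) m); auto.
    - intros E; apply Nu; left; apply (f_equal fst) in E; simpl in *; auto.
    - intros k E; apply Nu; right; apply (f_equal fst) in E; simpl in E.
      unfold tl; rewrite map_map; apply in_map_iff; exists (Z.to_nat (k + Z.of_nat N)).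
      (* A node [k h] in [[- b, b]] has [|k| <= N + 1/2 < N + 1], so it is one of the listed
         poles. *)
      assert (Hk : (- Z.of_nat N <= k <= Z.of_nat N)%Z).
      { assert (Hk : - (INR N + 1) < IZR k < INR N + 1).
        { rewrite E in Hu; unfold b in Hu; split; apply (Rmult_lt_reg_r h); nra. }
        rewrite INR_IZR_INZ, <- plus_IZR, <- opp_IZR in Hk; destruct Hk as [K1 K2].
        apply lt_IZR in K1, K2; lia. }
      split; [|apply in_seq; lia]. unfold sinc_pole, idx; cbn [fst].
      rewrite Z2Nat.id by lia. rewrite E; do 2 f_equal; lia. }
  assert (Hends : forall u, u = b \/ u = - b -> ~ In u (map fst l)).
  { intros u Hu I; destruct I as [I|I]; [cbn [fst] in I; lra|].
    unfold tl in I; rewrite map_map in I; apply in_map_iff in I.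
    destruct I as [j [Ej Hj]]; specialize (Hidx j Hj).
    unfold sinc_pole in Ej; cbn [fst] in Ej; lra. }
  rewrite (rect_residues l).
  - change (residue_sum l) with (F (RtoC x) / sx + residue_sum tl)%C.
    unfold tl; rewrite residue_sum_seq; unfold sum_sym.
    rewrite (sum_n_ext (fun j => (F (RtoC (IZR (Z.of_nat j - Z.of_nat N) * h))
               * RtoC (sinc_basis (Z.of_nat j - Z.of_nat N) h x))%C)
              (fun j => (- sx * snd (sinc_pole F h x (idx j)))%C)).
    + rewrite sum_n_C_mult_l; field; auto.
    + intros j; fold (idx j); unfold sinc_basis, sinc_pole, snd.
      destruct (Req_EM_T x (IZR (idx j) * h)) as [E|_]; [destruct (Hx _ E)|].
      specialize (Hx (idx j)); generalize (idx j), Hx; intros k Nk.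
      replace (sin (PI * (x / h - IZR k)))
        with (sin (PI * x / h) * cos (IZR k * PI)).
      2:{ replace (PI * (x / h - IZR k)) with (PI * x / h - IZR k * PI) by (field; lra).
          rewrite sin_minus, sin_IZR_PI; ring. }
      unfold sx.
      (* The residue has [k h - x] where the sinc function has [x - k h]; this sign turns the sum of
         residues into a difference. *)
      replace (sin (PI * x / h) * cos (IZR k * PI) / (PI * (x / h - IZR k)))
        with (- (sin (PI * x / h) * (cos (IZR k * PI) * h / PI * / (IZR k * h - x)))).
      2:{ field; repeat split; try lra. }
      replace (F (RtoC (IZR k * h)) / (IZR k * h - x))%C
        with (F (RtoC (IZR k * h)) * RtoC (/ (IZR k * h - x)))%C.
      2:{ rewrite RtoC_inv, RtoC_minus, RtoC_mult by lra; reflexivity. }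
      rewrite RtoC_opp, !RtoC_mult.
      replace (cos (IZR k * PI) * h / PI)%C with (RtoC (cos (IZR k * PI) * h / PI))
        by (apply injective_projections; simpl; field; lra).
      match goal with |- ?u = ?v => change (@eq C u v) end; ring.
  - lra.
  - lra.
  - change (map fst l) with (x :: map fst tl); apply NoDup_cons.
    + unfold tl; rewrite map_map; intros I; apply in_map_iff in I; destruct I as [j [Ej _]].
      apply (Hx (idx j)); symmetry; exact Ej.
    + unfold tl; rewrite map_map; apply Injective_map_NoDup; [|apply seq_NoDup].
      intros i j E; unfold sinc_pole in E; cbn [fst] in E.
      apply Rmult_eq_reg_r in E; [|lra]. apply eq_IZR in E; unfold idx in E; lia.
  - intros p r [E|I].
    + apply (f_equal fst) in E; simpl in E; subst p; lra.
    + apply in_map_iff in I; destruct I as [j [Ej Hj]]; specialize (Hidx j Hj).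
      apply (f_equal fst) in Ej; unfold sinc_pole in Ej; cbn [fst] in Ej.
      subst p; lra.
  - intros u v Hu Hv Nv; destruct (HF u v Hu Hv) as [m Hm].
    apply (sinc_kernel_cderiv F h x (u, v) m); auto; intros; apply neq_by_Im, Nv.
  - intros u Hu Nu; destruct (Hax u Hu Nu) as [L HL].
    eexists; apply (cderiv_ccont _ _ _ HL).
  - intros p r [E|I].
    (* At [x] the kernel minus its principal part is the difference quotient of
       [F z / sin (PI z / h)], so the limit is a derivative. *)
    + injection E; intros <- <-.
      assert (Hq : exists m, cderiv (fun z => F z / Csin (RtoC (PI / h) * z))%C
                               (RtoC x) m).
      { destruct (HF x 0 ltac:(lra) ltac:(lra)) as [m Hm].
        destruct (ex_cderiv_Csin_scaled (RtoC (PI / h)) (RtoC x)) as [s Hs].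
        eexists; apply cderiv_mult; [exact Hm|]; apply cderiv_inv; [|exact Hs].
        intros E0; apply Csin_scaled_zero in E0; auto.
        destruct E0 as [_ [k Ek]]; apply (Hx k Ek). }
      destruct Hq as [m Hm]; exists m.
      assert (Esx : Csin (RtoC (PI / h) * RtoC x)%C = sx).
      { rewrite <- RtoC_mult, Csin_RtoC; unfold sx; do 2 f_equal; field; lra. }
      destruct (ccont_neq_0 (fun z => Csin (RtoC (PI / h) * z)%C) (RtoC x))
        as [del [Hdel Nz']].
      { destruct (ex_cderiv_Csin_scaled (RtoC (PI / h)) (RtoC x)) as [s Hs].
        apply (cderiv_ccont _ _ _ Hs). }
      { rewrite Esx; exact Nsx'. }
      apply climit_ext_loc with
        (fun z => (F z / Csin (RtoC (PI / h) * z)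
           - F (RtoC x) / Csin (RtoC (PI / h) * RtoC x)) / (z - RtoC x))%C
        del; [exact Hdel | | exact Hm].
      intros z Nz Hz; rewrite Esx; unfold sinc_kernel.
      specialize (Nz' z Hz); pose proof (Csub_neq_0 _ _ Nz).
      field; repeat split; auto.
    + apply in_map_iff in I; destruct I as [j [Ej Hj]]; specialize (Hidx j Hj).
      destruct (HF (IZR (idx j) * h) 0 ltac:(lra) ltac:(lra)) as [m Hm].
      destruct (sinc_kernel_pole F h x (idx j) m Hh (Hx (idx j)) Hm) as [L HL].
      rewrite Ej in HL; cbn [fst snd] in HL.
      apply (f_equal fst) in Ej; unfold sinc_pole in Ej; cbn [fst] in Ej.
      rewrite Ej in HL; exists L; exact HL.
  - destruct (Hax (- b) ltac:(lra) (Hends _ (or_intror eq_refl))) as [L HL].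
    apply (cderiv_ccont _ _ _ HL).
  - destruct (Hax b ltac:(lra) (Hends _ (or_introl eq_refl))) as [L HL].
    apply (cderiv_ccont _ _ _ HL).
Qed.

(** * Bounds on the sides of the contour *)

Lemma Cmod_Csin_ge_sinh (u v : R) : sinh (Rabs v) <= Cmod (Csin (u, v)).
Proof.
  pose proof (sinh_nonneg _ (Rabs_pos v)) as H0.
  apply Rsqr_incr_0; [|exact H0 | apply Cmod_ge_0].
  rewrite !Rsqr_pow2, Cmod2_Csin; pose proof (pow2_ge_0 (sin u)).
  assert (sinh (Rabs v) ^ 2 = sinh v ^ 2).
  { unfold Rabs; destruct Rcase_abs; [rewrite sinh_odd|]; ring. }
  lra.
Qed.

Lemma Cmod_Csin_ge_1 (u v : R) : Rabs (sin u) = 1 -> 1 <= Cmod (Csin (u, v)).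
Proof.
  intros H; apply Rsqr_incr_0; [|lra | apply Cmod_ge_0].
  rewrite !Rsqr_pow2, Cmod2_Csin; pose proof (pow2_ge_0 (sinh v)).
  rewrite <- (pow2_abs (sin u)), H; lra.
Qed.

Lemma abs_sin_half_odd (N : nat) : Rabs (sin ((INR N + / 2) * PI)) = 1.
Proof.
  rewrite Rmult_plus_distr_r, INR_IZR_INZ, sin_plus, sin_IZR_PI.
  replace (/ 2 * PI) with (PI / 2) by field.
  rewrite cos_PI2, sin_PI2.
  pose proof (cos_IZR_PI_sqr (Z.of_nat N)) as H.
  assert (H' : Rabs (cos (IZR (Z.of_nat N) * PI)) ^ 2 = 1)
    by (rewrite pow2_abs; simpl; lra).
  replace (0 * 0 + cos (IZR (Z.of_nat N) * PI) * 1)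
    with (cos (IZR (Z.of_nat N) * PI)) by ring.
  pose proof (Rabs_pos (cos (IZR (Z.of_nat N) * PI))). simpl in H'; nra.
Qed.

Lemma sinc_kernel_norm_le (F : C -> C) (h x m1 m2 : R) (z : C) :
  0 < m1 -> 0 < m2 -> m1 <= Cmod (z - RtoC x)%C ->
  m2 <= Cmod (Csin (RtoC (PI / h) * z)%C) ->
  Cmod (sinc_kernel F h x z) <= / (m1 * m2) * Cmod (F z).
Proof.
  intros H1 H2 L1 L2; unfold sinc_kernel.
  rewrite Cmod_div, Cmod_mult by (apply Cmult_neq_0; apply Cmod_gt_0; lra).
  unfold Rdiv; rewrite Rmult_comm; apply Rmult_le_compat_r; [apply Cmod_ge_0|].
  apply Rinv_le_contravar; [apply Rmult_lt_0_compat; auto|].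
  apply Rmult_le_compat; lra.
Qed.

(** Each horizontal side is weighted by [1 / (D sinh (PI D / h))]. On a vertical side, of length
    [2 D], the sine is at least 1 in modulus and [|z - x| >= b - |x|]. *)
Lemma sinc_symmetric_error_le (F : C -> C) (phi : R -> R) (h x D V : R) (N : nat) :
  0 < h -> 0 < D -> (forall k, x <> IZR k * h) ->
  let b := (INR N + / 2) * h in
  Rabs x < b ->
  (forall u v, - b <= u <= b -> - D <= v <= D -> exists l, cderiv F (u, v) l) ->
  ex_RInt phi (- b) b ->
  (forall u, - b <= u <= b -> Cmod (F (u, D)) <= phi u) ->
  (forall u, - b <= u <= b -> Cmod (F (u, (- D)%R)) <= phi u) ->
  (forall v, - D <= v <= D -> Cmod (F (b, v)) <= V) ->
  (forall v, - D <= v <= D -> Cmod (F ((- b)%R, v)) <= V) ->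
  2 * PI * Cmod (F (RtoC x) -
     sum_sym N (fun k => F (RtoC (IZR k * h)) * RtoC (sinc_basis k h x)))%C
  <= 2 * RInt phi (- b) b / (D * sinh (PI * D / h)) + 4 * D * V / (b - Rabs x).
Proof.
  intros Hh HD Hx b Hxb HF Hphi HU HL HR HLf; assert (HPI := PI_RGT_0).
  assert (Hxb' := Rabs_def2 _ _ Hxb).
  assert (Hb : 0 < b) by lra.
  assert (Hk : 0 < PI / h) by (apply Rdiv_lt_0_compat; auto).
  assert (HS : 0 < sinh (PI * D / h))
    by (apply sinh_pos, Rdiv_lt_0_compat; auto; apply Rmult_lt_0_compat; auto).
  set (g := sinc_kernel F h x).
  assert (Escale : forall u v, (RtoC (PI / h) * (u, v))%C = (PI / h * u, PI / h * v))
    by (intros; apply injective_projections; simpl; ring).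
  assert (Ke : forall y, Rabs y = D -> rcont_on (fun t => g (t, y)) (- b) b).
  { intros y Hy; assert (Ny : y <> 0) by (intros ->; rewrite Rabs_R0 in Hy; lra).
    assert (Hy' := Rabs_le_between y D).
    apply hseg_rcont; intros u Hu; destruct (HF u y Hu ltac:(lra)) as [l Hl].
    destruct (sinc_kernel_cderiv F h x (u, y) l) as [m Hm]; auto;
      try (intros; apply neq_by_Im, Ny). apply (cderiv_ccont _ _ _ Hm). }
  assert (Kv : forall u, u = b \/ u = - b -> rcont_on (fun t => g (u, t)) (- D) D).
  { intros u Hu; apply vseg_rcont; intros v Hv.
    destruct (HF u v ltac:(lra) ltac:(lra)) as [l Hl].
    destruct (sinc_kernel_cderiv F h x (u, v) l) as [m Hm]; auto.
    - apply neq_by_Re; lra.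
    - intros k; apply neq_by_Re; intros E.
      (* A node on a vertical side would make [sin (PI u / h)] vanish, whereas at a half-odd
         multiple of [h] it is 1 in modulus. *)
      assert (E1 : PI / h * u = IZR k * PI) by (rewrite E; field; lra).
      assert (E2 : Rabs (sin (PI / h * u)) = 1).
      { destruct Hu as [->| ->].
        - replace (PI / h * b) with ((INR N + / 2) * PI) by (unfold b; field; lra).
          apply abs_sin_half_odd.
        - replace (PI / h * - b) with (- ((INR N + / 2) * PI)) by (unfold b; field; lra).
          rewrite sin_neg, Rabs_Ropp; apply abs_sin_half_odd. }
      rewrite E1, sin_IZR_PI, Rabs_R0 in E2; lra.
    - apply (cderiv_ccont _ _ _ Hm). }
  assert (Bh : forall y, Rabs y = D ->
            (forall u, - b <= u <= b -> Cmod (F (u, y)) <= phi u) ->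
            Cmod (CInt (fun t => g (t, y)) (- b) b)
            <= / (D * sinh (PI * D / h)) * RInt phi (- b) b).
  { intros y Hy HB.
    replace (/ (D * sinh (PI * D / h)) * RInt phi (- b) b)
      with (RInt (fun t => / (D * sinh (PI * D / h)) * phi t) (- b) b)
      by (apply (@RInt_scal R_CompleteNormedModule); auto).
    apply CInt_norm_le; [lra | apply Ke, Hy | apply (@ex_RInt_scal R_NormedModule), Hphi |].
    intros t Ht; eapply Rle_trans.
    - apply (sinc_kernel_norm_le F h x D (sinh (PI * D / h))); auto.
      + eapply Rle_trans; [|apply Cmod_Im_le]; simpl.
        replace (y + - 0) with y by ring; lra.
      + rewrite Escale; eapply Rle_trans; [|apply Cmod_Csin_ge_sinh].
        rewrite Rabs_mult, Hy, Rabs_right by lra.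
        right; f_equal; field; lra.
    - apply Rmult_le_compat_l; [|apply HB; lra].
      left; apply Rinv_0_lt_compat, Rmult_lt_0_compat; auto. }
  assert (Bv : forall u, u = b \/ u = - b ->
            (forall v, - D <= v <= D -> Cmod (F (u, v)) <= V) ->
            Cmod (CInt (fun t => g (u, t)) (- D) D) <= / (b - Rabs x) * V * (D - - D)).
  { intros u Hu HB; apply CInt_norm_le_const; [lra | apply Kv, Hu |].
    intros t Ht; eapply Rle_trans.
    - apply (sinc_kernel_norm_le F h x (b - Rabs x) 1); try lra.
      + eapply Rle_trans; [|apply re_le_Cmod]; simpl.
        assert (Eu : Rabs u = b)
          by (destruct Hu as [->| ->]; [rewrite Rabs_right | rewrite Rabs_left]; lra).
        rewrite <- Eu; apply Rabs_triang_inv.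
      + rewrite Escale; apply Cmod_Csin_ge_1.
        destruct Hu as [->| ->].
        * replace (PI / h * b) with ((INR N + / 2) * PI) by (unfold b; field; lra).
          apply abs_sin_half_odd.
        * replace (PI / h * - b) with (- ((INR N + / 2) * PI)) by (unfold b; field; lra).
          rewrite sin_neg, Rabs_Ropp; apply abs_sin_half_odd.
    - rewrite Rmult_1_r; apply Rmult_le_compat_l; [|apply HB; lra].
      left; apply Rinv_0_lt_compat; lra. }
  pose proof (sinc_contour F h x D N Hh HD Hx ltac:(fold b; lra) HF) as E.
  fold b in E; apply (f_equal Cmod) in E; rewrite !Cmod_mult in E.
  rewrite Cmod_Ci, !Cmod_R, (Rabs_right 2), (Rabs_right PI), Rmult_1_r in E by lra.
  rewrite <- E.
  (* Dropping [|sin (PI x / h)| <= 1] keeps the estimate from deteriorating as [x] approaches a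
     node. *)
  apply Rle_trans with (1 * Cmod (rect (sinc_kernel F h x) (- b) b (- D) D)).
  { apply Rmult_le_compat_r; [apply Cmod_ge_0|].
    apply Rabs_le, SIN_bound. }
  rewrite Rmult_1_l; unfold rect; fold g.
  eapply Rle_trans; [apply Cmod_triangle4|].
  rewrite !Cmod_mult, Cmod_Ci.
  pose proof (Bh D (Rabs_right D ltac:(lra)) HU) as B1.
  pose proof (Bh (- D) ltac:(rewrite Rabs_Ropp, Rabs_right; lra) HL) as B2.
  pose proof (Bv b (or_introl eq_refl) HR) as B3.
  pose proof (Bv (- b) (or_intror eq_refl) HLf) as B4.
  unfold Rdiv.
  replace (4 * D * V * / (b - Rabs x)) with (2 * (/ (b - Rabs x) * V * (D - - D))) by ring.
  lra.
Qed.

(** * Elementary estimates on the strip *)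

Lemma PI_gt_3 : 3 < PI.
Proof. generalize PI2_3_2; lra. Qed.

Lemma mul_cos_le_sin (t : R) : 0 <= t <= PI -> t * cos t <= sin t.
Proof.
  intros Ht; enough (sin 0 - 0 * cos 0 <= sin t - t * cos t)
    by (rewrite sin_0 in *; lra).
  apply (le_of_derive_nonneg (fun t => sin t - t * cos t) (fun t => t * sin t)).
  - lra.
  - intros s _; auto_derive; auto; ring.
  - intros s Hs; pose proof (sin_ge_0 s); apply Rmult_le_pos; lra.
Qed.

(** The derivative of [u sin t - sin (u t)] in [u] is [sin t - t cos (u t)], and
    [cos (u t) <= cos t] reduces its sign to [mul_cos_le_sin]. *)
Lemma sin_mul_le (u t : R) : 1 <= u -> 0 <= t -> u * t <= PI ->
  sin (u * t) <= u * sin t.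
Proof.
  intros Hu Ht Hut.
  enough (1 * sin t - sin (1 * t) <= u * sin t - sin (u * t))
    by (rewrite !Rmult_1_l in *; lra).
  apply (le_of_derive_nonneg (fun u => u * sin t - sin (u * t))
    (fun u => sin t - t * cos (u * t))); auto.
  - intros s _; auto_derive; auto; ring.
  - intros s Hs.
    assert (Hst : t <= s * t <= PI) by nra.
    pose proof (mul_cos_le_sin t ltac:(lra)).
    pose proof (cos_decr_1 t (s * t)) as C.
    assert (cos (s * t) <= cos t) by (apply C; lra).
    nra.
Qed.

(** Compares slopes: in the variable [u^2], at [u = 1], [sin (u A)^2] has derivative
    [A sin A cos A], and the line that is to dominate it has slope [B^2 sin A ^ 2] with
    [B^2 = (PI / 2)^2 - A^2]. Factoring this difference of squares, [cos A <= PI / 2 - A] and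
    [A <= (PI / 2 + A) sin A] suffice. *)
Lemma mul_cos_le (A : R) : 0 <= A <= PI / 2 ->
  A * cos A <= ((PI / 2) ^ 2 - A ^ 2) * sin A.
Proof.
  intros HA; pose proof PI_gt_3; pose proof PI_4.
  assert (C : 0 <= cos A <= PI / 2 - A).
  { rewrite cos_sin; replace (PI / 2 + A) with (PI - (PI / 2 - A)) by field.
    rewrite sin_PI_x; split; [apply sin_ge_0; lra|].
    pose proof (sin_cubic_pos (PI / 2 - A)); lra. }
  pose proof (sin_cubic_pos A ltac:(lra)) as S.
  assert (S' : A <= (PI / 2 + A) * sin A).
  { apply Rle_trans with (A * ((3 / 2 + A) * (1 - A ^ 2 / 6))).
    - assert (1 <= (3 / 2 + A) * (1 - A ^ 2 / 6)).
      { assert (A * A <= 2 * A) by nra. simpl; nra. }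
      nra.
    - assert (A - A ^ 3 / 6 >= 0) by (simpl; nra).
      replace (A * ((3 / 2 + A) * (1 - A ^ 2 / 6)))
        with ((3 / 2 + A) * (A - A ^ 3 / 6)) by field.
      apply Rmult_le_compat; lra. }
  replace ((PI / 2) ^ 2 - A ^ 2) with ((PI / 2 - A) * (PI / 2 + A)) by ring.
  rewrite Rmult_assoc; apply Rle_trans with ((PI / 2 - A) * A); nra.
Qed.

(* [sin (u A) ^ 2] is concave in [u ^ 2] as long as [u A <= PI / 2], hence lies
   below its tangent at [u = 1]; beyond, it is at most 1. *)
Lemma sin_dilated_sqr_le (A B u : R) : 0 <= A < PI / 2 ->
  B ^ 2 = (PI / 2) ^ 2 - A ^ 2 -> 1 <= u ->
  sin (u * A) ^ 2 <= sin A ^ 2 * (1 + B ^ 2 * (u ^ 2 - 1)).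
Proof.
  intros HA HB Hu; rewrite HB.
  pose proof (mul_cos_le A ltac:(lra)) as M; set (b := (PI / 2) ^ 2 - A ^ 2) in *.
  assert (S0 : 0 <= sin A) by (apply sin_ge_0; lra).
  assert (C0 : 0 < cos A) by (apply cos_gt_0; lra).
  assert (U : 0 <= u ^ 2 - 1) by (simpl; nra).
  destruct (Rle_dec (u * A) (PI / 2)) as [L|L].
  - assert (T : sin (u * A) ^ 2 <= sin A ^ 2 + A * sin A * cos A * (u ^ 2 - 1)).
    { enough (sin A ^ 2 + A * sin A * cos A * (1 ^ 2 - 1) - sin (1 * A) ^ 2
              <= sin A ^ 2 + A * sin A * cos A * (u ^ 2 - 1) - sin (u * A) ^ 2)
        by (rewrite !Rmult_1_l in *; lra).
      apply (le_of_derive_nonneg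
        (fun u => sin A ^ 2 + A * sin A * cos A * (u ^ 2 - 1) - sin (u * A) ^ 2)
        (fun u => A * (u * sin (2 * A) - sin (u * (2 * A))))); auto.
      - intros s _; auto_derive; auto.
        replace (s * (2 * A)) with (2 * (s * A)) by ring; rewrite !sin_2a; ring.
      - intros s Hs; apply Rmult_le_pos; [lra|].
        pose proof (sin_mul_le s (2 * A) ltac:(lra) ltac:(lra)) as K.
        assert (s * A <= u * A) by nra. specialize (K ltac:(lra)); lra. }
    eapply Rle_trans; [exact T|].
    replace (sin A ^ 2 * (1 + b * (u ^ 2 - 1)))
      with (sin A ^ 2 + sin A * (b * sin A) * (u ^ 2 - 1)) by ring.
    apply Rplus_le_compat_l, Rmult_le_compat_r; auto.
    replace (A * sin A * cos A) with (sin A * (A * cos A)) by ring.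
    apply Rmult_le_compat_l; auto.
  (* The right-hand side must reach 1, that is [cos A ^ 2 <= sin A ^ 2 * b * (u^2 - 1)]. Now
     [u A > PI / 2] means [b <= A^2 (u^2 - 1)], and the square of [mul_cos_le] supplies the rest. *)
  - assert (A0 : 0 < A) by nra.
    assert (S1 : 0 < sin A) by (apply sin_gt_0; lra).
    apply Rle_trans with 1.
    { pose proof (SIN_bound (u * A)); simpl; nra. }
    assert (U2 : b <= A ^ 2 * (u ^ 2 - 1)) by (unfold b; simpl; nra).
    assert (b0 : 0 < b) by (unfold b; simpl; nra).
    assert (M2 : A ^ 2 * cos A ^ 2 <= b ^ 2 * sin A ^ 2).
    { rewrite <- !Rpow_mult_distr; apply pow_incr; nra. }
    pose proof (sin2_cos2 A) as SC; unfold Rsqr in SC.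
    assert (K : A ^ 2 * cos A ^ 2 <= A ^ 2 * (sin A ^ 2 * (b * (u ^ 2 - 1)))).
    { eapply Rle_trans; [exact M2|].
      replace (b ^ 2 * sin A ^ 2) with (b * sin A ^ 2 * b) by ring.
      replace (A ^ 2 * (sin A ^ 2 * (b * (u ^ 2 - 1))))
        with (b * sin A ^ 2 * (A ^ 2 * (u ^ 2 - 1))) by ring.
      apply Rmult_le_compat_l; auto. apply Rmult_le_pos; [lra | apply pow2_ge_0]. }
    apply Rmult_le_reg_l in K; [|apply pow_lt; auto]. simpl in *; lra.
Qed.

Lemma cosh_sqr_ge (t : R) : 1 + t ^ 2 <= cosh t ^ 2.
Proof.
  rewrite cosh_sqr; apply Rplus_le_compat_l.
  destruct (Rle_dec 0 t) as [P|N].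
  - pose proof (sinh_ge_id t P); apply pow_incr; lra.
  - pose proof (sinh_ge_id (- t) ltac:(lra)) as H; rewrite sinh_odd in H.
    simpl; nra.
Qed.

(** With [p = B s] and [q = u A], [|1 + exp (2 p + 2 i q)|^2] is [(1 + exp (2 p))^2 - 4 exp (2 p)
    sin q ^ 2], and [(1 + exp (2 p))^2 = 4 exp (2 p) cosh p ^ 2]. The claim becomes
    [sin (u A)^2 <= sin A ^ 2 * cosh (B s)^2], which follows from [sin_dilated_sqr_le] and
    [cosh t ^ 2 >= 1 + t^2]. *)
Lemma Cmod_one_plus_Cexp_ge (A B u s : R) : 0 <= A < PI / 2 ->
  B ^ 2 = (PI / 2) ^ 2 - A ^ 2 -> 1 <= u -> s ^ 2 = u ^ 2 - 1 ->
  (1 + exp (2 * (B * s))) * cos A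
  <= Cmod (1 + Cexp ((2 * (B * s))%R, (2 * (u * A))%R))%C.
Proof.
  intros HA HB Hu Hs.
  assert (C0 : 0 < cos A) by (apply cos_gt_0; lra).
  pose proof (exp_pos (2 * (B * s))).
  apply Rsqr_incr_0; [| apply Rmult_le_pos; lra | apply Cmod_ge_0].
  rewrite !Rsqr_pow2, Cmod2_alt; unfold Cexp; simpl Re; simpl Im.
  pose proof (sin_dilated_sqr_le A B u HA HB Hu) as J.
  pose proof (cosh_sqr_ge (B * s)) as K; rewrite Rpow_mult_distr, Hs in K.
  assert (J' : sin (u * A) ^ 2 <= sin A ^ 2 * cosh (B * s) ^ 2).
  { eapply Rle_trans; [exact J|]. apply Rmult_le_compat_l; [apply pow2_ge_0 | exact K]. }
  assert (E : 4 * exp (2 * (B * s)) * cosh (B * s) ^ 2 = (1 + exp (2 * (B * s))) ^ 2).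
  { unfold cosh; replace (2 * (B * s)) with (B * s + B * s) by ring.
    rewrite exp_plus, exp_Ropp; field. apply Rgt_not_eq, exp_pos. }
  set (e := exp (2 * (B * s))) in *.
  pose proof (sin2_cos2 (2 * (u * A))) as SC; unfold Rsqr in SC.
  pose proof (sin2_cos2 A) as SA; unfold Rsqr in SA.
  pose proof (cos_2a_sin (u * A)) as C2.
  set (S := sin (2 * (u * A))) in *; set (C := cos (2 * (u * A))) in *.
  replace ((1 + e * C) ^ 2 + (0 + e * S) ^ 2)
    with (1 + 2 * e * C + e ^ 2 * (S * S + C * C)) by ring.
  rewrite SC, C2.
  replace (((1 + e) * cos A) ^ 2) with ((1 + e) ^ 2 * (1 - sin A ^ 2))
    by (replace (1 - sin A ^ 2) with (cos A * cos A) by (simpl; lra); ring).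
  assert (4 * e * sin (u * A) ^ 2 <= sin A ^ 2 * (1 + e) ^ 2).
  { rewrite <- E. replace (sin A ^ 2 * (4 * e * cosh (B * s) ^ 2))
      with (4 * e * (sin A ^ 2 * cosh (B * s) ^ 2)) by ring.
    apply Rmult_le_compat_l; lra. }
  simpl in *; lra.
Qed.

Lemma exp_ge_quadratic (a : R) : 0 <= a -> 1 + a + a ^ 2 / 2 <= exp a.
Proof.
  intros Ha; enough (exp 0 - (1 + 0 + 0 ^ 2 / 2) <= exp a - (1 + a + a ^ 2 / 2))
    by (rewrite exp_0 in *; lra).
  apply (le_of_derive_nonneg (fun a => exp a - (1 + a + a ^ 2 / 2))
    (fun a => exp a - (1 + a))); auto.
  - intros t _; auto_derive; auto; field.
  - intros t _; pose proof (exp_ineq1_le t); lra.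
Qed.

Lemma ln_one_plus_le (t : R) : 0 < t -> ln (1 + t) <= t.
Proof.
  intros Ht; rewrite <- (ln_exp t) at 2; apply ln_le; [lra|].
  apply exp_ineq1_le.
Qed.

(** Used with [M = PI cosh x] and [a = PI sinh x cos y], where [M^2 >= PI^2 + a^2]; the 9 stands for
    [PI^2]. *)
Lemma softplus_le (a M : R) : 0 <= M -> 9 + a ^ 2 <= M ^ 2 ->
  ln (1 + exp a) * (1 + exp (- a)) <= M.
Proof.
  intros HM H; pose proof (exp_pos a) as P; pose proof (exp_pos (- a)) as P'.
  assert (E : exp a * exp (- a) = 1)
    by apply exp_mult_opp.
  assert (M3 : 3 <= M) by (pose proof (pow2_ge_0 a); simpl in *; nra).
  destruct (Rle_dec 0 a) as [L|L].
  - assert (L1 : ln (1 + exp a) <= a + exp (- a)).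
    { replace (1 + exp a) with (exp a * (1 + exp (- a)))
        by (rewrite Rmult_plus_distr_l, E; ring).
      rewrite ln_mult, ln_exp by lra; pose proof (ln_one_plus_le (exp (- a)) P'); lra. }
    pose proof (exp_ge_quadratic a L) as Q.
    (* The product is at most [a + T]. As [exp (- a) (1 + a + a^2 / 2) <= 1] bounds both [T] and
       [a T] by 2, [(a + T)^2 <= a^2 + 8]. *)
    set (T := exp (- a) * (a + 2)).
    assert (E1 : exp (- a) <= 1) by (pose proof (pow2_ge_0 a); nra).
    assert (Q' : exp (- a) * (1 + a + a ^ 2 / 2) <= 1)
      by (rewrite <- E, Rmult_comm; apply Rmult_le_compat_r; lra).
    assert (T2 : T <= 2).
    { unfold T; assert (0 <= exp (- a) * a) by (apply Rmult_le_pos; lra).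
      assert (0 <= exp (- a) * (a ^ 2)) by (apply Rmult_le_pos; [lra | apply pow2_ge_0]).
      lra. }
    assert (aT : a * T <= 2).
    { unfold T; simpl in *; lra. }
    assert (T0 : 0 <= T) by (unfold T; apply Rmult_le_pos; lra).
    apply Rle_trans with (a + T).
    + apply Rle_trans with ((a + exp (- a)) * (1 + exp (- a))).
      * apply Rmult_le_compat_r; lra.
      * unfold T; nra.
    + apply Rsqr_incr_0; [unfold Rsqr; simpl in *; nra | lra | lra].
  - assert (exp a <= 1) by (rewrite <- exp_0; left; apply exp_increasing; lra).
    pose proof (ln_one_plus_le (exp a) P).
    apply Rle_trans with (exp a * (1 + exp (- a))).
    + apply Rmult_le_compat_r; lra.
    + lra.
Qed.

(** * Mean value inequality along segments *)

Lemma le_of_ex_derive_nonneg (f : R -> R) (a b : R) : a <= b ->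
  (forall t, a <= t <= b -> exists l, is_derive f t l /\ 0 <= l) -> f a <= f b.
Proof.
  intros Hab H; apply (le_of_derive_nonneg f (Derive f)); auto;
    intros t Ht; destruct (H t Ht) as [l [Hl P]];
    rewrite (is_derive_unique _ _ _ Hl); auto.
Qed.

(** Projecting [f] onto the direction of its increment [I] reduces this to a monotone real function.
    It works from pointwise derivatives, so [psi] can be estimated without first showing that its
    derivative is continuous and integrable. *)
Lemma mean_value_le (f : R -> C) (g : R -> R) (a b : R) : a <= b ->
  (forall t, a <= t <= b -> exists (l : C) (m : R),
     is_derive (fun s => Re (f s)) t (Re l) /\
     is_derive (fun s => Im (f s)) t (Im l) /\ is_derive g t m /\ Cmod l <= m) ->
  Cmod (f b - f a)%C <= g b - g a.
Proof.
  intros Hab H; set (I := (f b - f a)%C).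
  assert (K : Cmod I * g a - (Re I * Re (f a) + Im I * Im (f a))
              <= Cmod I * g b - (Re I * Re (f b) + Im I * Im (f b))).
  { apply (le_of_ex_derive_nonneg
      (fun t => Cmod I * g t - (Re I * Re (f t) + Im I * Im (f t)))); auto.
    intros t Ht; destruct (H t Ht) as (l & m & H1 & H2 & H3 & H4).
    exists (Cmod I * m - (Re I * Re l + Im I * Im l)); split.
    - apply (is_derive_minus (V := R_NormedModule)).
      + apply (is_derive_scal g); exact H3.
      + apply (is_derive_plus (V := R_NormedModule));
          [apply (is_derive_scal (fun s => Re (f s))); exact H1
          | apply (is_derive_scal (fun s => Im (f s))); exact H2].
    - pose proof (Cmod_Cauchy_Schwarz I l); pose proof (Cmod_ge_0 I); nra. }
  assert (E : Cmod I * Cmod I = Re I * (Re (f b) - Re (f a)) + Im I * (Im (f b) - Im (f a))).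
  { replace (Cmod I * Cmod I) with (Cmod I ^ 2) by ring.
    rewrite Cmod2_alt; unfold I, Re, Im; simpl; ring. }
  destruct (Cmod_ge_0 I) as [P|P].
  - apply (Rmult_le_reg_l (Cmod I)); auto; lra.
  - rewrite <- P.
    enough (g a <= g b) by lra.
    apply (le_of_ex_derive_nonneg g); auto; intros t Ht;
      destruct (H t Ht) as (l & m & _ & _ & H3 & H4).
    exists m; split; [exact H3|]. pose proof (Cmod_ge_0 l); lra.
Qed.

Lemma cderiv_line (g : C -> C) (z0 v l : C) (t : R) :
  cderiv g (z0 + RtoC t * v)%C l ->
  is_derive (fun s => Re (g (z0 + RtoC s * v)%C)) t (Re (l * v)%C) /\
  is_derive (fun s => Im (g (z0 + RtoC s * v)%C)) t (Im (l * v)%C).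
Proof.
  intros H.
  assert (K : forall eps, 0 < eps -> exists del : posreal, forall k, k <> 0 ->
            Rabs k < del ->
            Cmod ((g (z0 + RtoC (t + k) * v) - g (z0 + RtoC t * v)) * RtoC (/ k)
                   - l * v)%C < eps).
  { intros eps He; pose proof (Cmod_ge_0 v) as Hv.
    destruct (cderiv_near _ _ _ H (eps / (Cmod v + 1))) as [d [Hd Hw]].
    { apply Rdiv_lt_0_compat; lra. }
    assert (Hd' : 0 < d / (Cmod v + 1)) by (apply Rdiv_lt_0_compat; lra).
    exists (mkposreal _ Hd'); intros k Nk Hk; simpl in Hk.
    specialize (Hw (z0 + RtoC (t + k) * v)%C).
    replace (z0 + RtoC (t + k) * v - (z0 + RtoC t * v))%C with (RtoC k * v)%C in Hw
      by (rewrite RtoC_plus; ring).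
    assert (Ek : RtoC k <> 0%C) by (intros E; apply (f_equal fst) in E; auto).
    rewrite Cmod_mult, Cmod_R in Hw.
    set (G := (g (z0 + RtoC (t + k) * v) - g (z0 + RtoC t * v))%C) in *.
    replace (G * RtoC (/ k) - l * v)%C with ((G - l * (RtoC k * v)) * RtoC (/ k))%C
      by (rewrite RtoC_inv by auto; field; auto).
    rewrite Cmod_mult, Cmod_R, Rabs_inv.
    assert (Pk : 0 < Rabs k) by (apply Rabs_pos_lt; auto).
    assert (B : Rabs k * Cmod v < d).
    { apply Rle_lt_trans with (Rabs k * (Cmod v + 1)); [nra|].
      apply Rlt_le_trans with (d / (Cmod v + 1) * (Cmod v + 1)).
      - apply Rmult_lt_compat_r; lra.
      - right; field; lra. }
    specialize (Hw B); apply (Rmult_lt_reg_r (Rabs k)); auto.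
    rewrite Rmult_assoc, Rinv_l, Rmult_1_r by lra.
    eapply Rle_lt_trans; [exact Hw|].
    replace (eps / (Cmod v + 1) * (Rabs k * Cmod v))
      with (eps * Rabs k * (Cmod v / (Cmod v + 1))) by (field; lra).
    assert (Cmod v / (Cmod v + 1) < 1).
    { apply (Rmult_lt_reg_r (Cmod v + 1)); [lra|].
      unfold Rdiv; rewrite Rmult_assoc, Rinv_l; lra. }
    assert (0 < eps * Rabs k) by (apply Rmult_lt_0_compat; auto). nra. }
  split; apply is_derive_Reals; intros eps He; destruct (K eps He) as [d Hd];
    exists d; intros k Nk Hk; specialize (Hd k Nk Hk);
    eapply Rle_lt_trans; [|exact Hd | |exact Hd].
  - eapply Rle_trans; [|apply re_le_Cmod]; right; f_equal.
    unfold Re, Im; simpl; field; auto.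
  - eapply Rle_trans; [|apply Cmod_Im_le]; right; f_equal.
    unfold Re, Im; simpl; field; auto.
Qed.

(** * Growth of psi on the strip *)

Lemma Csinh_components (x y : R) :
  Csinh (x, y) = (sinh x * cos y, cosh x * sin y).
Proof.
  unfold Csinh, Cexp, sinh, cosh; simpl; rewrite cos_neg, sin_neg.
  apply injective_projections; simpl; field.
Qed.

Lemma PI_Csinh (x y : R) :
  (RtoC PI * Csinh (x, y))%C = (PI * sinh x * cos y, PI * cosh x * sin y).
Proof. rewrite Csinh_components; apply injective_projections; simpl; ring. Qed.

Lemma cos_half_PI_sin_pos (y : R) : Rabs y < PI / 2 -> 0 < cos (PI / 2 * sin y).
Proof.
  intros Hy; apply Rabs_def2 in Hy; pose proof PI_gt_3.
  assert (C : 0 < cos y) by (apply cos_gt_0; lra).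
  pose proof (sin2_cos2 y) as S; unfold Rsqr in S.
  assert (-1 < sin y < 1) by (split; nra).
  apply cos_gt_0; nra.
Qed.

Lemma Cmod_one_plus_Cexp_sinh_ge (x y : R) : Rabs y < PI / 2 ->
  (1 + exp (PI * sinh x * cos y)) * cos (PI / 2 * sin y)
  <= Cmod (1 + Cexp (RtoC PI * Csinh (x, y)))%C.
Proof.
  intros Hy; rewrite PI_Csinh; pose proof PI_gt_3.
  assert (P : forall y, 0 <= y < PI / 2 ->
    (1 + exp (PI * sinh x * cos y)) * cos (PI / 2 * sin y)
    <= Cmod (1 + Cexp ((PI * sinh x * cos y)%R, (PI * cosh x * sin y)%R))%C).
  { intros t Ht.
    assert (C : 0 < cos t) by (apply cos_gt_0; lra).
    assert (S : 0 <= sin t) by (apply sin_ge_0; lra).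
    pose proof (sin2_cos2 t) as SC; unfold Rsqr in SC.
    (* The substitution [A = (PI / 2) sin t], [B = (PI / 2) cos t], [u = cosh x], [s = sinh x];
       negative heights follow by conjugation. *)
    replace (PI * sinh x * cos t) with (2 * (PI / 2 * cos t * sinh x)) by field.
    replace (PI * cosh x * sin t) with (2 * (cosh x * (PI / 2 * sin t))) by field.
    apply Cmod_one_plus_Cexp_ge.
    - assert (sin t < 1) by nra.
      split; [apply Rmult_le_pos; lra|]. nra.
    - simpl; nra.
    - apply cosh_ge_1.
    - rewrite cosh_sqr; ring. }
  destruct (Rle_dec 0 y) as [L|L].
  - apply P; rewrite Rabs_right in Hy; lra.
  - rewrite Rabs_left in Hy by lra.
    specialize (P (- y) ltac:(lra)).
    rewrite cos_neg, sin_neg in P.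
    replace (PI / 2 * - sin y) with (- (PI / 2 * sin y)) in P by ring.
    rewrite cos_neg in P; eapply Rle_trans; [exact P|]; right.
    rewrite <- Cmod_conj; f_equal; unfold Cexp, Cconj; simpl.
    replace (PI * cosh x * - sin y) with (- (PI * cosh x * sin y)) by ring.
    rewrite cos_neg, sin_neg; apply injective_projections; simpl; ring.
Qed.

Lemma cosh_exp_sinh_decay (ka eps : R) : 0 < ka -> 0 < eps ->
  exists X0, 0 <= X0 /\ forall X, X0 <= X -> cosh X * exp (- (ka * sinh X)) <= eps.
Proof.
  intros Hk He.
  assert (Hd : 0 < 4 / (ka ^ 2 * eps)).
  { apply Rdiv_lt_0_compat; [lra|]. apply Rmult_lt_0_compat; [apply pow_lt|]; auto. }
  (* With [s = sinh X >= X]: [cosh X <= 2 s] and [exp (ka s) >= (ka s)^2 / 2], so the product is at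
     most [4 / (ka^2 s)]. *)
  exists (Rmax 1 (4 / (ka ^ 2 * eps))); split.
  { pose proof (Rmax_l 1 (4 / (ka ^ 2 * eps))); lra. }
  intros X HX.
  assert (H1 : 1 <= X) by (eapply Rle_trans; [apply Rmax_l | exact HX]).
  assert (H2 : 4 / (ka ^ 2 * eps) <= X) by (eapply Rle_trans; [apply Rmax_r | exact HX]).
  pose proof (sinh_ge_id X ltac:(lra)) as HsX.
  assert (Hc : cosh X <= 1 + sinh X).
  { unfold cosh, sinh; assert (exp (- X) <= 1); [|lra].
    rewrite <- exp_0; left; apply exp_increasing; lra. }
  set (s := sinh X) in *.
  pose proof (exp_ge_quadratic (ka * s) ltac:(nra)) as Q.
  rewrite exp_Ropp; pose proof (exp_pos (ka * s)) as P.
  apply (Rmult_le_reg_r (exp (ka * s))); auto.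
  rewrite Rmult_assoc, Rinv_l, Rmult_1_r by lra.
  apply Rle_trans with (2 * s); [lra|].
  apply Rle_trans with (eps * ((ka * s) ^ 2 / 2)).
  2: apply Rmult_le_compat_l; nra.
  assert (H3 : 4 <= ka ^ 2 * eps * s).
  { apply Rle_trans with (4 / (ka ^ 2 * eps) * (ka ^ 2 * eps)).
    - right; field; split; lra.
    - rewrite (Rmult_comm (ka ^ 2 * eps)); apply Rmult_le_compat_r; [|lra].
      left; apply Rmult_lt_0_compat; [apply pow_lt|]; auto. }
  replace (eps * ((ka * s) ^ 2 / 2)) with (ka ^ 2 * eps * s * (s / 2)) by field.
  nra.
Qed.

(** Differentiating [exp psi = 1 + E] with [E = exp (PI sinh z)] gives [(1 + E) psi' = E PI cosh z],
    by uniqueness of limits. Then [|E| = exp a] and the lower bound for [|1 + E|] are inserted. *)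
Lemma psi_cderiv (psi : C -> C) (x y : R) : is_psi psi -> Rabs y < PI / 2 ->
  exists l, cderiv psi (x, y) l /\
    Cmod l <= PI * cosh x / ((1 + exp (- (PI * sinh x * cos y)))
                             * cos (PI / 2 * sin y)).
Proof.
  intros (Han & Hexp & _) Hy; set (z := (x, y) : C).
  destruct (ex_derive_cderiv psi z) as [l Hl]; [apply Han; exact Hy|].
  exists l; split; [exact Hl|].
  set (E := Cexp (RtoC PI * Csinh z)%C).
  set (ch := ((Cexp z * 1 - Cexp (- z) * - (1)) * / 2)%C).
  assert (H1 : cderiv (fun w => Cexp (psi w)) z (E * (RtoC PI * ch))%C).
  { apply cderiv_ext_loc with (fun w => 1 + Cexp (RtoC PI * Csinh w))%C (PI / 2 - Rabs y).
    - lra.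
    - intros w Hw; symmetry; apply Hexp; unfold strip.
      replace (Im w) with (Im (w - z)%C + y) by (unfold z, Im; simpl; ring).
      pose proof (Cmod_Im_le (w - z)%C).
      eapply Rle_lt_trans; [apply Rabs_triang|]; lra.
    - replace (E * (RtoC PI * ch))%C
        with (0 + E * (0 * Csinh z + RtoC PI * ch))%C by ring.
      apply cderiv_plus; [apply cderiv_const|]; apply cderiv_Cexp_comp.
      apply cderiv_mult; [apply cderiv_const|].
      replace ch with (((Cexp z * 1 - Cexp (- z) * - (1)) * / 2
                         + (Cexp z - Cexp (- z)) * 0))%C
        by (unfold ch; ring).
      apply (cderiv_mult (fun w => Cexp w - Cexp (- w))%C (fun _ => / 2)%C); [|apply cderiv_const].
      apply cderiv_minus; apply cderiv_Cexp_comp; [apply cderiv_id|].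
      apply cderiv_opp, cderiv_id. }
  pose proof (climit_unique _ _ _ _ (cderiv_Cexp_comp _ _ _ Hl) H1) as U.
  rewrite (Hexp z Hy) in U; fold E in U; apply (f_equal Cmod) in U.
  rewrite !Cmod_mult, Cmod_R, (Rabs_right PI) in U by (pose proof PI_gt_3; lra).
  pose proof (Cmod_one_plus_Cexp_sinh_ge x y Hy) as L; fold z E in L.
  pose proof (cos_half_PI_sin_pos y Hy) as Pc.
  assert (Hch : Cmod ch <= cosh x).
  { unfold ch; rewrite Cmod_mult.
    replace (Cexp z * 1 - Cexp (- z) * - (1))%C with (Cexp z + Cexp (- z))%C by ring.
    assert (N2 : RtoC 2 <> 0%C) by (intros N; apply (f_equal fst) in N; simpl in N; lra).
    rewrite Cmod_inv, Cmod_R, Rabs_right by (auto; lra).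
    pose proof (Cmod_triangle (Cexp z) (Cexp (- z)%C)) as T.
    rewrite !Cmod_Cexp in T; simpl in T; unfold cosh. lra. }
  assert (HE : Cmod E = exp (PI * sinh x * cos y))
    by (unfold E, z; rewrite PI_Csinh, Cmod_Cexp; reflexivity).
  rewrite HE in U.
  set (a := PI * sinh x * cos y) in *.
  pose proof (exp_pos a) as Pa; pose proof (exp_pos (- a)) as Pa'.
  assert (Ea : exp a * exp (- a) = 1)
    by apply exp_mult_opp.
  pose proof (Cmod_ge_0 l) as Pl; pose proof PI_gt_3 as P3.
  assert (PD : 0 < (1 + exp (- a)) * cos (PI / 2 * sin y))
    by (apply Rmult_lt_0_compat; lra).
  apply (Rmult_le_reg_r ((1 + exp (- a)) * cos (PI / 2 * sin y))); auto.
  replace (PI * cosh x / ((1 + exp (- a)) * cos (PI / 2 * sin y))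
           * ((1 + exp (- a)) * cos (PI / 2 * sin y))) with (PI * cosh x)
    by (field; split; lra).
  apply (Rmult_le_reg_l (exp a)); auto.
  apply Rle_trans with (exp a * (PI * Cmod ch)).
  - rewrite <- U.
    replace (exp a * (Cmod l * ((1 + exp (- a)) * cos (PI / 2 * sin y))))
      with ((exp a + exp a * exp (- a)) * cos (PI / 2 * sin y) * Cmod l) by ring.
    rewrite Ea, (Rplus_comm (exp a)); apply Rmult_le_compat_r; auto.
  - apply Rmult_le_compat_l; [lra|]; apply Rmult_le_compat_l; lra.
Qed.

Lemma psi_real (psi : C -> C) (x : R) : is_psi psi ->
  psi (x, 0) = RtoC (ln (1 + exp (PI * sinh x))).
Proof.
  intros (_ & Hexp & Him); specialize (Him x).
  assert (S : strip (PI / 2) (RtoC x))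
    by (unfold strip; simpl; rewrite Rabs_R0; pose proof PI_gt_3; lra).
  specialize (Hexp _ S).
  change (RtoC x) with ((x, 0) : C) in *.
  rewrite PI_Csinh, cos_0, sin_0, !Rmult_1_r, !Rmult_0_r in Hexp.
  apply (f_equal Re) in Hexp; unfold Cexp in Hexp; rewrite Him in Hexp; simpl in Hexp.
  rewrite cos_0, !Rmult_1_r in Hexp.
  rewrite <- Hexp, ln_exp; destruct (psi (x, 0)) as [u v]; simpl in *.
  rewrite Him; reflexivity.
Qed.

Lemma Rabs_sin_mono (s t : R) : Rabs s <= Rabs t -> Rabs t < PI / 2 ->
  Rabs (sin s) <= Rabs (sin t).
Proof.
  intros Hst Ht; pose proof PI_gt_3.
  assert (E : forall r, Rabs r < PI / 2 -> Rabs (sin r) = sin (Rabs r)).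
  { intros r Hr; unfold Rabs at 2; destruct (Rcase_abs r) as [N|P].
    - rewrite Rabs_left in Hr by lra; rewrite sin_neg, Rabs_left1; [reflexivity|].
      enough (0 <= sin (- r)) by (rewrite sin_neg in *; lra).
      apply sin_ge_0; lra.
    - rewrite Rabs_right in Hr by lra; apply Rabs_right.
      apply Rle_ge, sin_ge_0; lra. }
  rewrite !E by lra; pose proof (Rabs_pos s).
  apply sin_incr_1; lra.
Qed.

Lemma cos_abs_antimono (s t : R) : Rabs s <= Rabs t -> Rabs t <= PI ->
  cos t <= cos s.
Proof.
  intros Hst Ht.
  assert (E : forall r, cos r = cos (Rabs r)).
  { intros r; unfold Rabs; destruct Rcase_abs; [rewrite cos_neg|]; auto. }
  rewrite (E s), (E t); pose proof (Rabs_pos s); apply cos_decr_1; lra.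
Qed.

Lemma cos_half_PI_sin_antimono (s t : R) : Rabs s <= Rabs t -> Rabs t < PI / 2 ->
  cos (PI / 2 * sin t) <= cos (PI / 2 * sin s).
Proof.
  intros Hst Ht; pose proof PI_gt_3; apply cos_abs_antimono;
    rewrite !Rabs_mult, (Rabs_right (PI / 2)) by lra.
  - apply Rmult_le_compat_l; [lra | apply Rabs_sin_mono; auto].
  - assert (Rabs (sin t) <= 1) by (apply Rabs_le, SIN_bound). nra.
Qed.

(** Supplies the starting value at [-oo]: at abscissa [- X] the line of height [y] is joined to the
    real axis, where [psi] is explicit, and the joining segment contributes nothing as [X] grows. *)
Lemma psi_vertical_le (psi : C -> C) (X y : R) : is_psi psi -> Rabs y < PI / 2 ->
  0 <= X ->
  Cmod (psi ((- X)%R, y) - psi ((- X)%R, 0))%C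
  <= Rabs y * (PI * cosh X * exp (- (PI * cos y * sinh X)) / cos (PI / 2 * sin y)).
Proof.
  intros Hpsi Hy HX; pose proof PI_gt_3.
  set (M := Rabs y * (PI * cosh X * exp (- (PI * cos y * sinh X))
                      / cos (PI / 2 * sin y))).
  pose proof (sinh_nonneg X HX) as Hsx.
  pose proof (cosh_ge_1 X) as Hcx.
  assert (Hty : forall t, 0 <= t <= 1 -> Rabs (t * y) <= Rabs y).
  { intros t Ht; rewrite Rabs_mult, (Rabs_right t) by lra.
    pose proof (Rabs_pos y); nra. }
  set (f := fun t => psi (((- X)%R, 0) + RtoC t * (0, y))%C).
  assert (Hex : forall t, 0 <= t <= 1 -> exists l,
            cderiv psi (((- X)%R, 0) + RtoC t * (0, y))%C l /\
            Cmod (l * (0, y))%C <= M).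
  { intros t Ht; specialize (Hty t Ht).
    destruct (psi_cderiv psi (- X) (t * y) Hpsi ltac:(lra)) as [l [Hl Bl]].
    exists l; split.
    - replace (((- X)%R, 0) + RtoC t * (0, y))%C with (((- X)%R, (t * y)%R) : C)
        by (apply injective_projections; simpl; ring). exact Hl.
    - rewrite Cmod_mult.
      replace ((0, y) : C) with (Ci * RtoC y)%C
        by (apply injective_projections; simpl; ring).
      rewrite Cmod_mult, Cmod_Ci, Cmod_R, Rmult_1_l, Rmult_comm.
      unfold M; apply Rmult_le_compat_l; [apply Rabs_pos|].
      eapply Rle_trans; [exact Bl|].
      pose proof (cos_half_PI_sin_antimono (t * y) y Hty Hy) as C1.
      pose proof (cos_half_PI_sin_pos y Hy) as C2.
      pose proof (cos_abs_antimono (t * y) y Hty ltac:(lra)) as C3.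
      rewrite sinh_odd, cosh_even.
      set (e := exp (- (PI * cos y * sinh X))).
      (* As [sinh (- X)] is negative the exponent on the right is positive, and
         [cos (t * y) >= cos y] makes the exponential at least [1 / e]. *)
      assert (He : / e <= 1 + exp (- (PI * - sinh X * cos (t * y)))).
      { unfold e; rewrite exp_Ropp, Rinv_inv.
        apply Rle_trans with (exp (- (PI * - sinh X * cos (t * y)))).
        - replace (- (PI * - sinh X * cos (t * y))) with (PI * cos (t * y) * sinh X) by ring.
          assert (PI * cos y * sinh X <= PI * cos (t * y) * sinh X)
            by (apply Rmult_le_compat_r; [lra|]; apply Rmult_le_compat_l; lra).
          destruct (Req_dec (PI * cos y * sinh X) (PI * cos (t * y) * sinh X)) as [->|N];
            [lra | left; apply exp_increasing; lra].
        - lra. }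
      assert (Pe : 0 < e) by apply exp_pos.
      assert (Pie : 0 < / e) by (apply Rinv_0_lt_compat; auto).
      replace (PI * cosh X * e / cos (PI / 2 * sin y))
        with (PI * cosh X * / (/ e * cos (PI / 2 * sin y))) by (field; lra).
      apply Rmult_le_compat_l; [nra|].
      apply Rinv_le_contravar; [apply Rmult_lt_0_compat; lra|].
      apply Rmult_le_compat; lra. }
  assert (MV : Cmod (f 1 - f 0)%C <= M * 1 - M * 0).
  { apply (mean_value_le f (fun t => M * t)); [lra|].
    intros t Ht; destruct (Hex t Ht) as [l [Hl Bl]].
    exists (l * (0, y))%C, M.
    destruct (cderiv_line psi _ _ _ t Hl) as [D1 D2].
    split; [exact D1 | split; [exact D2 | split; [|exact Bl]]].
    auto_derive; auto; ring. }
  replace (f 1) with (psi ((- X)%R, y)) in MV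
    by (unfold f; f_equal; apply injective_projections; simpl; ring).
  replace (f 0) with (psi ((- X)%R, 0)) in MV
    by (unfold f; f_equal; apply injective_projections; simpl; ring).
  lra.
Qed.

Lemma psi_norm_le (psi : C -> C) (x y : R) : is_psi psi -> Rabs y < PI / 2 ->
  Cmod (psi (x, y))
  <= ln (1 + exp (PI * sinh x * cos y)) / (cos y * cos (PI / 2 * sin y)).
Proof.
  intros Hpsi Hy; pose proof PI_gt_3.
  assert (Cy : 0 < cos y) by (apply Rabs_def2 in Hy; apply cos_gt_0; lra).
  pose proof (cos_half_PI_sin_pos y Hy) as CA.
  set (A := cos (PI / 2 * sin y)) in *.
  set (G := fun t => ln (1 + exp (PI * sinh t * cos y)) / (cos y * A)).
  change (Cmod (psi (x, y)) <= G x).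
  assert (GP : forall t, 0 <= G t).
  { intros t; apply Rdiv_le_0_compat; [|apply Rmult_lt_0_compat; auto].
    rewrite <- ln_1; apply ln_le; [lra|].
    pose proof (exp_pos (PI * sinh t * cos y)); lra. }
  apply le_epsilon; intros eps He.
  (* Collects what is left at abscissa [- X]: 1 for the real value of [psi], [|y| PI / A] for the
     vertical segment, both multiples of [cosh X * exp (- (PI cos y sinh X))]. *)
  set (D := 1 + Rabs y * PI / A).
  assert (HD : 1 <= D).
  { unfold D; assert (0 <= Rabs y * PI / A); [|lra].
    apply Rdiv_le_0_compat; auto; apply Rmult_le_pos; [apply Rabs_pos | lra]. }
  destruct (cosh_exp_sinh_decay (PI * cos y) (eps / D)) as (X0 & HX0 & B0).
  { apply Rmult_lt_0_compat; lra. }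
  { apply Rdiv_lt_0_compat; lra. }
  (* The second entry ensures [- X <= x], so that the horizontal integration runs to the right. *)
  set (X := Rmax X0 (- x)).
  specialize (B0 X (Rmax_l _ _)).
  assert (HX : 0 <= X) by (pose proof (Rmax_l X0 (- x)); unfold X; lra).
  assert (HXx : - X <= x) by (pose proof (Rmax_r X0 (- x)); unfold X; lra).
  pose proof (psi_vertical_le psi X y Hpsi Hy HX) as V; fold A in V.
  pose proof (sinh_nonneg X HX) as Hsx.
  assert (P0 : Cmod (psi ((- X)%R, 0)) <= cosh X * exp (- (PI * cos y * sinh X))).
  { rewrite (psi_real psi _ Hpsi), Cmod_R, sinh_odd.
    replace (PI * - sinh X) with (- (PI * sinh X)) by ring.
    pose proof (exp_pos (- (PI * sinh X))) as Pe.
    rewrite Rabs_right.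
    2:{ apply Rle_ge; rewrite <- ln_1 at 1; apply ln_le; lra. }
    eapply Rle_trans; [apply ln_one_plus_le, Pe|].
    pose proof (cosh_ge_1 X); pose proof (COS_bound y).
    assert (exp (- (PI * sinh X)) <= exp (- (PI * cos y * sinh X))).
    { assert (0 <= PI * sinh X * (1 - cos y)) by (apply Rmult_le_pos; nra).
      assert (L : - (PI * sinh X) <= - (PI * cos y * sinh X)) by lra.
      destruct L as [L| ->]; [left; apply exp_increasing, L | lra]. }
    pose proof (exp_pos (- (PI * cos y * sinh X))). nra. }
  assert (MV : Cmod (psi (x, y) - psi ((- X)%R, y))%C <= G x - G (- X)).
  { set (f := fun t => psi ((0, y) + RtoC t * 1)%C).
    replace (psi (x, y)) with (f x)
      by (unfold f; f_equal; apply injective_projections; simpl; ring).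
    replace (psi ((- X)%R, y)) with (f (- X))
      by (unfold f; f_equal; apply injective_projections; simpl; ring).
    apply mean_value_le; auto; intros t _.
    destruct (psi_cderiv psi t y Hpsi Hy) as [l [Hl Bl]]; fold A in Bl.
    exists (l * 1)%C, (PI * cosh t / ((1 + exp (- (PI * sinh t * cos y))) * A)).
    destruct (cderiv_line psi (0, y) 1%C l t) as [D1 D2].
    { replace ((0, y) + RtoC t * 1)%C with ((t, y) : C)
        by (apply injective_projections; simpl; ring). exact Hl. }
    split; [exact D1 | split; [exact D2 | split]].
    2: rewrite Cmult_1_r; exact Bl.
    pose proof (exp_pos (PI * sinh t * cos y)) as Pe.
    unfold G; evar (d : R); replace (PI * cosh t / _) with d; unfold d.
    - assert (Ds : is_derive sinh t (cosh t))
        by (unfold sinh, cosh; auto_derive; auto; field).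
      assert (Da : is_derive (fun t => PI * sinh t * cos y) t (PI * cosh t * cos y)).
      { unfold sinh, cosh; auto_derive; auto; field. }
      apply (is_derive_scal_l (fun t => ln (1 + exp (PI * sinh t * cos y))) t
               (exp (PI * sinh t * cos y) * (PI * cosh t * cos y)
                * / (1 + exp (PI * sinh t * cos y))) (/ (cos y * A))).
      apply (is_derive_comp ln (fun t => 1 + exp (PI * sinh t * cos y))).
      + apply is_derive_ln; lra.
      + replace (exp (PI * sinh t * cos y) * (PI * cosh t * cos y))
          with (0 + PI * cosh t * cos y * exp (PI * sinh t * cos y)) by ring.
        apply (is_derive_plus (V := R_NormedModule) (fun _ => 1));
          [apply (@is_derive_const R_AbsRing R_NormedModule)|].
        apply (is_derive_comp exp); [apply is_derive_exp | exact Da].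
    - unfold scal; simpl; unfold mult; simpl.
      rewrite exp_Ropp; field; repeat split; lra. }
  assert (T : Cmod (psi (x, y)) <= Cmod (psi (x, y) - psi ((- X)%R, y))%C
    + Cmod (psi ((- X)%R, y) - psi ((- X)%R, 0))%C + Cmod (psi ((- X)%R, 0))).
  { pose proof (Cmod_triangle (psi (x, y) - psi ((- X)%R, y)
      + (psi ((- X)%R, y) - psi ((- X)%R, 0)))%C (psi ((- X)%R, 0))) as T1.
    replace (psi (x, y) - psi ((- X)%R, y) + (psi ((- X)%R, y) - psi ((- X)%R, 0))
      + psi ((- X)%R, 0))%C with (psi (x, y)) in T1 by ring.
    pose proof (Cmod_triangle (psi (x, y) - psi ((- X)%R, y))%C
                  (psi ((- X)%R, y) - psi ((- X)%R, 0))%C); lra. }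
  assert (B1 : D * (cosh X * exp (- (PI * cos y * sinh X))) <= eps).
  { apply Rle_trans with (D * (eps / D)); [apply Rmult_le_compat_l; lra|].
    right; field; lra. }
  replace (D * (cosh X * exp (- (PI * cos y * sinh X))))
    with (cosh X * exp (- (PI * cos y * sinh X))
          + Rabs y * (PI * cosh X * exp (- (PI * cos y * sinh X)) / A)) in B1
    by (unfold D; field; lra).
  specialize (GP (- X)); lra.
Qed.

(** Since [|exp (- psi)| = 1 / |1 + exp (PI sinh z)|], two bounds with a cosine [A] each are
    multiplied. The quotient [ln (1 + exp a) / (1 + exp a)] is expanded by [1 + exp (- a)]: the
    numerator falls to [softplus_le], and the denominator [2 + exp a + exp (- a)] exceeds
    [exp |a|]. *)
Lemma psi_exp_opp_psi_le (psi : C -> C) (x y : R) : is_psi psi -> Rabs y < PI / 2 ->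
  Cmod (psi (x, y)) * Cmod (Cexp (- psi (x, y))%C)
  <= PI * cosh x * exp (- (PI * Rabs (sinh x) * cos y))
     / (cos (PI / 2 * sin y) ^ 2 * cos y).
Proof.
  intros Hpsi Hy; pose proof PI_gt_3.
  assert (Cy : 0 < cos y) by (apply Rabs_def2 in Hy; apply cos_gt_0; lra).
  pose proof (cos_half_PI_sin_pos y Hy) as CA.
  pose proof (psi_norm_le psi x y Hpsi Hy) as N.
  pose proof (Cmod_one_plus_Cexp_sinh_ge x y Hy) as L.
  destruct Hpsi as (_ & Hexp & _); rewrite <- (Hexp (x, y) Hy) in L.
  pose proof (cosh_ge_1 x) as Hc; pose proof (cosh_sqr x) as Hcs.
  pose proof (COS_bound y) as Cb.
  pose proof (softplus_le (PI * sinh x * cos y) (PI * cosh x)) as S.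
  set (a := PI * sinh x * cos y) in *; set (A := cos (PI / 2 * sin y)) in *.
  assert (S' : ln (1 + exp a) * (1 + exp (- a)) <= PI * cosh x).
  { apply S; [nra|].
    rewrite Rpow_mult_distr, Hcs; unfold a; rewrite !Rpow_mult_distr.
    assert (9 <= PI ^ 2) by (simpl; nra).
    assert (cos y ^ 2 <= 1) by (simpl; nra).
    assert (0 <= PI ^ 2 * sinh x ^ 2)
      by (apply Rmult_le_pos; apply pow2_ge_0). nra. }
  pose proof (exp_pos a) as Pa; pose proof (exp_pos (- a)) as Pa'.
  assert (Ea : exp a * exp (- a) = 1)
    by apply exp_mult_opp.
  assert (Eabs : PI * Rabs (sinh x) * cos y = Rabs a).
  { unfold a; rewrite !Rabs_mult, (Rabs_right PI), (Rabs_right (cos y)); lra. }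
  rewrite Eabs, Cexp_opp, Cmod_inv by apply Cexp_neq_0.
  assert (Ei : / ((1 + exp a) * (1 + exp (- a))) <= exp (- Rabs a)).
  { rewrite (exp_Ropp (Rabs a)); apply Rinv_le_contravar; [apply exp_pos|].
    unfold Rabs; destruct Rcase_abs; nra. }
  assert (D1 : 0 < (1 + exp a) * A) by (apply Rmult_lt_0_compat; lra).
  apply Rle_trans with (ln (1 + exp a) / (cos y * A) * / ((1 + exp a) * A)).
  { apply Rmult_le_compat; [apply Cmod_ge_0 | | exact N |].
    - left; apply Rinv_0_lt_compat, Cmod_gt_0, Cexp_neq_0.
    - apply Rinv_le_contravar; auto. }
  replace (ln (1 + exp a) / (cos y * A) * / ((1 + exp a) * A))
    with (ln (1 + exp a) * (1 + exp (- a)) * (/ ((1 + exp a) * (1 + exp (- a))))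
          * / (A ^ 2 * cos y)) by (field; repeat split; lra).
  unfold Rdiv; apply Rmult_le_compat_r.
  { left; apply Rinv_0_lt_compat, Rmult_lt_0_compat; auto; apply pow_lt; auto. }
  apply Rmult_le_compat; auto.
  - apply Rmult_le_pos; [|lra]. rewrite <- ln_1; apply ln_le; lra.
  - left; apply Rinv_0_lt_compat, Rmult_lt_0_compat; lra.
Qed.

(** The bound worsens with [|y|], so [y] is replaced by [d]. It serves twice: with the [d] of the
    strip for the contour, and with [d = 0], where the cosines are 1, for the nodes. *)
Lemma decay_modulus_psi_le (psi : C -> C) (mu d x y : R) :
  is_psi psi -> 0 < mu -> Rabs y <= d -> d < PI / 2 ->
  decay_modulus mu (psi (x, y))
  <= Rpower (PI * cosh x * exp (- (PI * Rabs (sinh x) * cos d))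
             / (cos (PI / 2 * sin d) ^ 2 * cos d)) mu.
Proof.
  intros Hpsi Hmu Hyd Hd; pose proof PI_gt_3.
  assert (Hd0 : 0 <= d) by (pose proof (Rabs_pos y); lra).
  assert (Ed : Rabs d = d) by (apply Rabs_right; lra).
  assert (Hy : Rabs y < PI / 2) by lra.
  pose proof (psi_exp_opp_psi_le psi x y Hpsi Hy) as B.
  unfold decay_modulus.
  assert (Np : psi (x, y) <> 0%C).
  { destruct Hpsi as (_ & Hexp & _); specialize (Hexp (x, y) Hy); intros E.
    rewrite E, Cexp_0 in Hexp; apply (Cexp_neq_0 (RtoC PI * Csinh (x, y))%C).
    transitivity ((1 + Cexp (RtoC PI * Csinh (x, y))) - 1)%C; [ring|].
    rewrite <- Hexp; ring. }
  assert (P1 : 0 < Cmod (psi (x, y))) by (apply Cmod_gt_0, Np).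
  assert (P2 : 0 < Cmod (Cexp (- psi (x, y))%C)) by (apply Cmod_gt_0, Cexp_neq_0).
  rewrite Rpower_mult_distr by auto.
  apply Rle_Rpower_l; [lra|]; split; [apply Rmult_lt_0_compat; auto|].
  eapply Rle_trans; [exact B|].
  assert (Cd : 0 < cos d) by (apply cos_gt_0; lra).
  pose proof (cos_half_PI_sin_pos d ltac:(lra)) as CA.
  pose proof (cos_half_PI_sin_antimono y d ltac:(lra) ltac:(lra)) as C1.
  pose proof (cos_abs_antimono y d ltac:(lra) ltac:(lra)) as C2.
  pose proof (cosh_ge_1 x).
  apply Rmult_le_compat.
  - apply Rmult_le_pos; [nra | left; apply exp_pos].
  - left; apply Rinv_0_lt_compat, Rmult_lt_0_compat; [apply pow_lt|]; lra.
  - apply Rmult_le_compat_l; [nra|].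
    assert (L : - (PI * Rabs (sinh x) * cos y) <= - (PI * Rabs (sinh x) * cos d)).
    { apply Ropp_le_contravar, Rmult_le_compat_l; auto.
      apply Rmult_le_pos; [lra | apply Rabs_pos]. }
    destruct L as [L| ->]; [left; apply exp_increasing, L | lra].
  - apply Rinv_le_contravar; [apply Rmult_lt_0_compat; [apply pow_lt|]; lra|].
    apply Rmult_le_compat; try lra; [apply pow_le; lra | apply pow_incr; lra].
Qed.

(** * Discretization and truncation errors *)

Lemma Rpower_decay (c t q mu : R) : 0 < c -> 0 < q ->
  Rpower (PI * c * exp (- t) / q) mu
  = Rpower PI mu / Rpower q mu * (Rpower c mu * exp (- (mu * t))).
Proof.
  intros Hc Hq; pose proof PI_RGT_0 as HPI; unfold Rpower.
  assert (Hpc : 0 < PI * c) by (apply Rmult_lt_0_compat; auto).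
  pose proof (exp_pos (- t)) as He.
  rewrite ln_div by (auto using Rmult_lt_0_compat).
  rewrite ln_mult, ln_mult, ln_exp by auto.
  replace (mu * (ln PI + ln c + - t - ln q))
    with (mu * ln PI + mu * ln c + - (mu * t) + - (mu * ln q)) by ring.
  rewrite !exp_plus, (exp_Ropp (mu * ln q)); field.
  apply Rgt_not_eq, exp_pos.
Qed.

Lemma Rpower_le_id (c mu : R) : 1 <= c -> mu <= 1 -> Rpower c mu <= c.
Proof.
  intros Hc Hmu; rewrite <- (Rpower_1 c) at 2 by lra.
  apply Rle_Rpower; auto.
Qed.

Lemma is_RInt_cosh_exp_abs_sinh (ka b : R) : 0 < ka -> 0 <= b ->
  is_RInt (fun u => cosh u * exp (- (ka * Rabs (sinh u)))) (- b) b
    (2 * (1 - exp (- (ka * sinh b))) / ka).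
Proof.
  intros Hk Hb.
  pose proof sinh_nonneg as Sg.
  assert (C1 : forall u, continuous (fun u => cosh u * exp (- (ka * sinh u))) u).
  { intros u; apply (@ex_derive_continuous R_AbsRing R_NormedModule).
    unfold sinh, cosh; auto_derive; auto. }
  assert (C2 : forall u, continuous (fun u => cosh u * exp (ka * sinh u)) u).
  { intros u; apply (@ex_derive_continuous R_AbsRing R_NormedModule).
    unfold sinh, cosh; auto_derive; auto. }
  replace (2 * (1 - exp (- (ka * sinh b))) / ka)
    with (plus ((1 - exp (- (ka * sinh b))) / ka) ((1 - exp (- (ka * sinh b))) / ka))
    by (unfold plus; simpl; field; lra).
  apply (@is_RInt_Chasles R_NormedModule _ (- b) 0 b).
  - apply (is_RInt_ext (fun u => cosh u * exp (ka * sinh u))).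
    { intros u Hu; rewrite Rmin_left, Rmax_right in Hu by lra.
      do 2 f_equal; specialize (Sg (- u) ltac:(lra)); rewrite sinh_odd in Sg.
      rewrite Rabs_left1 by lra; ring. }
    replace ((1 - exp (- (ka * sinh b))) / ka)
      with (minus (exp (ka * sinh 0) / ka) (exp (ka * sinh (- b)) / ka)).
    2:{ rewrite sinh_0, sinh_odd, Rmult_0_r, exp_0.
        replace (ka * - sinh b) with (- (ka * sinh b)) by ring.
        unfold minus, plus, opp; simpl; field; lra. }
    apply (@is_RInt_derive R_CompleteNormedModule (fun u => exp (ka * sinh u) / ka)).
    + intros u _; unfold sinh, cosh, Rdiv, Rminus; auto_derive; auto; field; lra.
    + intros u _; apply C2.
  - apply (is_RInt_ext (fun u => cosh u * exp (- (ka * sinh u)))).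
    { intros u Hu; rewrite Rmin_left, Rmax_right in Hu by lra.
      rewrite Rabs_right; auto; apply Rle_ge, Sg; lra. }
    replace ((1 - exp (- (ka * sinh b))) / ka)
      with (minus (- exp (- (ka * sinh b)) / ka) (- exp (- (ka * sinh 0)) / ka)).
    2:{ rewrite sinh_0, Rmult_0_r, Ropp_0, exp_0.
        unfold minus, plus, opp; simpl; field; lra. }
    apply (@is_RInt_derive R_CompleteNormedModule (fun u => - exp (- (ka * sinh u)) / ka)).
    + intros u _; unfold sinh, cosh, Rdiv, Rminus; auto_derive; auto; field; lra.
    + intros u _; apply C1.
Qed.

Lemma sum_n_C_shift (u : nat -> C) (m : nat) :
  sum_n u (S m) = (u 0%nat + sum_n (fun j => u (S j)) m)%C.
Proof.
  induction m as [|m IH].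
  - rewrite sum_Sn, !sum_O; reflexivity.
  - rewrite sum_Sn, IH, (sum_Sn (fun j => u (S j))).
    change plus with Cplus.
    match goal with |- ?u = ?v => change (@eq C u v) end; ring.
Qed.

Lemma sum_sym_S (N : nat) (a : Z -> C) :
  sum_sym (S N) a = (sum_sym N a + (a (Z.of_nat (S N)) + a (- Z.of_nat (S N))%Z))%C.
Proof.
  unfold sum_sym; replace (2 * S N)%nat with (S (S (2 * N))) by lia.
  rewrite sum_Sn, sum_n_C_shift; change plus with Cplus.
  rewrite (sum_n_ext (fun j => a (Z.of_nat (S j) - Z.of_nat (S N))%Z)
                     (fun j => a (Z.of_nat j - Z.of_nat N)%Z))
    by (intros j; f_equal; lia).
  replace (Z.of_nat 0 - Z.of_nat (S N))%Z with (- Z.of_nat (S N))%Z by lia.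
  replace (Z.of_nat (S (S (2 * N))) - Z.of_nat (S N))%Z with (Z.of_nat (S N)) by lia.
  ring.
Qed.

Lemma sum_sym_tail_le (a : Z -> C) (e : nat -> R) (n N : nat) : (n <= N)%nat ->
  (forall m, (n <= m)%nat ->
     Cmod (a (Z.of_nat (S m)) + a (- Z.of_nat (S m))%Z)%C <= e m - e (S m)) ->
  Cmod (sum_sym N a - sum_sym n a)%C <= e n - e N.
Proof.
  intros HN H; induction HN as [|N HN IH].
  - replace (sum_sym n a - sum_sym n a)%C with (RtoC 0) by ring.
    rewrite Cmod_0; lra.
  - rewrite sum_sym_S; specialize (H N HN).
    set (t := (a (Z.of_nat (S N)) + a (- Z.of_nat (S N))%Z)%C) in *.
    replace (sum_sym N a + t - sum_sym n a)%C with ((sum_sym N a - sum_sym n a) + t)%C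
      by ring.
    eapply Rle_trans; [apply Cmod_triangle|]; lra.
Qed.

Lemma Rabs_sin_div_le (t : R) : t <> 0 -> Rabs (sin t / t) <= 1.
Proof.
  intros Ht; assert (P : 0 < Rabs t) by (apply Rabs_pos_lt; auto).
  unfold Rdiv; rewrite Rabs_mult, Rabs_inv.
  apply (Rmult_le_reg_r (Rabs t)); auto.
  rewrite Rmult_assoc, Rinv_l, Rmult_1_r, Rmult_1_l by lra.
  assert (H : forall s, 0 <= s -> Rabs (sin s) <= s).
  { intros s Hs; pose proof (sin_cubic_pos s Hs); apply Rabs_le; split; [|lra].
    assert (0 - sin 0 <= - s + 2 * s + sin s); [|rewrite sin_0 in *; lra].
    replace (- s + 2 * s + sin s) with (s + sin s) by ring.
    enough (0 + sin 0 <= s + sin s) by (rewrite sin_0 in *; lra).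
    apply (le_of_derive_nonneg (fun t => t + sin t) (fun t => 1 + cos t)); auto.
    - intros r _; auto_derive; auto; ring.
    - intros r _; pose proof (COS_bound r); lra. }
  destruct (Rle_dec 0 t) as [L|L].
  - rewrite (Rabs_right t) by lra; auto.
  - rewrite (Rabs_left t), <- Rabs_Ropp, <- sin_neg by lra; apply H; lra.
Qed.

Lemma sinc_basis_abs_le (k : Z) (h x : R) : 0 < h -> Rabs (sinc_basis k h x) <= 1.
Proof.
  intros Hh; unfold sinc_basis; destruct Req_EM_T as [E|N].
  - rewrite Rabs_R1; lra.
  - apply Rabs_sin_div_le, Rmult_integral_contrapositive_currified.
    + apply Rgt_not_eq, PI_RGT_0.
    + intros E; apply N; apply (Rmult_eq_reg_r (/ h)).
      * rewrite Rmult_assoc, Rinv_r, Rmult_1_r by lra. unfold Rdiv in E; lra.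
      * apply Rinv_neq_0_compat; lra.
Qed.

(** The sign of the derivative is that of [sinh r - PI cosh r ^ 2], and [PI (1 + s^2) > s]. *)
Lemma cosh_exp_sinh_antimono (s t : R) : 0 <= s <= t ->
  cosh t * exp (- (PI * sinh t)) <= cosh s * exp (- (PI * sinh s)).
Proof.
  intros Hst; pose proof PI_gt_3.
  enough (- (cosh s * exp (- (PI * sinh s))) <= - (cosh t * exp (- (PI * sinh t)))) by lra.
  apply (le_of_derive_nonneg (fun r => - (cosh r * exp (- (PI * sinh r))))
    (fun r => exp (- (PI * sinh r)) * (PI * cosh r ^ 2 - sinh r))); [lra | |].
  - intros r _; unfold sinh, cosh, Rdiv, Rminus; auto_derive; auto; field.
  - intros r Hr; apply Rmult_le_pos; [left; apply exp_pos|].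
    rewrite cosh_sqr; pose proof (pow2_ge_0 (sinh r - 1)).
    pose proof (pow2_ge_0 (sinh r)). simpl in *; nra.
Qed.

Lemma cosh_mono (s t : R) : 0 <= s <= t -> cosh s <= cosh t.
Proof.
  intros Hst; apply (le_of_derive_nonneg cosh sinh); [lra | |].
  - intros r _; unfold sinh, cosh, Rdiv, Rminus; auto_derive; auto; field.
  - intros r Hr; apply sinh_nonneg; lra.
Qed.

(* [cosh t ^ mu * exp (- PI mu sinh t)] is decreasing, and on [t >= t0] it is at
   most [cosh t0 ^ (mu - 1)] times the derivative of
   [- exp (- PI mu sinh t) / (PI mu)]. *)
Lemma tail_term_le (mu t0 s h : R) : 0 < mu <= 1 -> 0 <= t0 <= s -> 0 < h ->
  Rpower (cosh (s + h)) mu * exp (- (mu * (PI * sinh (s + h)))) * h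
  <= Rpower (cosh t0) (mu - 1) / (PI * mu)
     * (exp (- (mu * (PI * sinh s))) - exp (- (mu * (PI * sinh (s + h))))).
Proof.
  intros Hmu Ht Hh; pose proof PI_gt_3.
  set (c0 := Rpower (cosh t0) (mu - 1)).
  assert (Hc0 : 0 < c0) by apply exp_pos.
  set (ga := fun t => Rpower (cosh t) mu * exp (- (mu * (PI * sinh t)))).
  assert (Ga : forall t, ga t = Rpower (cosh t * exp (- (PI * sinh t))) mu).
  { intros t; unfold ga; rewrite <- Rpower_mult_distr.
    - f_equal; unfold Rpower; rewrite ln_exp; f_equal; ring.
    - pose proof (cosh_ge_1 t); lra.
    - apply exp_pos. }
  change (ga (s + h) * h <= c0 / (PI * mu)
     * (exp (- (mu * (PI * sinh s))) - exp (- (mu * (PI * sinh (s + h)))))).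
  enough (- (c0 / (PI * mu) * exp (- (mu * (PI * sinh s)))) - ga (s + h) * s
          <= - (c0 / (PI * mu) * exp (- (mu * (PI * sinh (s + h))))) - ga (s + h) * (s + h))
    by lra.
  apply (le_of_derive_nonneg
    (fun t => - (c0 / (PI * mu) * exp (- (mu * (PI * sinh t)))) - ga (s + h) * t)
    (fun t => c0 * cosh t * exp (- (mu * (PI * sinh t))) - ga (s + h))); [lra | |].
  - intros r _; unfold sinh, cosh, Rdiv, Rminus; auto_derive; auto; field; lra.
  - intros r Hr; pose proof (cosh_ge_1 r) as Hcr; pose proof (cosh_ge_1 t0) as Hct.
    assert (M1 : ga (s + h) <= ga r).
    { rewrite !Ga; apply Rle_Rpower_l; [lra|]; split.
      - apply Rmult_lt_0_compat; [|apply exp_pos].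
        pose proof (cosh_ge_1 (s + h)); lra.
      - apply cosh_exp_sinh_antimono; lra. }
    assert (M2 : Rpower (cosh r) mu <= c0 * cosh r).
    { replace mu with ((mu - 1) + 1) at 1 by ring.
      rewrite Rpower_plus, Rpower_1 by lra.
      apply Rmult_le_compat_r; [lra|]; unfold c0.
      replace (mu - 1) with (- (1 - mu)) by ring; rewrite !Rpower_Ropp.
      apply Rinv_le_contravar; [apply exp_pos|].
      apply Rle_Rpower_l; [lra|]; split; [lra | apply cosh_mono; lra]. }
    unfold ga in M1 at 2.
    pose proof (exp_pos (- (mu * (PI * sinh r)))); nra.
Qed.

Lemma le_of_left_limit (f : R -> R) (d c : R) : 0 < d -> continuity_pt f d ->
  (forall D, 0 < D < d -> f D <= c) -> f d <= c.
Proof.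
  intros Hd Hf H; apply Rnot_lt_le; intros Hlt.
  destruct (Hf (f d - c)) as [a [Ha Hx]]; [lra|].
  set (D := Rmax (d / 2) (d - a / 2)).
  assert (HD : d / 2 <= D /\ d - a / 2 <= D) by (split; [apply Rmax_l | apply Rmax_r]).
  assert (HDd : D < d) by (unfold D; apply Rmax_lub_lt; lra).
  specialize (H D ltac:(lra)); specialize (Hx D); simpl in Hx.
  unfold Rdist, D_x, no_cond in Hx.
  assert (K : Rabs (f D - f d) < f d - c).
  { apply Hx; split; [split; [trivial | lra]|]. rewrite Rabs_left; lra. }
  apply Rabs_def2 in K; lra.
Qed.

(** The contour controls the error of [S N] for large [N], while [T] controls [S N - S n] uniformly
    in [N]. The contour height [D] stays below [d], because [F] is given on the open strip, and
    tends to [d] only in the final inequality. *)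
Lemma sinc_error_off_grid (F : C -> C) (d h M ka T x : R) (n : nat) :
  0 < d -> 0 < h -> 0 <= M -> 0 < ka -> (forall k, x <> IZR k * h) ->
  analytic_on (strip d) F ->
  (forall u v, Rabs v < d -> Cmod (F (u, v)) <= M * (cosh u * exp (- (ka * Rabs (sinh u))))) ->
  let S := fun N => sum_sym N (fun k => F (RtoC (IZR k * h)) * RtoC (sinc_basis k h x))%C in
  (forall N, (n <= N)%nat -> Cmod (S N - S n)%C <= T) ->
  Cmod (F (RtoC x) - S n)%C <= T + 2 * M / ka / (PI * d * sinh (PI * d / h)).
Proof.
  intros Hd Hh HM Hk Hx HF HB S HT; pose proof PI_RGT_0 as HPI.
  set (err := Cmod (F (RtoC x) - S n)%C).
  assert (HS : forall D, 0 < D -> 0 < sinh (PI * D / h)).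
  { intros D HD; apply sinh_pos, Rdiv_lt_0_compat; auto; apply Rmult_lt_0_compat; auto. }
  assert (Step : forall D, 0 < D < d ->
            2 * PI * (err - T) <= 2 * (2 * M / ka) / (D * sinh (PI * D / h))).
  { intros D HD; apply le_epsilon; intros eps He.
    assert (HDS : 0 < D * sinh (PI * D / h)) by (apply Rmult_lt_0_compat; [|apply HS]; lra).
    (* Makes the vertical sides, at most [4 D V] once [b >= |x| + 1], smaller than [eps]; the [+ 1]
       covers [M = 0]. *)
    destruct (cosh_exp_sinh_decay ka (eps / (4 * D * M + 1))) as (X0 & HX0 & B0); auto.
    { apply Rdiv_lt_0_compat; auto. assert (0 <= 4 * D * M) by (apply Rmult_le_pos; lra). lra. }
    destruct (nfloor_ex (Rmax 0 ((Rmax X0 (Rabs x + 1)) / h))) as [m [_ Hm]]; [apply Rmax_l|].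
    set (N := Nat.max n (m + 1)).
    assert (HmN : INR m + 1 <= INR N).
    { change 1 with (INR 1); rewrite <- plus_INR; apply le_INR; unfold N; lia. }
    set (b := (INR N + / 2) * h).
    assert (Hb : Rmax X0 (Rabs x + 1) <= b).
    { assert (L : Rmax X0 (Rabs x + 1) / h <= INR N + / 2).
      { pose proof (Rmax_r 0 (Rmax X0 (Rabs x + 1) / h)); lra. }
      apply (Rmult_le_compat_r h) in L; [|lra].
      unfold Rdiv in L; rewrite Rmult_assoc, Rinv_l, Rmult_1_r in L by lra. exact L. }
    assert (HbX : X0 <= b) by (eapply Rle_trans; [apply Rmax_l | exact Hb]).
    assert (Hbx : Rabs x + 1 <= b) by (eapply Rle_trans; [apply Rmax_r | exact Hb]).
    pose proof (Rabs_pos x) as Hx0.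
    set (phi := fun u => M * (cosh u * exp (- (ka * Rabs (sinh u))))).
    pose proof (is_RInt_cosh_exp_abs_sinh ka b Hk ltac:(lra)) as I0.
    assert (Iphi : is_RInt phi (- b) b (M * (2 * (1 - exp (- (ka * sinh b))) / ka)))
      by (apply (@is_RInt_scal R_NormedModule); exact I0).
    set (V := M * (cosh b * exp (- (ka * sinh b)))).
    assert (HV : forall u v, u = b \/ u = - b -> - D <= v <= D -> Cmod (F (u, v)) <= V).
    { intros u v Hu Hv; eapply Rle_trans; [apply HB, Rabs_def1; lra|].
      unfold V; right.
      assert (Sb : 0 < sinh b) by (apply sinh_pos; lra).
      destruct Hu as [->| ->]; [|rewrite cosh_even, sinh_odd, Rabs_Ropp];
        rewrite Rabs_right; auto; lra. }
    pose proof (sinc_symmetric_error_le F phi h x D V N Hh ltac:(lra) Hx) as E.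
    fold b in E; specialize (E ltac:(lra)).
    assert (E' : 2 * PI * Cmod (F (RtoC x) - S N)%C
      <= 2 * RInt phi (- b) b / (D * sinh (PI * D / h)) + 4 * D * V / (b - Rabs x)).
    { apply E.
      - intros u v _ Hv; apply ex_derive_cderiv, HF; unfold strip; simpl.
        apply Rabs_def1; lra.
      - eexists; exact Iphi.
      - intros u _; apply HB, Rabs_def1; lra.
      - intros u _; apply HB, Rabs_def1; lra.
      - intros v Hv; apply HV; auto.
      - intros v Hv; apply HV; auto. }
    rewrite (is_RInt_unique _ _ _ _ Iphi) in E'.
    specialize (HT N ltac:(unfold N; lia)).
    assert (Tri : err <= Cmod (F (RtoC x) - S N)%C + T).
    { pose proof (Cmod_triangle (F (RtoC x) - S N)%C (S N - S n)%C) as T1.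
      replace (F (RtoC x) - S N + (S N - S n))%C with (F (RtoC x) - S n)%C in T1 by ring.
      fold err in T1; lra. }
    assert (B1 : M * (2 * (1 - exp (- (ka * sinh b))) / ka) <= 2 * M / ka).
    { replace (2 * M / ka) with (M * (2 * 1 / ka)) by (field; lra).
      apply Rmult_le_compat_l; auto; apply Rmult_le_compat_r.
      - left; apply Rinv_0_lt_compat; auto.
      - pose proof (exp_pos (- (ka * sinh b))); lra. }
    assert (B2 : 2 * (M * (2 * (1 - exp (- (ka * sinh b))) / ka)) / (D * sinh (PI * D / h))
                 <= 2 * (2 * M / ka) / (D * sinh (PI * D / h))).
    { apply Rmult_le_compat_r; [left; apply Rinv_0_lt_compat; auto | lra]. }
    assert (HV0 : 0 <= V).
    { apply Rmult_le_pos; auto; pose proof (cosh_ge_1 b).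
      apply Rmult_le_pos; [lra | left; apply exp_pos]. }
    assert (B3 : 4 * D * V / (b - Rabs x) <= 4 * D * V).
    { rewrite <- (Rmult_1_r (4 * D * V)) at 2; apply Rmult_le_compat_l.
      - apply Rmult_le_pos; lra.
      - rewrite <- Rinv_1; apply Rinv_le_contravar; lra. }
    assert (B4 : 4 * D * V <= eps).
    { unfold V; assert (P : 0 <= 4 * D * M) by (apply Rmult_le_pos; lra).
      replace (4 * D * (M * (cosh b * exp (- (ka * sinh b)))))
        with (4 * D * M * (cosh b * exp (- (ka * sinh b)))) by ring.
      apply Rle_trans with ((4 * D * M + 1) * (eps / (4 * D * M + 1))).
      - apply Rmult_le_compat; try lra; [|apply B0, HbX].
        pose proof (cosh_ge_1 b); apply Rmult_le_pos; [lra | left; apply exp_pos].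
      - right; field; lra. }
    assert (2 * PI * (err - T) <= 2 * PI * Cmod (F (RtoC x) - S N)%C)
      by (apply Rmult_le_compat_l; lra).
    lra. }
  assert (Lim : 2 * PI * (err - T) * (d * sinh (PI * d / h)) <= 2 * (2 * M / ka)).
  { apply (le_of_left_limit (fun D => 2 * PI * (err - T) * (D * sinh (PI * D / h))) d); auto.
    - apply derivable_continuous_pt, ex_derive_Reals_0; unfold sinh; auto_derive; auto.
    - intros D HD; specialize (Step D HD).
      assert (HDS : 0 < D * sinh (PI * D / h)) by (apply Rmult_lt_0_compat; [|apply HS]; lra).
      apply (Rmult_le_compat_r (D * sinh (PI * D / h))) in Step; [|lra].
      unfold Rdiv at 2 in Step; rewrite (Rmult_assoc (2 * (2 * M / ka))), Rinv_l, Rmult_1_r in Step by lra.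
      exact Step. }
  assert (HdS : 0 < d * sinh (PI * d / h)) by (apply Rmult_lt_0_compat; auto).
  enough (err - T <= 2 * M / ka / (PI * d * sinh (PI * d / h))) by lra.
  apply (Rmult_le_reg_r (2 * PI * (d * sinh (PI * d / h)))).
  - apply Rmult_lt_0_compat; lra.
  - replace (2 * M / ka / (PI * d * sinh (PI * d / h)) * (2 * PI * (d * sinh (PI * d / h))))
      with (2 * (2 * M / ka)).
    + lra.
    + field; repeat split; try lra. apply Rgt_not_eq, HS, Hd.
Qed.

(** * Comparison with the constants of the theorem *)

Lemma mesh_parameter_ge (d mu n : R) : 0 < d -> 0 < mu -> mu * exp 1 / (2 * d) <= n ->
  exp 1 <= 2 * d * n / mu /\ 1 <= ln (2 * d * n / mu).
Proof.
  intros Hd Hmu Hn.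
  assert (HX : exp 1 <= 2 * d * n / mu).
  { apply (Rmult_le_reg_r (mu / (2 * d))); [apply Rdiv_lt_0_compat; lra|].
    replace (2 * d * n / mu * (mu / (2 * d))) with n by (field; lra).
    eapply Rle_trans; [|exact Hn]; right; field; lra. }
  split; [exact HX|].
  rewrite <- (ln_exp 1) at 1; apply ln_le; [apply exp_pos | exact HX].
Qed.

(* With [X = 2 d n / mu], [n h = ln X]; the claim reduces to
   [L - 1 + PI / (2 X) - PI / 2 <= PI X / 2 * (1 - 1 / L)] for [L = ln X >= 1]. *)
Lemma truncation_const_le (d mu n : R) : 0 < d -> 0 < mu <= 1 -> 0 < n ->
  mu * exp 1 / (2 * d) <= n ->
  let L := ln (2 * d * n / mu) in
  2 * d * (Rpower (cosh L) (mu - 1) * exp (- (mu * (PI * sinh L)))) / (L / n)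
  <= mu * Rpower 2 (1 - mu) * exp (mu * (PI + 2) / 2) * exp (- (PI * d * n / L)).
Proof.
  intros Hd Hmu Hn Hexp L; pose proof PI_gt_3.
  destruct (mesh_parameter_ge d mu n Hd (proj1 Hmu) Hexp) as [HX HL].
  fold L in HL; set (X := 2 * d * n / mu) in *.
  assert (HX0 : 0 < X) by (pose proof (exp_pos 1); lra).
  assert (HX1 : 1 <= X) by (pose proof (exp_ineq1_le 1); lra).
  assert (EL : exp L = X) by (apply exp_ln; auto).
  assert (ELn : exp (- L) = / X) by (rewrite exp_Ropp, EL; auto).
  assert (HXL : 1 + L <= X) by (rewrite <- EL; apply exp_ineq1_le).
  assert (Es : sinh L = (X - / X) / 2) by (unfold sinh; rewrite EL, ELn; auto).
  assert (PiX : 0 < / X) by (apply Rinv_0_lt_compat; auto).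
  assert (PiX1 : / X <= 1) by (rewrite <- Rinv_1; apply Rinv_le_contravar; lra).
  assert (PiL : 0 < / L) by (apply Rinv_0_lt_compat; lra).
  assert (PiL1 : / L <= 1) by (rewrite <- Rinv_1; apply Rinv_le_contravar; lra).
  assert (Ec : X / 2 <= cosh L) by (unfold cosh; rewrite EL, ELn; lra).
  (* As [mu - 1 <= 0], the lower bound [cosh L >= X / 2] becomes an upper bound; this is the origin
     of [2 ^ (1 - mu)]. *)
  assert (H1 : Rpower (cosh L) (mu - 1) <= Rpower 2 (1 - mu) * exp ((mu - 1) * L)).
  { replace (Rpower 2 (1 - mu) * exp ((mu - 1) * L)) with (Rpower (X / 2) (mu - 1)).
    - replace (mu - 1) with (- (1 - mu)) by ring; rewrite !Rpower_Ropp.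
      apply Rinv_le_contravar; [apply exp_pos|].
      apply Rle_Rpower_l; lra.
    - unfold Rpower; rewrite ln_div, <- exp_plus by lra.
      f_equal; unfold L; ring. }
  rewrite Es.
  replace (2 * d * (Rpower (cosh L) (mu - 1) * exp (- (mu * (PI * ((X - / X) / 2))))) / (L / n))
    with (mu * (Rpower (cosh L) (mu - 1) * (X * / L) * exp (- (mu * (PI * ((X - / X) / 2))))))
    by (unfold X; field; repeat split; lra).
  rewrite (Rmult_assoc (mu * Rpower 2 (1 - mu))), (Rmult_assoc mu (Rpower 2 (1 - mu))).
  apply Rmult_le_compat_l; [lra|].
  apply Rle_trans with (Rpower 2 (1 - mu) * exp ((mu - 1) * L) * X
                        * exp (- (mu * (PI * ((X - / X) / 2))))).
  { apply Rmult_le_compat_r; [left; apply exp_pos|].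
    apply Rmult_le_compat; [left; apply exp_pos | | exact H1 |].
    - apply Rmult_le_pos; lra.
    - nra. }
  rewrite <- EL at 1.
  replace (Rpower 2 (1 - mu) * exp ((mu - 1) * L) * exp L * exp (- (mu * (PI * ((X - / X) / 2)))))
    with (Rpower 2 (1 - mu) * (exp ((mu - 1) * L) * (exp L * exp (- (mu * (PI * ((X - / X) / 2)))))))
    by ring.
  apply Rmult_le_compat_l; [left; apply exp_pos|].
  rewrite <- !exp_plus.
  assert (Ed : PI * d * n / L = mu * (PI * X / 2 * / L)) by (unfold X; field; lra).
  rewrite Ed.
  (* Since [/ X <= 1], the left side is at most [L - 1 = L (1 - 1 / L)], and [L <= X <= PI X / 2].
     Multiplied by [mu], this is the comparison of exponents [Fin]; the constants moved across form
     [exp (mu (PI + 2) / 2)]. *)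
  assert (Key : L - 1 + PI / 2 * / X - PI / 2 <= PI * X / 2 * (1 - / L)).
  { assert (K1 : PI / 2 * / X <= PI / 2) by nra.
    assert (K2 : L - 1 = L * (1 - / L)) by (field; lra).
    assert (K3 : L * (1 - / L) <= PI * X / 2 * (1 - / L))
      by (apply Rmult_le_compat_r; nra).
    lra. }
  assert (Fin : (mu - 1) * L + (L + - (mu * (PI * ((X - / X) / 2))))
                <= mu * (PI + 2) / 2 + - (mu * (PI * X / 2 * / L))) by nra.
  destruct Fin as [Fin| ->]; [left; apply exp_increasing, Fin | lra].
Qed.

(** With [y = PI d / h], [1 / sinh y = 2 exp (- y) / (1 - exp (- 2 y))]. Here [2 y = PI mu X / L],
    and [X = exp L >= e L] gives [2 y >= PI mu e], whence the factor [1 - exp (- PI mu e)]. *)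
Lemma contour_const_le (d mu n : R) : 0 < d < PI / 2 -> 0 < mu <= 1 -> 0 < n ->
  mu * exp 1 / (2 * d) <= n ->
  let L := ln (2 * d * n / mu) in
  2 / Rpower (cos (PI / 2 * sin d) ^ 2 * cos d) mu / (cos d * sinh (PI * d / (L / n)))
  <= 4 / ((1 - exp (- (PI * mu * exp 1)))
          * Rpower (cos (PI / 2 * sin d)) (2 * mu) * Rpower (cos d) (mu + 1))
     * exp (- (PI * d * n / L)).
Proof.
  intros Hd Hmu Hn Hexp L; pose proof PI_gt_3.
  destruct (mesh_parameter_ge d mu n (proj1 Hd) (proj1 Hmu) Hexp) as [HX HL].
  fold L in HL; set (X := 2 * d * n / mu) in *.
  assert (EL : exp L = X) by (apply exp_ln; pose proof (exp_pos 1); lra).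
  assert (HXL : exp 1 <= X / L).
  { apply (Rmult_le_reg_r L); [lra|].
    unfold Rdiv; rewrite Rmult_assoc, Rinv_l, Rmult_1_r, <- EL by lra.
    replace L with (1 + (L - 1)) at 2 by ring; rewrite exp_plus.
    apply Rmult_le_compat_l; [left; apply exp_pos|].
    pose proof (exp_ineq1_le (L - 1)); lra. }
  set (y := PI * d * n / L).
  replace (PI * d / (L / n)) with y by (unfold y; field; lra).
  set (w := PI * mu * exp 1).
  assert (Hy : w <= 2 * y).
  { replace (2 * y) with (PI * mu * (X / L)) by (unfold y, X; field; lra).
    unfold w; apply Rmult_le_compat_l; [apply Rmult_le_pos; lra | exact HXL]. }
  assert (Hw : 0 < w)
    by (unfold w; apply Rmult_lt_0_compat; [apply Rmult_lt_0_compat; lra | apply exp_pos]).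
  assert (H1 : exp (- w) < 1) by (rewrite <- exp_0; apply exp_increasing; lra).
  assert (Cd : 0 < cos d) by (apply cos_gt_0; lra).
  assert (CA : 0 < cos (PI / 2 * sin d))
    by (apply cos_half_PI_sin_pos; rewrite Rabs_right; lra).
  set (A := cos (PI / 2 * sin d)) in *.
  assert (EQ : Rpower (A ^ 2 * cos d) mu = Rpower A (2 * mu) * Rpower (cos d) mu).
  { rewrite <- Rpower_mult_distr by (auto; apply pow_lt; auto).
    rewrite <- (Rpower_pow 2 A), Rpower_mult by auto; reflexivity. }
  rewrite EQ, Rpower_plus, Rpower_1 by auto.
  assert (P1 : 0 < Rpower A (2 * mu)) by apply exp_pos.
  assert (P2 : 0 < Rpower (cos d) mu) by apply exp_pos.
  assert (Sy : (1 - exp (- w)) / 2 <= exp (- y) * sinh y).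
  { unfold sinh.
    replace (exp (- y) * ((exp y - exp (- y)) / 2))
      with ((exp (- y + y) - exp (- y + - y)) / 2) by (rewrite !exp_plus; field).
    replace (- y + y) with 0 by ring; replace (- y + - y) with (- (2 * y)) by ring.
    rewrite exp_0.
    assert (exp (- (2 * y)) <= exp (- w)); [|lra].
    destruct Hy as [Hy| <-]; [left; apply exp_increasing; lra | lra]. }
  pose proof (exp_pos (- y)) as Py.
  assert (Psy : 0 < sinh y).
  { apply (Rmult_lt_reg_l (exp (- y))); auto; lra. }
  apply (Rmult_le_reg_r (Rpower A (2 * mu) * Rpower (cos d) mu * cos d * sinh y
                         * (1 - exp (- w)))).
  { apply Rmult_lt_0_compat; [|lra]; auto using Rmult_lt_0_compat. }
  replace (2 / (Rpower A (2 * mu) * Rpower (cos d) mu) / (cos d * sinh y)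
           * (Rpower A (2 * mu) * Rpower (cos d) mu * cos d * sinh y * (1 - exp (- w))))
    with (2 * (1 - exp (- w))) by (field; repeat split; lra).
  replace (4 / ((1 - exp (- w)) * Rpower A (2 * mu) * (Rpower (cos d) mu * cos d)) * exp (- y)
           * (Rpower A (2 * mu) * Rpower (cos d) mu * cos d * sinh y * (1 - exp (- w))))
    with (4 * (exp (- y) * sinh y)) by (field; repeat split; lra).
  lra.
Qed.

(** * Nodes of the grid, and the conclusion *)

Lemma sum_sym_ext (N : nat) (a b : Z -> C) :
  (forall k, a k = b k) -> sum_sym N a = sum_sym N b.
Proof. intros H; apply sum_n_ext; intros j; apply H. Qed.

Lemma sum_sym_single (N : nat) (a : Z -> C) (j : Z) :
  (forall k, k <> j -> a k = 0%C) -> (Z.abs j <= Z.of_nat N)%Z ->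
  sum_sym N a = a j.
Proof.
  intros H Hj.
  assert (G : forall m, sum_sym m a = if Z_le_dec (Z.abs j) (Z.of_nat m) then a j else 0%C).
  { induction m as [|m IH].
    - unfold sum_sym; rewrite sum_O; simpl (Z.of_nat 0 - Z.of_nat 0)%Z.
      destruct Z_le_dec; [replace j with 0%Z by lia; reflexivity | apply H; lia].
    - rewrite sum_sym_S, IH.
      destruct (Z_le_dec (Z.abs j) (Z.of_nat m)), (Z_le_dec (Z.abs j) (Z.of_nat (S m)));
        try lia.
      + rewrite (H (Z.of_nat (S m))), (H (- Z.of_nat (S m))%Z) by lia; ring.
      + destruct (Z.eq_dec j (Z.of_nat (S m))) as [->|N1].
        * rewrite (H (- Z.of_nat (S m))%Z) by lia; ring.
        * replace (- Z.of_nat (S m))%Z with j by lia.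
          rewrite (H (Z.of_nat (S m))) by lia; ring.
      + rewrite (H (Z.of_nat (S m))), (H (- Z.of_nat (S m))%Z) by lia; ring. }
  rewrite G; destruct Z_le_dec; [reflexivity | lia].
Qed.

Lemma sinc_basis_grid (k j : Z) (h : R) : 0 < h -> k <> j ->
  sinc_basis k h (IZR j * h) = 0.
Proof.
  intros Hh N; unfold sinc_basis; destruct Req_EM_T as [E|_].
  - apply Rmult_eq_reg_r, eq_IZR in E; [congruence | lra].
  - replace (PI * (IZR j * h / h - IZR k)) with (IZR (j - k) * PI)
      by (rewrite minus_IZR; field; lra).
    rewrite sin_IZR_PI; unfold Rdiv; ring.
Qed.

Lemma sinc_basis_node (j : Z) (h : R) : sinc_basis j h (IZR j * h) = 1.
Proof. unfold sinc_basis; destruct Req_EM_T; congruence. Qed.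

Theorem theorem2p9 :
  forall (psi : C -> C) (psi_inv : R -> R),
    is_psi psi -> is_psi_inv psi psi_inv ->
  forall (d : R), 0 < d < PI / 2 ->
  forall (F : C -> C) (K mu : R),
    analytic_on (strip d) F ->
    0 < K -> 0 < mu <= 1 ->
    (forall z : C, strip d z -> Cmod (F z) <= K * decay_modulus mu (psi z)) ->
  forall n : nat, (0 < n)%nat -> INR n >= mu * exp 1 / (2 * d) ->
    Rbar_le
      (sup_half_line
         (sinc_error psi psi_inv (on_half_line psi_inv F) (step d mu n) n))
      (Finite (err_const K d mu
               * exp (- (PI * d * INR n / ln (2 * d * INR n / mu))))).
Proof.
  intros psi psi_inv Hpsi [Hinv _] d Hd F K mu HF HK Hmu HB n Hn Hnd.
  pose proof PI_gt_3 as HPI; apply Rge_le in Hnd.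
  assert (Hn0 : 0 < INR n) by (apply lt_0_INR; auto).
  pose proof (truncation_const_le d mu (INR n) (proj1 Hd) Hmu Hn0 Hnd) as TC.
  pose proof (contour_const_le d mu (INR n) Hd Hmu Hn0 Hnd) as CC.
  unfold step; cbv zeta in TC, CC.
  destruct (mesh_parameter_ge d mu (INR n) (proj1 Hd) (proj1 Hmu) Hnd) as [_ HL].
  set (L := ln (2 * d * INR n / mu)) in *; set (h := L / INR n) in *.
  assert (Hh : 0 < h) by (apply Rdiv_lt_0_compat; lra).
  assert (Hnh : INR n * h = L) by (unfold h; field; lra).
  assert (Cd : 0 < cos d) by (apply cos_gt_0; lra).
  assert (CA : 0 < cos (PI / 2 * sin d))
    by (apply cos_half_PI_sin_pos; rewrite Rabs_right; lra).
  set (Q := cos (PI / 2 * sin d) ^ 2 * cos d) in *.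
  assert (HQ : 0 < Q) by (apply Rmult_lt_0_compat; [apply pow_lt|]; auto).
  set (P := Rpower PI mu); assert (HP : 0 < P) by apply exp_pos.
  assert (HQm : 0 < Rpower Q mu) by apply exp_pos.
  set (M := K * P / Rpower Q mu).
  assert (HM : 0 < M) by (apply Rdiv_lt_0_compat; auto; apply Rmult_lt_0_compat; auto).
  (* On the strip [cosh u ^ mu] is raised to [cosh u], so that the bound can be integrated in closed
     form. *)
  assert (Bstrip : forall u v, Rabs v < d ->
            Cmod (F (u, v)) <= M * (cosh u * exp (- (mu * PI * cos d * Rabs (sinh u))))).
  { intros u v Hv; eapply Rle_trans; [apply HB; exact Hv|].
    eapply Rle_trans.
    { apply Rmult_le_compat_l; [lra|].
      apply (decay_modulus_psi_le psi mu d u v Hpsi); lra. }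
    fold Q; pose proof (cosh_ge_1 u) as Hc.
    rewrite Rpower_decay by (auto; lra); fold P.
    replace (mu * (PI * Rabs (sinh u) * cos d)) with (mu * PI * cos d * Rabs (sinh u)) by ring.
    replace (M * (cosh u * exp (- (mu * PI * cos d * Rabs (sinh u)))))
      with (K * (P / Rpower Q mu * (cosh u * exp (- (mu * PI * cos d * Rabs (sinh u))))))
      by (unfold M; field; lra).
    apply Rmult_le_compat_l; [lra|]; apply Rmult_le_compat_l.
    { left; apply Rdiv_lt_0_compat; auto. }
    apply Rmult_le_compat_r; [left; apply exp_pos | apply Rpower_le_id; lra]. }
  (* On the axis the power [mu] is kept: the tail estimate turns it into the factor
     [cosh L ^ (mu - 1)]. *)
  assert (Breal : forall u, Cmod (F (RtoC u))
            <= K * P * (Rpower (cosh u) mu * exp (- (mu * (PI * Rabs (sinh u)))))).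
  { intros u; eapply Rle_trans.
    { apply HB; unfold strip; simpl; rewrite Rabs_R0; lra. }
    rewrite Rmult_assoc; apply Rmult_le_compat_l; [lra|].
    eapply Rle_trans.
    { apply (decay_modulus_psi_le psi mu 0 u 0 Hpsi); try lra. rewrite Rabs_R0; lra. }
    pose proof (cosh_ge_1 u).
    rewrite sin_0, Rmult_0_r, cos_0, pow1, !Rmult_1_r, Rpower_decay by lra; fold P.
    right; unfold Rpower at 1; rewrite ln_1, Rmult_0_r, exp_0; field. }
  (* The telescoping sequence [e] at [m = n], because [n h = L]; the 2 accounts for the pair [k],
     [- k]. *)
  set (T := K * P / (PI * mu) * (2 * (Rpower (cosh L) (mu - 1)
              * exp (- (mu * (PI * sinh L)))) / h)).
  set (e := fun m : nat => K * P / (PI * mu) * (2 * (Rpower (cosh L) (mu - 1)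
              * exp (- (mu * (PI * sinh (INR m * h))))) / h)).
  assert (Tail : forall x N, (n <= N)%nat ->
    Cmod (sum_sym N (fun k => F (RtoC (IZR k * h)) * RtoC (sinc_basis k h x))
          - sum_sym n (fun k => F (RtoC (IZR k * h)) * RtoC (sinc_basis k h x)))%C <= T).
  { intros x N HN; apply Rle_trans with (e n - e N).
    - apply sum_sym_tail_le; auto; intros m Hm.
      assert (Hmh : L <= INR m * h)
        by (rewrite <- Hnh; apply Rmult_le_compat_r; [lra | apply le_INR, Hm]).
      pose proof (tail_term_le mu L (INR m * h) h Hmu ltac:(lra) Hh) as TT.
      replace (INR m * h + h) with (INR (S m) * h) in TT by (rewrite S_INR; ring).
      assert (One : forall k, Rabs (IZR k * h) = INR (S m) * h ->
        Cmod (F (RtoC (IZR k * h)) * RtoC (sinc_basis k h x))%C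
        <= K * P * (Rpower (cosh (INR (S m) * h)) mu
                    * exp (- (mu * (PI * sinh (INR (S m) * h)))))).
      { intros k Hk; rewrite Cmod_mult, Cmod_R.
        rewrite <- Rmult_1_r; apply Rmult_le_compat;
          [apply Cmod_ge_0 | apply Rabs_pos | | apply sinc_basis_abs_le, Hh].
        eapply Rle_trans; [apply Breal|]; right.
        assert (S0 : 0 <= sinh (INR (S m) * h)).
        { left; apply sinh_pos; rewrite S_INR; nra. }
        rewrite <- Hk in *; revert S0; unfold Rabs at 1 3 4; destruct Rcase_abs; intros S0.
        - rewrite cosh_even, sinh_odd in *; rewrite Rabs_left1 by lra; reflexivity.
        - rewrite Rabs_right by lra; reflexivity. }
      eapply Rle_trans; [apply Cmod_triangle|].
      pose proof (One (Z.of_nat (S m))) as O1; pose proof (One (- Z.of_nat (S m))%Z) as O2.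
      assert (Pm : 0 <= INR (S m) * h) by (apply Rmult_le_pos; [apply pos_INR | lra]).
      specialize (O1 ltac:(rewrite <- INR_IZR_INZ, Rabs_right; lra)).
      specialize (O2 ltac:(rewrite opp_IZR, <- INR_IZR_INZ,
        <- Ropp_mult_distr_l, Rabs_Ropp, Rabs_right; lra)).
      apply Rle_trans with (2 * (K * P) / h
        * (Rpower (cosh (INR (S m) * h)) mu * exp (- (mu * (PI * sinh (INR (S m) * h)))) * h)).
      + replace (2 * (K * P) / h * (Rpower (cosh (INR (S m) * h)) mu
            * exp (- (mu * (PI * sinh (INR (S m) * h)))) * h))
          with (2 * (K * P * (Rpower (cosh (INR (S m) * h)) mu
                    * exp (- (mu * (PI * sinh (INR (S m) * h)))))))
          by (field; lra). lra.
      + eapply Rle_trans.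
        * apply Rmult_le_compat_l; [|exact TT].
          left; apply Rdiv_lt_0_compat; auto; repeat apply Rmult_lt_0_compat; lra.
        * right; unfold e; field; lra.
    - assert (E0 : e n = T) by (unfold e, T; rewrite Hnh; reflexivity).
      assert (0 <= e N); [|lra].
      unfold e; apply Rmult_le_pos.
      + apply Rdiv_le_0_compat; [apply Rmult_le_pos | apply Rmult_lt_0_compat]; lra.
      + apply Rdiv_le_0_compat; auto; apply Rmult_le_pos; [lra|].
        apply Rmult_le_pos; left; apply exp_pos. }
  set (bnd := 2 * M / (mu * PI * cos d) / (PI * d * sinh (PI * d / h))).
  assert (HS : 0 < sinh (PI * d / h))
    by (apply sinh_pos, Rdiv_lt_0_compat; auto; apply Rmult_lt_0_compat; lra).
  assert (Hpos : forall u v, 0 < u -> 0 < v -> 0 < u * v) by apply Rmult_lt_0_compat.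
  assert (HPI0 : 0 < PI) by lra.
  assert (Hka : 0 < mu * PI * cos d) by (apply Hpos; [apply Hpos|]; lra).
  assert (Hbnd : 0 <= bnd).
  { left; unfold bnd; apply Rdiv_lt_0_compat.
    - apply Rdiv_lt_0_compat; lra.
    - apply Hpos; auto; apply Hpos; lra. }
  assert (Hfinal : T + bnd <= err_const K d mu * exp (- (PI * d * INR n / L))).
  { assert (EP : Rpower PI (1 - mu) = PI / P).
    { unfold P; unfold Rminus; rewrite Rpower_plus, Rpower_1, Rpower_Ropp by lra; reflexivity. }
    assert (Hc : 0 < K * P / (PI * d * mu)).
    { apply Rdiv_lt_0_compat; [|apply Hpos; [apply Hpos|]]; auto; lra. }
    (* Both errors share the factor [K P / (PI d mu)], which is [K / (PI ^ (1 - mu) d mu)]; what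
       remains are the two constant estimates. *)
    unfold err_const; rewrite EP.
    assert (E1 : T = K * P / (PI * d * mu) * (2 * d * (Rpower (cosh L) (mu - 1)
                   * exp (- (mu * (PI * sinh L)))) / h)) by (unfold T; field; lra).
    assert (E2 : bnd = K * P / (PI * d * mu) * (/ PI * (2 / Rpower Q mu
                   / (cos d * sinh (PI * d / h)))))
      by (unfold bnd, M; field; repeat split; lra).
    rewrite E1, E2, <- Rmult_plus_distr_l.
    replace (K / (PI / P * d * mu)) with (K * P / (PI * d * mu)) by (field; lra).
    rewrite (Rmult_assoc (K * P / (PI * d * mu))).
    apply Rmult_le_compat_l; [lra|].
    rewrite Rmult_plus_distr_r, Rplus_comm; apply Rplus_le_compat; [|exact TC].
    apply Rle_trans with (/ PI * (4 / ((1 - exp (- (PI * mu * exp 1)))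
          * Rpower (cos (PI / 2 * sin d)) (2 * mu) * Rpower (cos d) (mu + 1))
          * exp (- (PI * d * INR n / L)))).
    - apply Rmult_le_compat_l; [left; apply Rinv_0_lt_compat; lra | exact CC].
    - right; field.
      assert (exp (- (PI * mu * exp 1)) < 1).
      { rewrite <- exp_0 at 2; apply exp_increasing.
        assert (0 < PI * mu * exp 1); [|lra].
        apply Hpos; [apply Hpos; lra | apply exp_pos]. }
      pose proof (exp_pos ((mu + 1) * ln (cos d))).
      pose proof (exp_pos (2 * mu * ln (cos (PI / 2 * sin d)))).
      unfold Rpower; repeat split; lra. }
  apply (proj2 (Lub_Rbar_correct _)); intros y [t [Ht ->]]; simpl.
  eapply Rle_trans; [|exact Hfinal].
  set (x := psi_inv t); unfold sinc_error, on_half_line; fold x.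
  rewrite (sum_sym_ext n _ (fun k => F (RtoC (IZR k * h)) * RtoC (sinc_basis k h x))%C)
    by (intros k; rewrite Hinv; reflexivity).
  (* At a node [x = j h], [F x] equals every symmetric sinc sum of order at least [|j|], so the
     error is a mere tail, at most [T]. Elsewhere the contour argument applies. *)
  destruct (classic (exists j, x = IZR j * h)) as [[j Hj]|Hoff].
  - assert (HT : Cmod (F (RtoC x) - sum_sym n (fun k => F (RtoC (IZR k * h))
                         * RtoC (sinc_basis k h x)))%C <= T); [|lra].
    replace (F (RtoC x)) with (sum_sym (Nat.max n (Z.to_nat (Z.abs j)))
      (fun k => F (RtoC (IZR k * h)) * RtoC (sinc_basis k h x))%C).
    + apply Tail; lia.
    + rewrite (sum_sym_single _ _ j); [| |lia].
      * rewrite Hj, sinc_basis_node; ring.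
      * intros k Hk; rewrite Hj, sinc_basis_grid by auto; ring.
  - apply (sinc_error_off_grid F d h M (mu * PI * cos d) T x n); auto; try lra.
    intros k Hk; apply Hoff; exists k; exact Hk.
Qed.
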